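(* (ZO-PAGE-ED, pure coordinate-wise estimators, finite-sum case.) Consider ZOMA with pure CW estimators and the ED matrices (context), $W$ positive semidefinite, under the PL, expected-smoothness, bounded-variance and network assumptions of the context. Set $$B=N,\ b=b_0=\sqrt{\tfrac NK},\ p=\tfrac1{\sqrt{NK}},\ \beta=0,\ \eta_x=\mathcal O\Big(\tfrac{(1-\lambda)^{1.5}}{\kappa^2}\Big),\ \eta_y=\mathcal O\big((1-\lambda)^{1.5}\big),\ \delta_x=\mathcal O\Big(\tfrac1{d_1^{1/2}(1-\lambda)^{3/4}T^{1/2}}\Big),\ \delta_y=\mathcal O\Big(\tfrac1{d_2^{1/2}(1-\lambda)^{3/4}T^{1/2}}\Big).$$ Then $$\frac1T\sum_{i=0}^{T-1}\big(\mathbb E\|\nabla_xJ(x_{c,i},y_{c,i})\|^2+\mathbb E\|\nabla_yJ(x_{c,i},y_{c,i})\|^2\big)\le\mathcal O\Big(\frac{\kappa^2(\Delta_0'+1)}{(1-\lambda)^{1.5}T}+\frac{\kappa^2(1-\lambda)\zeta_0^2}T+\frac{\kappa^2\lambda^2\sqrt K\sigma^2}{\sqrt NT}+\frac{\kappa^2\sigma^2}T\Big).$$ The dominant communication complexity and per-agent function query complexity for accuracy $\varepsilon$ are $$CC\approx\mathcal O\Big(\frac{\kappa^2\varepsilon^{-2}}{(1-\lambda)^{1.5}}+\kappa^2\varepsilon^{-2}\Big),\qquad FC\approx(CC\times p\times B+b_0)\times2d+CC\times(1-p)\times b\times4d\approx\mathcal O\Big(\frac{d\kappa^2\sqrt N\varepsilon^{-2}}{\sqrt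 K(1-\lambda)^{1.5}}+d\sqrt{\tfrac NK}\Big).$$
   Context: Problem. $K\ge2$ agents; $d=d_1+d_2$; $z=(x,y)\in\mathbb R^{d_1}\times\mathbb R^{d_2}$; $J=\frac1K\sum_{k=1}^KJ_k$, $J_k(z)=\frac1N\sum_{s=1}^NQ_k(z;\zeta_k(s))$ (finite-sum case); $\xi_k$ denotes a uniform draw from $\{\zeta_k(1),\dots,\zeta_k(N)\}$. $P(x)=\max_yJ(x,y)$, $P^\star=\inf_xP(x)$. PL assumption: $\|\nabla_yJ(x,y)\|^2\ge2\nu(\max_{y'}J(x,y')-J(x,y))$ for all $x,y$, $\nu>0$; $P^\star>-\infty$ ($J$ nonconvex in $x$, nonconcave in $y$). Expected smoothness: $Q_k(\cdot;\xi)$ is $C^1$, $\mathbb E\|\nabla_wQ_k(z;\xi_k)-\nabla_wQ_k(z';\xi_k)\|^2\le L_f^2\|z-z'\|^2$, $w\in\{x,y\}$. $\kappa=L_f/\nu$. Bounded variance: $\mathbb E\nabla_wQ_k(z;\xi_k)=\nabla_wJ_k(z)$, $\mathbb E\|\nabla_wQ_k(z;\xi_k)-\nabla_wJ_k(z)\|^2\le\sigma^2$; samples are spatially and temporally i.i.d. CW estimators: $q_k^x(z;\xi,0)=\sum_{j=1}^{d_1}\frac{Q_k(x+\delta_xe_j,y;\xi)-Q_k(x-\delta_xe_j,y;\xi)}{2\delta_x}e_j$, with $e_j$ the canonical basis vectors; $q_k^y(z;\xi,0)$ analogously, perturbing $y\in\mathbb R^{d_2}$ with $\delta_y$. ZOMA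 (pure CW). Parameters $p,\beta\in[0,1]$, learning rates $\eta_x,\eta_y$, batch sizes $b,B,b_0$, number of rounds $T$. For $w\in\{x,y\}$: $g^w_{k,0}=\frac1{b_0}\sum_{j=1}^{b_0}q^w_k(z_{k,0};\xi^j_{k,0},0)$; for $i\ge1$, with $\pi_i\sim\mathrm{Bernoulli}(p)$ common to all agents, $g^w_{k,i}=\frac1B\sum_{j=1}^Bq^w_k(z_{k,i};\xi^j_{k,i},0)$ if $\pi_i=1$ (samples drawn uniformly without replacement) and $g^w_{k,i}=(1-\beta)[g^w_{k,i-1}-\frac1b\sum_{j=1}^bq^w_k(z_{k,i-1};\xi^j_{k,i},0)]+\frac1b\sum_{j=1}^bq^w_k(z_{k,i};\xi^j_{k,i},0)$ if $\pi_i=0$; except when $\pi_i=1$, samples are i.i.d. With stacked vectors $\mathcal X_i=\mathrm{col}\{x_{k,i}\}$, $\mathcal Y_i=\mathrm{col}\{y_{k,i}\}$, $\mathcal G_{w,i}=\mathrm{col}\{g^w_{k,i}\}$: $\mathcal X_{i+1}=\mathcal A_x(\mathcal C_x\mathcal X_i-\eta_x\mathcal G_{x,i})-\mathcal B_x\mathcal D_{x,i}$, $\mathcal D_{x,i+1}=\mathcal D_{x,i}+\mathcal B_x\mathcal X_{i+1}$, $\mathcal Y_{i+1}=\mathcal A_y(\mathcal C_y\mathcal Y_i+\eta_y\mathcal G_{y,i})-\mathcal B_y\mathcal D_{y,i}$, $\mathcal D_{y,i+1}=\mathcal D_{y,i}+\mathcal B_y\mathcal Y_{i+1}$, with identical initial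 points at all agents and $\mathcal B_x\mathcal D_{x,0}=0$, $\mathcal B_y\mathcal D_{y,0}=0$. $x_{c,i},y_{c,i}$ are the averages of $x_{k,i},y_{k,i}$ over agents. Network assumption and ED: $W\in\mathbb R^{K\times K}$ symmetric, doubly stochastic, primitive; $\lambda$ is its second largest eigenvalue in magnitude. ED (exact diffusion): $\mathcal A_x=W\otimes I_{d_1}$, $\mathcal B_x=(I-W\otimes I_{d_1})^{1/2}$, $\mathcal C_x=I$ (same for $y$ with $d_2$). Quantities and conventions. $\Delta_0'=\mathbb E[(P(x_{c,0})-P^\star)+(P(x_{c,0})-J(x_{c,0},y_{c,0}))]$; $\zeta_0^2=\frac1K\mathbb E\|(\mathcal A_x-\frac1K\mathbf 1\mathbf 1^\top\otimes I_{d_1})\mathcal G_{x,0}\|^2+\frac1K\mathbb E\|(\mathcal A_y-\frac1K\mathbf 1\mathbf 1^\top\otimes I_{d_2})\mathcal G_{y,0}\|^2$. ''$h=\mathcal O(e)$'' for a hyperparameter means $h$ is chosen of order $e$, with a suitable constant (integer rounding of batch sizes ignored). The $\mathcal O$ in the bound suppresses numerical constants, $L_f$, and the norms of the matrices $\widehat{\mathcal Q},\widehat{\mathcal Q}^{-1}$ in a factorization $\begin{bmatrix}\widehat\Lambda_a\widehat\Lambda_c-\widehat\Lambda_b^2&-\widehat\Lambda_b\\ \widehat\Lambda_b&I\end{bmatrix}=\widehat{\mathcal Q}\mathcal T\widehat{\mathcal Q}^{-1}$, $\|\mathcal T\|<1$, where $\widehat\Lambda_a,\widehat\Lambda_b,\widehat\Lambda_c$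 are the diagonal matrices of eigenvalues of $\mathcal A,\mathcal B,\mathcal C$ on the orthogonal complement of the consensus space (for $x$ and $y$). $CC$ is the number $T$ of rounds for the averaged squared gradient norm to reach order $\varepsilon^2$, and $FC$ the corresponding number of function evaluations per agent: a CW gradient pair costs $2d$ evaluations per sample at one point, $4d$ at two points; $\sigma,\Delta_0',\zeta_0$ are treated as constants in $CC,FC$.
   Formalization: It is assumed that ν ≤ L_f (κ ≥ 1; automatic unless J is constant in y, where the bound can fail), and, for CC and FC only, that K ≤ N and 0 < ε ≤ 1, since otherwise the batch size √(N/K) is below 1; batch sizes are rounded up. *)

(* Defs.v *)
From HB Require Import structures.
From mathcomp Require Export all_boot all_order all_algebra.
From mathcomp Require Export mxtens.
From mathcomp Require Export all_classical all_reals all_analysis.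

Set Implicit Arguments.
Unset Strict Implicit.
Unset Printing Implicit Defensive.
Import Order.TTheory GRing.Theory Num.Theory.
Import numFieldNormedType.Exports.
Local Open Scope classical_set_scope.
Local Open Scope ring_scope.

(* The norm that the library puts on matrices is the sup norm; it gives the
   right notions of continuity and differentiability, but all quantitative
   assumptions use the Euclidean norm below. *)
Definition sqnorm {R : realType} {n : nat} (v : 'cV[R]_n) : R :=
  \sum_(j < n) v j 0 ^+ 2.

Definition sqnorm2 {R : realType} {d1 d2 : nat}
    (z : 'cV[R]_d1 * 'cV[R]_d2) : R :=
  sqnorm z.1 + sqnorm z.2.

Definition opnorm {R : realType} {m n : nat} (M : 'M[R]_(m, n)) : R :=
  sup [set Num.sqrt (sqnorm (M *m v)) | v in [set v : 'cV[R]_n | sqnorm v <= 1]].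

Definition grad_x {R : realType} {d1 d2 : nat}
    (f : 'cV[R]_d1 * 'cV[R]_d2 -> R) (z : 'cV[R]_d1 * 'cV[R]_d2) : 'cV[R]_d1 :=
  \col_(j < d1) 'D_((delta_mx j 0, 0)) f z.

Definition grad_y {R : realType} {d1 d2 : nat}
    (f : 'cV[R]_d1 * 'cV[R]_d2 -> R) (z : 'cV[R]_d1 * 'cV[R]_d2) : 'cV[R]_d2 :=
  \col_(j < d2) 'D_((0, delta_mx j 0)) f z.

Definition continuously_differentiable {R : realType} {d1 d2 : nat}
    (f : 'cV[R]_d1 * 'cV[R]_d2 -> R) : Prop :=
  [/\ forall z, differentiable f z, continuous (grad_x f)
    & continuous (grad_y f)].

(* [loss R K N d1 d2] is the type of the sample losses: [Q k s z] stands for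
   Q_k(z; zeta_k(s)); a random sample of agent k is a random index s. *)
Definition loss (R : realType) (K N d1 d2 : nat) : Type :=
  'I_K -> 'I_N -> 'cV[R]_d1 * 'cV[R]_d2 -> R.

(* Also the expectation under a uniform draw of the sample index. *)
Definition mean {R : realType} {V : lmodType R} {N : nat} (F : 'I_N -> V) : V :=
  N%:R^-1 *: \sum_(s < N) F s.

Definition Jloc {R : realType} {K N d1 d2 : nat} (Q : loss R K N d1 d2)
    (k : 'I_K) (z : 'cV[R]_d1 * 'cV[R]_d2) : R :=
  mean (fun s => Q k s z : R^o).

Definition Jglob {R : realType} {K N d1 d2 : nat} (Q : loss R K N d1 d2)
    (z : 'cV[R]_d1 * 'cV[R]_d2) : R :=
  mean (fun k => Jloc Q k z : R^o).

Definition Pmax {R : realType} {K N d1 d2 : nat} (Q : loss R K N d1 d2)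
    (x : 'cV[R]_d1) : R :=
  sup (range (fun y => Jglob Q (x, y))).

Definition Pstar {R : realType} {K N d1 d2 : nat} (Q : loss R K N d1 d2) : R :=
  inf (range (Pmax Q)).

Definition PL_condition {R : realType} {K N d1 d2 : nat}
    (Q : loss R K N d1 d2) (nu : R) : Prop :=
  [/\ 0 < nu,
      (* the supremum defining [Pmax] is a maximum *)
      forall x, exists y', forall y, Jglob Q (x, y) <= Jglob Q (x, y'),
      forall z, 2 * nu * (Pmax Q z.1 - Jglob Q z) <= sqnorm (grad_y (Jglob Q) z)
    & has_lbound (range (Pmax Q)) ].

Definition expected_smoothness {R : realType} {K N d1 d2 : nat}
    (Q : loss R K N d1 d2) (Lf : R) : Prop :=
  [/\ forall k s, continuously_differentiable (Q k s),
      forall k z z',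
        mean (fun s => sqnorm (grad_x (Q k s) z - grad_x (Q k s) z') : R^o)
          <= Lf ^+ 2 * sqnorm2 (z - z')
    & forall k z z',
        mean (fun s => sqnorm (grad_y (Q k s) z - grad_y (Q k s) z') : R^o)
          <= Lf ^+ 2 * sqnorm2 (z - z')].

Definition bounded_variance {R : realType} {K N d1 d2 : nat}
    (Q : loss R K N d1 d2) (sigma : R) : Prop :=
  [/\ forall k z, mean (fun s => grad_x (Q k s) z) = grad_x (Jloc Q k) z,
      forall k z, mean (fun s => grad_y (Q k s) z) = grad_y (Jloc Q k) z,
      forall k z,
        mean (fun s => sqnorm (grad_x (Q k s) z - grad_x (Jloc Q k) z) : R^o)
          <= sigma ^+ 2
    & forall k z,
        mean (fun s => sqnorm (grad_y (Q k s) z - grad_y (Jloc Q k) z) : R^o)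
          <= sigma ^+ 2].

Definition cw_x {R : realType} {d1 d2 : nat} (delta : R)
    (f : 'cV[R]_d1 * 'cV[R]_d2 -> R) (z : 'cV[R]_d1 * 'cV[R]_d2) : 'cV[R]_d1 :=
  \sum_(j < d1)
    ((f (z.1 + delta *: delta_mx j 0, z.2) - f (z.1 - delta *: delta_mx j 0, z.2))
       / (2 * delta)) *: delta_mx j 0.

Definition cw_y {R : realType} {d1 d2 : nat} (delta : R)
    (f : 'cV[R]_d1 * 'cV[R]_d2 -> R) (z : 'cV[R]_d1 * 'cV[R]_d2) : 'cV[R]_d2 :=
  \sum_(j < d2)
    ((f (z.1, z.2 + delta *: delta_mx j 0) - f (z.1, z.2 - delta *: delta_mx j 0))
       / (2 * delta)) *: delta_mx j 0.

(* R^(K d) is indexed agent by agent, as in the library's Kronecker product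
   [*t], so that [W *t 1%:M] acts on stacked vectors. *)
Definition stack {R : realType} {K d : nat} (u : 'I_K -> 'cV[R]_d) :
    'cV[R]_(K * d) :=
  \col_i u (mxtens_unindex i).1 (mxtens_unindex i).2 0.

Definition agent {R : realType} {K d : nat} (X : 'cV[R]_(K * d)) (k : 'I_K) :
    'cV[R]_d :=
  \col_j X (mxtens_index (k, j)) 0.

Definition averaging (R : realType) (K d : nat) : 'M[R]_(K * d) :=
  (const_mx K%:R^-1 : 'M[R]_K) *t (1%:M : 'M[R]_d).

Definition psd {R : realType} {n : nat} (M : 'M[R]_n) : Prop :=
  M^T = M /\ forall v : 'cV[R]_n, 0 <= (v^T *m M *m v) 0 0.

Definition is_sqrtmx {R : realType} {n : nat} (S M : 'M[R]_n) : Prop :=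
  psd S /\ S *m S = M.

Definition network_matrix {R : realType} {K : nat} (W : 'M[R]_K) : Prop :=
  [/\ W^T = W, forall k l, 0 <= W k l, forall k, \sum_l W k l = 1,
      forall l, \sum_k W k l = 1
    & exists m : nat, forall k l, 0 < (W ^+ m) k l].

(* [s] lists the eigenvalues with multiplicity; [lam] is the magnitude of the
   second one in order of decreasing magnitude. *)
Definition second_eigenvalue {R : realType} {K : nat} (W : 'M[R]_K) (lam : R) :
    Prop :=
  exists s : seq R,
    [/\ char_poly W = \prod_(a <- s) ('X - a%:P),
        sorted (fun a b : R => `|b| <= `|a|) s & lam = `|s`_1|].

(* The columns of [U] are an orthonormal basis of the orthogonal complement of
   the consensus space { 1 (x) v } made of common eigenvectors of A, B, C;
   [La], [Lb], [Lc] are the corresponding eigenvalues. *)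
Definition complement_spectrum {R : realType} {K d : nat}
    (A B C : 'M[R]_(K * d)) (U : 'M[R]_(K * d, K.-1 * d))
    (La Lb Lc : 'rV[R]_(K.-1 * d)) : Prop :=
  [/\ U^T *m U = 1%:M,
      ((const_mx 1 : 'cV[R]_K) *t (1%:M : 'M[R]_d))^T *m U = 0,
      A *m U = U *m diag_mx La,
      B *m U = U *m diag_mx Lb
    & C *m U = U *m diag_mx Lc].

Definition transition_factorization {R : realType} {n : nat}
    (La Lb Lc : 'rV[R]_n) (Qh T : 'M[R]_(n + n)) : Prop :=
  [/\ Qh \in unitmx, opnorm T < 1
    & block_mx (diag_mx La *m diag_mx Lc - diag_mx Lb *m diag_mx Lb)
               (- diag_mx Lb) (diag_mx Lb) 1%:M
      = Qh *m T *m invmx Qh].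

Definition factorization_bound {R : realType} {K d : nat} (q : R)
    (A B C : 'M[R]_(K * d)) : Prop :=
  exists (U : 'M[R]_(K * d, K.-1 * d)) (La Lb Lc : 'rV[R]_(K.-1 * d))
         (Qh T : 'M[R]_(K.-1 * d + K.-1 * d)),
    [/\ complement_spectrum A B C U La Lb Lc,
        transition_factorization La Lb Lc Qh T,
        opnorm Qh <= q & opnorm (invmx Qh) <= q].

(* [coin i], [large k i] and [small k i] are used at round i.+1. *)
Record noise (K N b B b0 : nat) := Noise {
  coin  : nat -> bool;
  large : 'I_K -> nat -> {ffun 'I_B -> 'I_N};
  small : 'I_K -> nat -> 'I_b -> 'I_N;
  first : 'I_K -> 'I_b0 -> 'I_N }.

(* In order: initial point, coins, large batches, small-batch samples, initial
   samples. *)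
Definition source (K b b0 : nat) : eqType :=
  (unit + nat + ('I_K * nat) + ('I_K * nat * 'I_b) + ('I_K * 'I_b0))%type.

Definition events {Om V : Type} (G : set (set V)) (X : Om -> V) : set (set Om) :=
  [set X @^-1` A | A in G].

(* The initial point carries the Borel sigma-algebra; all other sources are
   discrete. *)
Definition source_events {R : realType} {K N b B b0 d1 d2 : nat} {Om : Type}
    (z0 : Om -> 'cV[R]_d1 * 'cV[R]_d2) (xi : Om -> noise K N b B b0)
    (a : source K b b0) : set (set Om) :=
  match a with
  | inl (inl (inl (inl _))) =>
      events <<s (open : set (set ('cV[R]_d1 * 'cV[R]_d2))) >> z0
  | inl (inl (inl (inr i))) => events setT (fun w => coin (xi w) i)
  | inl (inl (inr (k, i))) => events setT (fun w => large (xi w) k i)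
  | inl (inr (k, i, j)) => events setT (fun w => small (xi w) k i j)
  | inr (k, j) => events setT (fun w => first (xi w) k j)
  end.

Definition mutually_independent {d} {Om : measurableType d} {R : realType}
    (P : probability Om R) (I : eqType) (F : I -> set (set Om)) : Prop :=
  (forall a, F a `<=` measurable) /\
  forall (s : seq I) (E : I -> set Om), uniq s -> (forall a, F a (E a)) ->
    P (\big[setI/setT]_(a <- s) E a) = (\prod_(a <- s) P (E a))%E.

(* A large batch is a draw without replacement: uniform over the injections,
   of which there are N (N - 1) ... (N - B + 1). *)
Definition noise_law {d} {Om : measurableType d} {R : realType}
    (P : probability Om R) {K N b B b0 d1 d2 : nat} (p : R)
    (z0 : Om -> 'cV[R]_d1 * 'cV[R]_d2) (xi : Om -> noise K N b B b0) : Prop :=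
  [/\ mutually_independent P (source_events z0 xi),
      forall i, P [set w | coin (xi w) i] = p%:E,
      forall k i (f : {ffun 'I_B -> 'I_N}),
        P [set w | large (xi w) k i = f]
          = (if injectiveb f then (N ^_ B)%:R^-1 else 0)%:E,
      forall k i j s, P [set w | small (xi w) k i j = s] = (N%:R^-1)%:E
    & forall k j s, P [set w | first (xi w) k j = s] = (N%:R^-1)%:E].

Record params (R : realType) (K d1 d2 : nat) := Params {
  par_p : R;
  par_beta : R;
  eta_x : R;
  eta_y : R;
  delta_x : R;
  delta_y : R;
  mat_Ax : 'M[R]_(K * d1);
  mat_Bx : 'M[R]_(K * d1);
  mat_Cx : 'M[R]_(K * d1);
  mat_Ay : 'M[R]_(K * d2);
  mat_By : 'M[R]_(K * d2);
  mat_Cy : 'M[R]_(K * d2) }.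

Record state (R : realType) (K d1 d2 : nat) := State {
  st_x  : 'cV[R]_(K * d1);
  st_y  : 'cV[R]_(K * d2);
  st_gx : 'cV[R]_(K * d1);
  st_gy : 'cV[R]_(K * d2);
  st_dx : 'cV[R]_(K * d1);
  st_dy : 'cV[R]_(K * d2) }.

Definition batch_mean {R : realType} {N m d : nat} (draw : 'I_m -> 'I_N)
    (q : 'I_N -> 'cV[R]_d) : 'cV[R]_d :=
  m%:R^-1 *: \sum_(j < m) q (draw j).

(* [gr z s] is the gradient estimate at z from sample s, [z'] the previous
   point and [g] the previous estimator. *)
Definition next_estimator {R : realType} {N b B d1 d2 d : nat} (beta : R)
    (c : bool) (lg : 'I_B -> 'I_N) (sm : 'I_b -> 'I_N)
    (gr : 'cV[R]_d1 * 'cV[R]_d2 -> 'I_N -> 'cV[R]_d)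
    (z' z : 'cV[R]_d1 * 'cV[R]_d2) (g : 'cV[R]_d) : 'cV[R]_d :=
  if c then batch_mean lg (gr z)
  else (1 - beta) *: (g - batch_mean sm (gr z')) + batch_mean sm (gr z).

Definition agent_z {R : realType} {K d1 d2 : nat} (X : 'cV[R]_(K * d1))
    (Y : 'cV[R]_(K * d2)) (k : 'I_K) : 'cV[R]_d1 * 'cV[R]_d2 :=
  (agent X k, agent Y k).

Definition zoma_init {R : realType} {K N b B b0 d1 d2 : nat}
    (Q : loss R K N d1 d2) (prm : params R K d1 d2)
    (z0 : 'cV[R]_d1 * 'cV[R]_d2) (Dx0 : 'cV[R]_(K * d1)) (Dy0 : 'cV[R]_(K * d2))
    (xi : noise K N b B b0) : state R K d1 d2 :=
  {| st_x := stack (fun=> z0.1);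
     st_y := stack (fun=> z0.2);
     st_gx := stack (fun k =>
       batch_mean (first xi k) (fun s => cw_x (delta_x prm) (Q k s) z0));
     st_gy := stack (fun k =>
       batch_mean (first xi k) (fun s => cw_y (delta_y prm) (Q k s) z0));
     st_dx := Dx0;
     st_dy := Dy0 |}.

(* From round i to round i.+1; the coin and the samples of round i.+1 are
   shared by the x- and y-estimators. *)
Definition zoma_step {R : realType} {K N b B b0 d1 d2 : nat}
    (Q : loss R K N d1 d2) (prm : params R K d1 d2) (xi : noise K N b B b0)
    (i : nat) (st : state R K d1 d2) : state R K d1 d2 :=
  let X := mat_Ax prm *m (mat_Cx prm *m st_x st - eta_x prm *: st_gx st)
             - mat_Bx prm *m st_dx st in
  let Y := mat_Ay prm *m (mat_Cy prm *m st_y st + eta_y prm *: st_gy st)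
             - mat_By prm *m st_dy st in
  {| st_x := X;
     st_y := Y;
     st_gx := stack (fun k =>
       next_estimator (par_beta prm) (coin xi i) (large xi k i) (small xi k i)
         (fun z s => cw_x (delta_x prm) (Q k s) z)
         (agent_z (st_x st) (st_y st) k) (agent_z X Y k) (agent (st_gx st) k));
     st_gy := stack (fun k =>
       next_estimator (par_beta prm) (coin xi i) (large xi k i) (small xi k i)
         (fun z s => cw_y (delta_y prm) (Q k s) z)
         (agent_z (st_x st) (st_y st) k) (agent_z X Y k) (agent (st_gy st) k));
     st_dx := st_dx st + mat_Bx prm *m X;
     st_dy := st_dy st + mat_By prm *m Y |}.

Fixpoint zoma {R : realType} {K N b B b0 d1 d2 : nat}
    (Q : loss R K N d1 d2) (prm : params R K d1 d2)
    (z0 : 'cV[R]_d1 * 'cV[R]_d2) (Dx0 : 'cV[R]_(K * d1)) (Dy0 : 'cV[R]_(K * d2))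
    (xi : noise K N b B b0) (i : nat) : state R K d1 d2 :=
  if i is i'.+1 then zoma_step Q prm xi i' (zoma Q prm z0 Dx0 Dy0 xi i')
  else zoma_init Q prm z0 Dx0 Dy0 xi.

Definition centroid {R : realType} {K d1 d2 : nat} (st : state R K d1 d2) :
    'cV[R]_d1 * 'cV[R]_d2 :=
  (mean (agent (st_x st)), mean (agent (st_y st))).

Definition avg_sqgrad {d} {Om : measurableType d} {R : realType}
    (P : probability Om R) {K N d1 d2 : nat} (Q : loss R K N d1 d2)
    (run : Om -> nat -> state R K d1 d2) (T : nat) : \bar R :=
  ((T%:R^-1)%:E * \sum_(i < T)
     ('E_P[fun w => sqnorm (grad_x (Jglob Q) (centroid (run w i)))]
      + 'E_P[fun w => sqnorm (grad_y (Jglob Q) (centroid (run w i)))]))%E.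

Definition Delta0 {d} {Om : measurableType d} {R : realType}
    (P : probability Om R) {K N d1 d2 : nat} (Q : loss R K N d1 d2)
    (run : Om -> nat -> state R K d1 d2) : \bar R :=
  ('E_P[fun w => let z := centroid (run w 0%N) in
         ((Pmax Q z.1 - Pstar Q) + (Pmax Q z.1 - Jglob Q z))%R])%E.

Definition zeta0_sq {d} {Om : measurableType d} {R : realType}
    (P : probability Om R) {K d1 d2 : nat} (prm : params R K d1 d2)
    (run : Om -> nat -> state R K d1 d2) : \bar R :=
  ((K%:R^-1)%:E *
     'E_P[fun w => sqnorm ((mat_Ax prm - averaging R K d1) *m st_gx (run w 0%N))%R]
   + (K%:R^-1)%:E *
     'E_P[fun w => sqnorm ((mat_Ay prm - averaging R K d2) *m st_gy (run w 0%N))%R])%E.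

(* [T] is the least number of rounds after which the bound e^2 is met; the algorithm
   may depend on the number of rounds it is run for, so [avg T] is the averaged
   squared gradient norm of the T-round algorithm. *)
Definition communication_complexity {R : realType} (avg : nat -> \bar R) (e : R)
    (T : nat) : Prop :=
  [/\ (0 < T)%N, (avg T <= (e ^+ 2)%:E)%E
    & forall T', (0 < T' < T)%N -> ~ (avg T' <= (e ^+ 2)%:E)%E].

(* Per agent: 2 (d1 + d2) evaluations for a pair of gradient estimates at one
   point, twice that at two points. *)
Definition function_queries {R : realType} (CC : nat) (p : R)
    (b B b0 d1 d2 : nat) : R :=
  (CC%:R * p * B%:R + b0%:R) * (2 * (d1 + d2)%:R)
  + CC%:R * (1 - p) * b%:R * (4 * (d1 + d2)%:R).

(* Main.v *)
(* The Lyapunov function is the merit (P - P_star) + (P - J) at the centroid, plus eta_y times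
   a weighted sum of the squared error of the averaged estimator, of the mean squared error
   of the individual estimators, of the consensus error and of an energy of the
   exact-diffusion recursion.
   - Under the PL condition a maximiser in y lies within 2 |grad_y J| / nu of y up to
     arbitrarily small loss, so P obeys a descent inequality along x and one round decreases
     the merit up to the estimation error.
   - In an eigenbasis of W exact diffusion splits into 2x2 systems; W being positive
     semidefinite, each of them contracts a quadratic form by the factor (1 + lam) / 2.
   - The error of the averaged estimator shrinks by 1 - p per round, and p b K >= 1 lets this
     absorb the variance that the increments create.
   For a fixed initial point telescoping gives the rate. The noise of finitely many rounds
   takes finitely many values and is independent of the initial point, so an expectation is
   a finite weighted sum over noise histories, integrated over the initial point; the state
   depends continuously on that point and P is lower semicontinuous, hence everything is
   Borel. *)
Require Import Defs.
From mathcomp Require Import ring lra measurable_realfun.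
Import Order.TTheory GRing.Theory Num.Theory.
Import numFieldNormedType.Exports.
Local Open Scope classical_set_scope.
Local Open Scope ring_scope.

Set Implicit Arguments.
Unset Strict Implicit.
Unset Printing Implicit Defensive.

(** * Euclidean norms and means *)

(** Two balances dictate the step sizes. When [x] moves, the maximiser in [y] drifts, at a cost of
    order [kappa^2 etax |grad_y J|^2]; the ascent in [y] gains [etay |grad_y J|^2]. So [etax] is of
    order [etay / kappa^2], and dividing the telescoped bound by [etax] puts [kappa^2] in front of
    every term of the rate. On the network side the energy contracts only at rate [(1 - lam) / 2],
    bounds the disagreement only after division by [1 - lam], and is driven with the factor
    [3 / (1 - lam)]. Each of the three costs one power of [1 - lam], so [etay^2 / (1 - lam)^3] has
    to stay bounded, whence [etay] of order [(1 - lam)^(3/2)].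

    The individual estimation errors are tracked besides the averaged one because every agent's own
    estimator drives the energy, while the gain of a factor [K] from averaging is available only at
    the centroid. They can be tracked cheaply: the probability [p] that limits their decay also
    limits their influence on the energy. *)

Definition dot {R : realType} {n : nat} (u v : 'cV[R]_n) : R :=
  \sum_(j < n) u j 0 * v j 0.

Section Euclidean.
Context {R : realType} {n : nat}.
Implicit Types u v w : 'cV[R]_n.

Lemma dotC u v : dot u v = dot v u.
Proof. by apply: eq_bigr => j _; rewrite mulrC. Qed.

Lemma dotDl u v w : dot (u + v) w = dot u w + dot v w.
Proof. by rewrite -big_split; apply: eq_bigr => j _; rewrite mxE mulrDl. Qed.

Lemma dotDr u v w : dot w (u + v) = dot w u + dot w v.
Proof. by rewrite !(dotC w) dotDl. Qed.

Lemma dotZl a u v : dot (a *: u) v = a * dot u v.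
Proof. by rewrite mulr_sumr; apply: eq_bigr => j _; rewrite mxE mulrA. Qed.

Lemma dotZr a u v : dot u (a *: v) = a * dot u v.
Proof. by rewrite dotC dotZl dotC. Qed.

Lemma dotNl u v : dot (- u) v = - dot u v.
Proof. by rewrite -scaleN1r dotZl mulN1r. Qed.

Lemma dotNr u v : dot u (- v) = - dot u v.
Proof. by rewrite dotC dotNl dotC. Qed.

Lemma dotBl u v w : dot (u - v) w = dot u w - dot v w.
Proof. by rewrite dotDl dotNl. Qed.

Lemma dot0l u : dot 0 u = 0.
Proof. by rewrite -(scale0r (0 : 'cV[R]_n)) dotZl mul0r. Qed.

Lemma dot_suml (I : Type) (r : seq I) (P : pred I) (F : I -> 'cV[R]_n) v :
  dot (\sum_(i <- r | P i) F i) v = \sum_(i <- r | P i) dot (F i) v.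
Proof.
by elim/big_rec2: _ => [|i y1 y2 _ <-]; rewrite ?dot0l // dotDl.
Qed.

Lemma dot_sumr (I : Type) (r : seq I) (P : pred I) (F : I -> 'cV[R]_n) v :
  dot v (\sum_(i <- r | P i) F i) = \sum_(i <- r | P i) dot v (F i).
Proof. by rewrite dotC dot_suml; apply: eq_bigr => i _; rewrite dotC. Qed.

Lemma sqnormE v : sqnorm v = dot v v.
Proof. by apply: eq_bigr => j _; rewrite expr2. Qed.

Lemma sqnorm_mulmx v : sqnorm v = (v^T *m v) 0 0.
Proof. by rewrite mxE; apply: eq_bigr => j _; rewrite mxE expr2. Qed.

Lemma sqnorm_ge0 v : 0 <= sqnorm v.
Proof. by apply: sumr_ge0 => j _; rewrite sqr_ge0. Qed.

Lemma sqnorm0 : sqnorm (0 : 'cV[R]_n) = 0.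
Proof. by rewrite sqnormE dot0l. Qed.

Lemma sqnormZ a v : sqnorm (a *: v) = a ^+ 2 * sqnorm v.
Proof. by rewrite !sqnormE dotZl dotZr mulrA expr2. Qed.

Lemma sqnormN v : sqnorm (- v) = sqnorm v.
Proof. by rewrite -scaleN1r sqnormZ sqrrN expr1n mul1r. Qed.

Lemma sqnormD u v : sqnorm (u + v) = sqnorm u + 2 * dot u v + sqnorm v.
Proof. rewrite !sqnormE dotDl !dotDr (dotC v u); ring. Qed.

Lemma sqnormB u v : sqnorm (u - v) = sqnorm u - 2 * dot u v + sqnorm v.
Proof. rewrite sqnormD dotNr sqnormN; ring. Qed.

Lemma sqnormBC u v : sqnorm (u - v) = sqnorm (v - u).
Proof. by rewrite -opprB sqnormN. Qed.

Lemma dot_young (a : R) u v : 0 < a ->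
  2 * dot u v <= a^-1 * sqnorm u + a * sqnorm v.
Proof.
move=> a0; have := sqnorm_ge0 (u - a *: v).
rewrite sqnormB sqnormZ dotZr => h.
rewrite -(ler_pM2l a0) mulrDr !mulrA divff ?gt_eqF // mul1r.
rewrite -expr2; lra.
Qed.

Lemma sqnormD_le2 u v : sqnorm (u + v) <= 2 * sqnorm u + 2 * sqnorm v.
Proof.
by have := dot_young u v (ltr01 : (0 : R) < 1); rewrite sqnormD invr1; lra.
Qed.

Lemma sqnormB_le2 u v : sqnorm (u - v) <= 2 * sqnorm u + 2 * sqnorm v.
Proof. by rewrite -(sqnormN v) sqnormD_le2. Qed.

Lemma sqnormD_le3 u v w :
  sqnorm (u + v + w) <= 3 * sqnorm u + 3 * sqnorm v + 3 * sqnorm w.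
Proof.
have l01 : (0 : R) < 1 by [].
have := dot_young u v l01; have := dot_young u w l01.
have := dot_young v w l01; rewrite !sqnormD dotDl invr1; lra.
Qed.

Lemma sqnorm_eq0 v : sqnorm v = 0 -> v = 0.
Proof.
move=> v0; apply/colP => j; rewrite mxE; apply/eqP; rewrite -sqrf_eq0; apply/eqP.
move/eqP: v0; rewrite psumr_eq0 => [|i _]; last by rewrite sqr_ge0.
by move=> /allP /(_ j (mem_index_enum _)) /eqP.
Qed.

Lemma cauchy_schwarz u v : dot u v ^+ 2 <= sqnorm u * sqnorm v.
Proof.
have [v0|v0] := eqVneq (sqnorm v) 0.
  by rewrite (sqnorm_eq0 v0) dotC dot0l expr2 mul0r sqnorm0 mulr0.
have vp : 0 < sqnorm v by rewrite lt_def v0 sqnorm_ge0.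
have := sqnorm_ge0 (sqnorm v *: u - dot u v *: v).
rewrite sqnormB !sqnormZ dotZl dotZr => h.
rewrite -(ler_pM2l vp); nra.
Qed.

End Euclidean.

Section Means.
Context {R : realType} {N : nat}.
Hypothesis N0 : (0 < N)%N.

Let NR0 : (N%:R : R) != 0. Proof. by rewrite pnatr_eq0 -lt0n. Qed.

Lemma meanD (V : lmodType R) (F G : 'I_N -> V) :
  mean (fun s => F s + G s) = mean F + mean G.
Proof. by rewrite /mean big_split scalerDr. Qed.

Lemma meanZ (V : lmodType R) (a : R) (F : 'I_N -> V) :
  mean (fun s => a *: F s) = a *: mean F.
Proof.
rewrite /mean; have -> : \sum_s a *: F s = a *: \sum_s F s by rewrite scaler_sumr.
by rewrite !scalerA mulrC.
Qed.

Lemma meanN (V : lmodType R) (F : 'I_N -> V) :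
  mean (fun s => - F s) = - mean F.
Proof. by rewrite /mean sumrN scalerN. Qed.

Lemma meanB (V : lmodType R) (F G : 'I_N -> V) :
  mean (fun s => F s - G s) = mean F - mean G.
Proof. by rewrite meanD meanN. Qed.

Lemma mean_cst (V : lmodType R) (v : V) : mean (fun _ : 'I_N => v) = v.
Proof.
rewrite /mean sumr_const card_ord -[v *+ _]scaler_nat scalerA.
by rewrite mulVf // scale1r.
Qed.

Lemma eq_mean (V : lmodType R) (F G : 'I_N -> V) : F =1 G -> mean F = mean G.
Proof. by move=> e; rewrite /mean; congr (_ *: _); apply: eq_bigr. Qed.

Lemma le_mean (F G : 'I_N -> R^o) : (forall s, F s <= G s) -> mean F <= mean G.
Proof.
move=> le; apply: ler_wpM2l; first by rewrite invr_ge0.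
by apply: ler_sum.
Qed.

Lemma mean_ge0 (F : 'I_N -> R^o) : (forall s, 0 <= F s) -> 0 <= mean F.
Proof. by move=> F0; apply: mulr_ge0; rewrite ?invr_ge0 ?sumr_ge0. Qed.

Lemma mean_dotl n (F : 'I_N -> 'cV[R]_n) v :
  dot (mean F) v = mean (fun s => dot (F s) v : R^o).
Proof. by rewrite dotZl dot_suml. Qed.

Lemma meanMl (a : R) (F : 'I_N -> R^o) : mean (fun s => a * F s : R^o) = a * mean F.
Proof. exact: (@meanZ R^o). Qed.

Lemma mean_sqnormB n (F : 'I_N -> 'cV[R]_n) v :
  mean (fun s => sqnorm (F s - v) : R^o)
  = mean (fun s => sqnorm (F s - mean F) : R^o) + sqnorm (mean F - v).
Proof.
rewrite (eq_mean (G := fun s => (sqnorm (F s - mean F) : R^o)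
    + ((2 * dot (F s - mean F) (mean F - v) : R^o) + (sqnorm (mean F - v) : R^o)))).
  rewrite meanD; congr (_ + _).
  by rewrite meanD mean_cst meanMl -mean_dotl meanB mean_cst subrr dot0l mulr0 add0r.
move=> s; rewrite addrA -sqnormD; congr sqnorm.
by rewrite addrA subrK.
Qed.

Lemma sqnorm_mean n (F : 'I_N -> 'cV[R]_n) :
  sqnorm (mean F) <= mean (fun s => sqnorm (F s) : R^o).
Proof.
have := mean_sqnormB F 0; rewrite subr0 => e.
rewrite (eq_mean (G := fun s => sqnorm (F s - 0) : R^o)); last by move=> s; rewrite subr0.
rewrite e lerDr; apply: mean_ge0 => s; exact: sqnorm_ge0.
Qed.

Lemma variance_le n (F : 'I_N -> 'cV[R]_n) v :
  mean (fun s => sqnorm (F s - mean F) : R^o)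
  <= mean (fun s => sqnorm (F s - v) : R^o).
Proof. by rewrite (mean_sqnormB F v) lerDl sqnorm_ge0. Qed.

End Means.

(** * Finite differences *)

Section LineDerivative.
Context {R : realType} {V : normedModType R}.
Implicit Types (f : V -> R) (z v : V).

Lemma is_derive_line f z v (t : R) : derivable f (z + t *: v) v ->
  is_derive t (1 : R) (fun t : R => f (z + t *: v)) ('D_v f (z + t *: v)).
Proof.
have e : (fun h : R => h^-1 *: (((fun t : R => f (z + t *: v)) \o shift t) (h *: (1 : R))
            - f (z + t *: v)))
       = (fun h : R => h^-1 *: ((f \o shift (z + t *: v)) (h *: v) - f (z + t *: v))).
  apply/funext => h /=; congr (_ *: (f _ - _)).
  have -> : h%:A = h :> R by rewrite /GRing.scale /= mulr1.
  by rewrite scalerDl addrCA.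
move=> df; split; first by rewrite /derivable e.
by rewrite /derive e.
Qed.

Lemma segment_MVT f z v : (forall z, differentiable f z) ->
  exists2 t : R, 0 < t < 1 & f (z + v) - f z = 'D_v f (z + t *: v).
Proof.
move=> df.
have dl (t : R) : is_derive t (1 : R) (fun t : R => f (z + t *: v)) ('D_v f (z + t *: v)).
  by apply: is_derive_line; exact: diff_derivable.
have [|t ht] := @MVT R (fun t : R => f (z + t *: v)) (fun t => 'D_v f (z + t *: v)) 0 1 ltr01
   (fun t _ => dl t).
  apply: continuous_subspaceT => t.
  by apply: differentiable_continuous; apply/derivable1_diffP; case: (dl t).
rewrite scale1r scale0r addr0 subr0 mulr1 => e.
by exists t => //; move: ht; rewrite in_itv.
Qed.

(* Mean value theorem for the vector-valued map t |-> (f_s (z + t v) - t D_v f_s z)_s,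
   tested against its own increment. *)
Lemma central_difference_error (N : nat) (F : 'I_N -> V -> R) z v (delta A : R) :
  0 < delta -> (forall s z, differentiable (F s) z) ->
  (forall t : R, `|t| <= delta ->
     \sum_(s < N) ('D_v (F s) (z + t *: v) - 'D_v (F s) z) ^+ 2 <= A) ->
  \sum_(s < N) ((F s (z + delta *: v) - F s (z - delta *: v)) / (2 * delta)
                 - 'D_v (F s) z) ^+ 2 <= A.
Proof.
move=> d0 dF hA.
(* The mean value theorem applied to each [F s] would give a different point for each [s], while
   [hA] bounds the sum at one common point; the errors [c s] therefore serve as weights of a single
   scalar function [h]. *)
pose c s := (F s (z + delta *: v) - F s (z - delta *: v)) / (2 * delta) - 'D_v (F s) z.
pose D s : R := 'D_v (F s) z.
pose h (t : R) := \sum_(s < N) c s *: (F s (z + t *: v) - t * D s).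
have dh (t : R) : is_derive t (1 : R) h (\sum_(s < N) c s *: ('D_v (F s) (z + t *: v) - D s)).
  have -> : h = \sum_(s < N) (fun t : R => c s *: (F s (z + t *: v) - t * D s)).
    by apply/funext => u; rewrite fct_sumE.
  suff k s : is_derive t (1 : R) (fun t : R => c s *: (F s (z + t *: v) - t * D s))
      (c s *: ('D_v (F s) (z + t *: v) - D s)) by exact: is_derive_sum.
  have k1 : is_derive t (1 : R) (fun t : R => F s (z + t *: v)) ('D_v (F s) (z + t *: v)).
    by apply: is_derive_line; exact: diff_derivable.
  have k2 : is_derive t (1 : R) (fun t : R => t * D s) (D s).
    have -> : (fun t : R => t * D s) = D s \*: (id : R -> R).
      by apply/funext => u; rewrite mulrC.
    by rewrite -[X in is_derive _ _ _ X]mulr1; exact: is_deriveZ.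
  exact: (is_deriveZ _ (is_deriveB k1 k2)).
have dd : - delta < delta by rewrite ltrNl; lra.
have [|t ht e] := @MVT R h _ (- delta) delta dd (fun t _ => dh t).
  apply: continuous_subspaceT => t.
  by apply: differentiable_continuous; apply/derivable1_diffP; case: (dh t).
have {}e : \sum_s c s ^+ 2 = \sum_s c s * ('D_v (F s) (z + t *: v) - D s).
  apply: (@mulIf _ (delta - - delta)); first by rewrite subr_eq0 gt_eqF.
  rewrite -[RHS]e /h -sumrB mulr_suml; apply: eq_bigr => s _.
  have sE (a b : R) : a *: (b : R^o) = a * b by [].
  rewrite -scalerBr sE scaleNr expr2 -mulrA; congr (_ * _).
  rewrite /c -/(D s); field; by rewrite gt_eqF.
have tb : `|t| <= delta by move: ht; rewrite in_itv /= ler_norml => /andP[/ltW -> /ltW ->].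
have := hA t tb; rewrite -/(D _) => le.
apply: le_trans le.
have : \sum_s c s * ('D_v (F s) (z + t *: v) - D s)
   <= \sum_s (2^-1 * c s ^+ 2 + 2^-1 * ('D_v (F s) (z + t *: v) - D s) ^+ 2).
  apply: ler_sum => s _; have := sqr_ge0 (c s - ('D_v (F s) (z + t *: v) - D s)).
  by set x := c s; set y := ('D_v _ _ - _); nra.
rewrite -e big_split -!mulr_sumr /=; lra.
Qed.

End LineDerivative.

Section Gradients.
Context {R : realType} {d1 d2 : nat}.
Local Notation Z := ('cV[R]_d1 * 'cV[R]_d2)%type.
Implicit Types (f : Z -> R) (z v : Z).

Lemma derive_grad f z v : differentiable f z ->
  'D_v f z = dot (grad_x f z) v.1 + dot (grad_y f z) v.2.
Proof.
move=> df; rewrite deriveE //.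
have ev : v = \sum_(j < d1) v.1 j 0 *: ((delta_mx j 0, 0) : Z)
            + \sum_(j < d2) v.2 j 0 *: ((0, delta_mx j 0) : Z).
  have e1 : \sum_(j < d1) v.1 j 0 *: ((delta_mx j 0, 0) : Z) = (v.1, 0).
    transitivity ((\sum_(j < d1) v.1 j 0 *: delta_mx j 0 : 'cV[R]_d1, 0) : Z).
      apply: (big_rec2 (fun (a : Z) (b : 'cV[R]_d1) => a = (b, 0))) => // i a b _ ->.
      by apply/pair_equal_spec; split => //=; rewrite scaler0 addr0.
    by congr pair; apply/colP => j; rewrite summxE (bigD1 j) //= big1 => [|i ij];
      rewrite !mxE eqxx ?mulr1 ?addr0 // eq_sym (negbTE ij) mulr0.
  have e2 : \sum_(j < d2) v.2 j 0 *: ((0, delta_mx j 0) : Z) = (0, v.2).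
    transitivity ((0, \sum_(j < d2) v.2 j 0 *: delta_mx j 0 : 'cV[R]_d2) : Z).
      apply: (big_rec2 (fun (a : Z) (b : 'cV[R]_d2) => a = (0, b))) => // i a b _ ->.
      by apply/pair_equal_spec; split => //=; rewrite scaler0 addr0.
    by congr pair; apply/colP => j; rewrite summxE (bigD1 j) //= big1 => [|i ij];
      rewrite !mxE eqxx ?mulr1 ?addr0 // eq_sym (negbTE ij) mulr0.
  rewrite e1 e2; case: (v) => a b; by apply/pair_equal_spec; rewrite /= addr0 add0r.
rewrite {1}ev linearD !linear_sum /dot; congr (_ + _); apply: eq_bigr => j _.
  by rewrite linearZ mxE deriveE // mulrC.
by rewrite linearZ mxE deriveE // mulrC.
Qed.

Lemma cw_xE (delta : R) f z j :
  cw_x delta f z j 0 = (f (z + delta *: ((delta_mx j 0, 0) : Z))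
    - f (z - delta *: ((delta_mx j 0, 0) : Z))) / (2 * delta).
Proof.
rewrite /cw_x summxE (bigD1 j) //= big1 => [|i ij].
  rewrite !mxE !eqxx mulr1 addr0; congr ((f _ - f _) / _);
    by apply/pair_equal_spec; rewrite /= scaler0 ?oppr0 addr0.
by rewrite !mxE eq_sym (negbTE ij) mulr0.
Qed.

Lemma cw_yE (delta : R) f z j :
  cw_y delta f z j 0 = (f (z + delta *: ((0, delta_mx j 0) : Z))
    - f (z - delta *: ((0, delta_mx j 0) : Z))) / (2 * delta).
Proof.
rewrite /cw_y summxE (bigD1 j) //= big1 => [|i ij].
  rewrite !mxE !eqxx mulr1 addr0; congr ((f _ - f _) / _);
    by apply/pair_equal_spec; rewrite /= scaler0 ?oppr0 addr0.
by rewrite !mxE eq_sym (negbTE ij) mulr0.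
Qed.

Lemma sqnorm_delta n (j : 'I_n) (t : R) : sqnorm (t *: (delta_mx j 0 : 'cV[R]_n)) = t ^+ 2.
Proof.
rewrite /sqnorm (bigD1 j) //= big1 => [|i ij].
  by rewrite !mxE !eqxx mulr1 addr0.
by rewrite !mxE (negbTE ij) mulr0 expr2 mul0r.
Qed.

End Gradients.

(** * Smoothness and the PL condition *)

Section SmoothFunctions.
Context {R : realType} {d1 d2 : nat}.
Local Notation Z := ('cV[R]_d1 * 'cV[R]_d2)%type.
Variables (f : Z -> R) (L : R).
Hypotheses (L0 : 0 < L) (df : forall z, differentiable f z)
  (Lx : forall z z', sqnorm (grad_x f z - grad_x f z') <= L ^+ 2 * sqnorm2 (z - z'))
  (Ly : forall z z', sqnorm (grad_y f z - grad_y f z') <= L ^+ 2 * sqnorm2 (z - z')).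

Lemma sqnorm2_ge0 (z : Z) : 0 <= sqnorm2 z.
Proof. by rewrite addr_ge0 ?sqnorm_ge0. Qed.

Lemma sqnorm2Z a (z : Z) : sqnorm2 (a *: z) = a ^+ 2 * sqnorm2 z.
Proof. by rewrite /sqnorm2 !sqnormZ mulrDr. Qed.

Lemma dot_grad_dev n (g g' v : 'cV[R]_n) (A : R) :
  sqnorm (g - g') <= L ^+ 2 * A -> 2 * `|dot g v - dot g' v| <= L * A + L * sqnorm v.
Proof.
have gen (u : 'cV[R]_n) : sqnorm u <= L ^+ 2 * A -> 2 * dot u v <= L * A + L * sqnorm v.
  move=> h; apply: le_trans (dot_young u v L0) _; rewrite lerD2r.
  by rewrite mulrC ler_pdivrMr // [leRHS]mulrAC -expr2.
move=> h; rewrite -dotBl; have [_|_] := ler0P (dot (g - g') v); last exact: gen.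
by rewrite -dotNl; apply: gen; rewrite sqnormN.
Qed.

(** The mean value theorem replaces the integral form of Taylor's formula, and one intermediate
    point serves both blocks. The price is [L] instead of [L / 2] in the one-block quadratic bounds
    below, which the step sizes absorb. *)
Lemma smooth_expansion z v : exists2 t : R, 0 < t < 1 &
  [/\ f (z + v) - f z = dot (grad_x f (z + t *: v)) v.1 + dot (grad_y f (z + t *: v)) v.2,
      sqnorm (grad_x f (z + t *: v) - grad_x f z) <= L ^+ 2 * sqnorm2 v &
      sqnorm (grad_y f (z + t *: v) - grad_y f z) <= L ^+ 2 * sqnorm2 v].
Proof.
have [t t01 e] := segment_MVT z v df; exists t => //.
have le : sqnorm2 (z + t *: v - z) <= sqnorm2 v.
  rewrite addrC addKr sqnorm2Z ler_piMl ?sqnorm2_ge0 // expr_le1 //; lra.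
split; first by rewrite e derive_grad.
- by apply: le_trans (Lx _ _) _; rewrite ler_wpM2l ?sqr_ge0.
- by apply: le_trans (Ly _ _) _; rewrite ler_wpM2l ?sqr_ge0.
Qed.

Lemma smooth_lower z v :
  f z + dot (grad_x f z) v.1 + dot (grad_y f z) v.2 - 2 * L * sqnorm2 v <= f (z + v).
Proof.
have [t _ [e ex ey]] := smooth_expansion z v.
have := dot_grad_dev v.1 ex; have := dot_grad_dev v.2 ey.
have := ler_norm (- (dot (grad_x f (z + t *: v)) v.1 - dot (grad_x f z) v.1)).
have := ler_norm (- (dot (grad_y f (z + t *: v)) v.2 - dot (grad_y f z) v.2)).
rewrite !normrN.
have := sqnorm2_ge0 v; have : L * sqnorm2 v = L * sqnorm v.1 + L * sqnorm v.2.
  by rewrite -mulrDr.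
have : 0 <= L * sqnorm2 v by rewrite mulr_ge0 ?sqnorm2_ge0 ?ltW.
lra.
Qed.

Lemma smooth_upper_x z (u : 'cV[R]_d1) :
  f (z.1 + u, z.2) <= f z + dot (grad_x f z) u + L * sqnorm u.
Proof.
have [t _ [e ex _]] := smooth_expansion z (u, 0).
have := dot_grad_dev u ex.
have := ler_norm (dot (grad_x f (z + t *: (u, 0))) u - dot (grad_x f z) u).
move: e; rewrite /sqnorm2 /= sqnorm0 [dot _ 0]dotC dot0l !addr0.
have -> : z + (u, 0) = (z.1 + u, z.2) by apply/pair_equal_spec; rewrite /= addr0.
lra.
Qed.

Lemma smooth_lower_y z (u : 'cV[R]_d2) :
  f z + dot (grad_y f z) u - L * sqnorm u <= f (z.1, z.2 + u).
Proof.
have [t _ [e _ ey]] := smooth_expansion z (0, u).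
have := dot_grad_dev u ey.
have := ler_norm (- (dot (grad_y f (z + t *: (0, u))) u - dot (grad_y f z) u)).
move: e; rewrite normrN /sqnorm2 /= sqnorm0 [dot _ 0]dotC dot0l !add0r.
have -> : z + (0, u) = (z.1, z.2 + u) by apply/pair_equal_spec; rewrite /= addr0.
lra.
Qed.

End SmoothFunctions.

(* Gradient ascent with step 1/(2L) closes the gap geometrically, and the square root of
   the gap telescopes the length of its path. *)
Lemma PL_error_bound (R : realType) (n : nat) (f : 'cV[R]_n -> R) (g : 'cV[R]_n -> 'cV[R]_n)
    (L nu m : R) (y : 'cV[R]_n) (eps : R) :
  0 < L -> 0 < nu -> nu <= L ->
  (forall y, f y <= m) ->
  (forall y, 2 * nu * (m - f y) <= sqnorm (g y)) ->
  (forall y u, f y + dot (g y) u - L * sqnorm u <= f (y + u)) ->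
  0 < eps ->
  exists2 y', m - eps <= f y' & sqnorm (y' - y) <= 4 * sqnorm (g y) / nu ^+ 2.
Proof.
move=> L0 nu0 nuL fm PL desc eps0.
have L0' := ltW L0; have nu0' := ltW nu0.
pose a k := iter k (fun y => y + (2 * L)^-1 *: g y) y.
pose gap k := m - f (a k).
have gap0 k : 0 <= gap k by rewrite subr_ge0.
have step k : gap k.+1 <= gap k - (4 * L)^-1 * sqnorm (g (a k)).
  have := desc (a k) ((2 * L)^-1 *: g (a k)).
  rewrite dotZr sqnormZ -sqnormE /gap /=.
  suff : (2 * L)^-1 * sqnorm (g (a k)) - L * ((2 * L)^-1 ^+ 2 * sqnorm (g (a k)))
      = (4 * L)^-1 * sqnorm (g (a k)) by rewrite -/(a k); lra.
  by field; rewrite gt_eqF.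
(* An ascent step gains [|g|^2 / (4 L)], which by PL is at least [nu / (2 L)] times the gap. *)
pose r := 1 - nu / (2 * L).
have r01 : 0 <= r < 1.
  rewrite /r subr_ge0 ltrBlDr ltrDl divr_gt0 ?mulr_gt0 // andbT.
  by rewrite ler_pdivrMr ?mulr_gt0 // mul1r; lra.
have geo k : gap k <= r ^+ k * gap 0%N.
  elim: k => [|k IH]; first by rewrite expr0 mul1r.
  have h : gap k.+1 <= r * gap k.
    apply: le_trans (step k) _; rewrite /r mulrBl mul1r lerB // -/(gap k).
    have := PL (a k); rewrite -/(gap k) => h.
    apply: le_trans (ler_wpM2l _ h); last by rewrite invr_ge0 mulr_ge0 //.
    rewrite le_eqVlt; apply/orP; left; apply/eqP; field; by rewrite gt_eqF.
  apply: le_trans h _; rewrite exprS -mulrA ler_wpM2l //; by case/andP: r01.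
(* Stopping after finitely many steps avoids a limit of the iterates; the price [eps] disappears
   later, in a bound that holds for every [eps]. *)
have [k gapk] : exists k, gap k <= eps.
  have cv : (fun k => r ^+ k * gap 0%N) @ \oo --> (0 * gap 0%N : R).
    apply: cvgMr_tmp; apply: cvg_expr; rewrite ger0_norm; by case/andP: r01.
  rewrite mul0r in cv.
  have /cvgrPdist_le /(_ _ eps0) [k _ hk] := cv.
  exists k; apply: le_trans (geo k) _; apply: le_trans (ler_norm _) _.
  by have := hk k (leqnn k); rewrite /= sub0r normrN.
have path i : Num.sqrt (sqnorm (a i - y))
    <= 4 / Num.sqrt (2 * nu) * (Num.sqrt (gap 0%N) - Num.sqrt (gap i)).
  have s0 : 0 < Num.sqrt (2 * nu) by rewrite sqrtr_gt0 mulr_gt0.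
  elim: i => [|i IH]; first by rewrite !subrr mulr0 sqnorm0 sqrtr0.
  have tri (u v : 'cV[R]_n) :
      Num.sqrt (sqnorm (u + v)) <= Num.sqrt (sqnorm u) + Num.sqrt (sqnorm v).
    rewrite -(@ler_pXn2r _ 2%N) ?nnegrE ?addr_ge0 ?sqrtr_ge0 //.
    rewrite sqr_sqrtr ?sqnorm_ge0 // sqrrD !sqr_sqrtr ?sqnorm_ge0 // sqnormD.
    rewrite lerD2r lerD2l mulr_natl ler_pMn2r // -sqrtrM ?sqnorm_ge0 //.
    apply: le_trans (ler_norm _) _; rewrite -sqrtr_sqr ler_sqrt ?cauchy_schwarz //.
    by rewrite mulr_ge0 ?sqnorm_ge0.
  have -> : a i.+1 - y = (a i - y) + (2 * L)^-1 *: g (a i) by rewrite /= addrAC.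
  apply: le_trans (tri _ _) _.
  rewrite sqnormZ sqrtrM ?sqr_ge0 // sqrtr_sqr ger0_norm ?invr_ge0 ?mulr_ge0 //.
  set G := Num.sqrt (sqnorm (g (a i))).
  set p := Num.sqrt (gap i); set q := Num.sqrt (gap i.+1).
  set c := Num.sqrt (2 * nu) in s0 IH *.
  have G0 : 0 <= G by exact: sqrtr_ge0.
  have p0 : 0 <= p by exact: sqrtr_ge0.
  have q0 : 0 <= q by exact: sqrtr_ge0.
  have cp : c * p <= G.
    rewrite /c /p -sqrtrM ?mulr_ge0 // ler_sqrt ?sqnorm_ge0 //.
    by have := PL (a i).
  have q2 : q ^+ 2 <= p ^+ 2 - (4 * L)^-1 * G ^+ 2.
    by rewrite !sqr_sqrtr ?sqnorm_ge0 //; exact: step.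
  suff : (2 * L)^-1 * G <= 4 / c * (p - q) by move: IH; rewrite -/p; lra.
  have q3 : 4 * L * (p ^+ 2 - q ^+ 2) >= G ^+ 2.
    rewrite -(ler_pM2l (_ : 0 < (4 * L)^-1)) ?invr_gt0 ?mulr_gt0 //.
    by rewrite mulKf ?gt_eqF ?mulr_gt0 //; lra.
  rewrite -(ler_pM2l s0) -(ler_pM2l (_ : 0 < 2 * L)) ?mulr_gt0 //.
  have -> : 2 * L * (c * ((2 * L)^-1 * G)) = c * G by field; rewrite gt_eqF.
  have -> : 2 * L * (c * (4 / c * (p - q))) = 8 * L * (p - q) by field; rewrite gt_eqF.
  have qp : q <= p.
    rewrite -(@ler_pXn2r _ 2%N) ?nnegrE //.
    have : 0 <= (4 * L)^-1 * G ^+ 2 by rewrite mulr_ge0 ?sqr_ge0 ?invr_ge0 ?mulr_ge0 //.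
    lra.
  (* c p G <= G^2 <= 4 L (p - q) (p + q) <= 8 L p (p - q) *)
  have [p00|pn0] := eqVneq p 0.
    have q00 : q = 0 by apply/eqP; rewrite eq_le q0 -p00 qp.
    move: q3; rewrite p00 q00 subrr mulr0 => G2.
    have -> : G = 0 by apply/eqP; rewrite -sqrf_eq0 eq_le G2 sqr_ge0.
    by rewrite subrr !mulr0.
  have pp : 0 < p by rewrite lt_def pn0 p0.
  rewrite -(ler_pM2l pp).
  have : c * p * G <= G ^+ 2 by rewrite expr2 ler_wpM2r.
  have : 4 * L * (p ^+ 2 - q ^+ 2) <= p * (8 * L * (p - q)).
    have : 0 <= L * (p - q) ^+ 2 by rewrite mulr_ge0 ?sqr_ge0 //.
    have : p * (8 * L * (p - q)) - 4 * L * (p ^+ 2 - q ^+ 2) = 4 * (L * (p - q) ^+ 2) by ring.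
    lra.
  lra.
exists (a k); first by move: gapk; rewrite /gap; lra.
have s0 : 0 < Num.sqrt (2 * nu) by rewrite sqrtr_gt0 mulr_gt0.
have : Num.sqrt (sqnorm (a k - y)) <= 4 / Num.sqrt (2 * nu) * Num.sqrt (gap 0%N).
  apply: le_trans (path k) _; rewrite ler_wpM2l ?divr_ge0 ?sqrtr_ge0 //.
  by rewrite lerBlDr lerDl sqrtr_ge0.
rewrite -(@ler_pXn2r _ 2%N) ?nnegrE ?sqrtr_ge0 ?mulr_ge0 ?invr_ge0 ?sqrtr_ge0 //.
rewrite sqr_sqrtr ?sqnorm_ge0 // !exprMn exprVn !sqr_sqrtr ?mulr_ge0 // => h.
(* PL at the starting point trades the initial gap for the gradient:
   [16 gap / (2 nu) <= 16 |g y|^2 / (2 nu)^2]. *)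
apply: le_trans h _; have := PL y; rewrite -/(gap 0%N) => h.
rewrite ler_pdivlMr ?exprn_gt0 //.
have -> : 4 ^+ 2 * (2 * nu)^-1 * gap 0%N * nu ^+ 2 = 4 * (2 * nu * gap 0%N).
  by field; rewrite gt_eqF.
by rewrite ler_wpM2l.
Qed.

(** * Gradients of means and the bias of coordinate-wise differences *)

Section MeanGradients.
Context {R : realType} {N d1 d2 : nat}.
Local Notation Z := ('cV[R]_d1 * 'cV[R]_d2)%type.
Variables (F : 'I_N -> Z -> R).
Hypotheses (N0 : (0 < N)%N) (dF : forall s z, differentiable (F s) z).

Let meanF (z : Z) : R := mean (fun s => F s z : R^o).

Let meanFE : meanF = (N%:R^-1 : R) \*: \sum_(s < N) F s.
Proof. by apply/funext => z; rewrite /meanF /mean /= fct_sumE. Qed.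

Lemma differentiable_mean z : differentiable meanF z.
Proof.
rewrite meanFE; apply: differentiableZ; apply: differentiable_sum => s; exact: dF.
Qed.

Lemma derive_mean z v : 'D_v meanF z = mean (fun s => 'D_v (F s) z : R^o).
Proof.
rewrite meanFE deriveZ ?derive_sum // => [s|]; first exact: diff_derivable.
by apply: derivable_sum => s; exact: diff_derivable.
Qed.

Lemma grad_x_mean z : grad_x meanF z = mean (fun s => grad_x (F s) z).
Proof.
apply/colP => j; rewrite mxE derive_mean /mean !mxE summxE.
by congr (_ * _); apply: eq_bigr => s _; rewrite mxE.
Qed.

Lemma grad_y_mean z : grad_y meanF z = mean (fun s => grad_y (F s) z).
Proof.
apply/colP => j; rewrite mxE derive_mean /mean !mxE summxE.
by congr (_ * _); apply: eq_bigr => s _; rewrite mxE.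
Qed.

Lemma smooth_mean_x (A : R) z z' :
  mean (fun s => sqnorm (grad_x (F s) z - grad_x (F s) z') : R^o) <= A ->
  sqnorm (grad_x meanF z - grad_x meanF z') <= A.
Proof.
by apply: le_trans; rewrite !grad_x_mean -meanB; exact: sqnorm_mean.
Qed.

Lemma smooth_mean_y (A : R) z z' :
  mean (fun s => sqnorm (grad_y (F s) z - grad_y (F s) z') : R^o) <= A ->
  sqnorm (grad_y meanF z - grad_y meanF z') <= A.
Proof.
by apply: le_trans; rewrite !grad_y_mean -meanB; exact: sqnorm_mean.
Qed.

Variables (L : R).
Hypotheses
  (Lx : forall z z', mean (fun s => sqnorm (grad_x (F s) z - grad_x (F s) z') : R^o)
     <= L ^+ 2 * sqnorm2 (z - z'))
  (Ly : forall z z', mean (fun s => sqnorm (grad_y (F s) z - grad_y (F s) z') : R^o)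
     <= L ^+ 2 * sqnorm2 (z - z')).

(** Along one basis vector expected smoothness bounds the sum over samples of the squared changes of
    the partial derivative by [N L^2 delta^2], which [central_difference_error] transfers to the
    difference quotients; the [d1] coordinates give the factor. *)
Lemma cw_x_bias delta z : 0 < delta ->
  mean (fun s => sqnorm (cw_x delta (F s) z - grad_x (F s) z) : R^o)
  <= d1%:R * (L ^+ 2 * delta ^+ 2).
Proof.
move=> d0; have NR : (0 : R) < N%:R by rewrite ltr0n.
rewrite /mean /sqnorm exchange_big scaler_sumr /=.
rewrite -[d1 in leRHS]card_ord mulr_natl -sumr_const.
apply: ler_sum => j _; rewrite ler_pdivrMl //.
under eq_bigr do rewrite !mxE cw_xE.
apply: central_difference_error => // t td.
have := Lx (z + t *: (delta_mx j 0, 0)) z.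
rewrite /mean ler_pdivrMl // => h; apply: le_trans _ (le_trans h _).
  apply: ler_sum => s _; rewrite /sqnorm (bigD1 j) //= !mxE lerDl.
  by apply: sumr_ge0 => i _; exact: sqr_ge0.
apply: ler_wpM2l; first exact: ltW.
rewrite ler_wpM2l ?sqr_ge0 // addrC addKr sqnorm2Z /sqnorm2 /= sqnorm0 addr0.
rewrite -[delta_mx _ _]scale1r sqnorm_delta expr1n mulr1.
by rewrite -(real_normK (num_real t)) ler_pXn2r ?nnegrE // ltW.
Qed.

Lemma cw_y_bias delta z : 0 < delta ->
  mean (fun s => sqnorm (cw_y delta (F s) z - grad_y (F s) z) : R^o)
  <= d2%:R * (L ^+ 2 * delta ^+ 2).
Proof.
move=> d0; have NR : (0 : R) < N%:R by rewrite ltr0n.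
rewrite /mean /sqnorm exchange_big scaler_sumr /=.
rewrite -[d2 in leRHS]card_ord mulr_natl -sumr_const.
apply: ler_sum => j _; rewrite ler_pdivrMl //.
under eq_bigr do rewrite !mxE cw_yE.
apply: central_difference_error => // t td.
have := Ly (z + t *: (0, delta_mx j 0)) z.
rewrite /mean ler_pdivrMl // => h; apply: le_trans _ (le_trans h _).
  apply: ler_sum => s _; rewrite /sqnorm (bigD1 j) //= !mxE lerDl.
  by apply: sumr_ge0 => i _; exact: sqr_ge0.
apply: ler_wpM2l; first exact: ltW.
rewrite ler_wpM2l ?sqr_ge0 // addrC addKr sqnorm2Z /sqnorm2 /= sqnorm0 add0r.
rewrite -[delta_mx _ _]scale1r sqnorm_delta expr1n mulr1.
by rewrite -(real_normK (num_real t)) ler_pXn2r ?nnegrE // ltW.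
Qed.

End MeanGradients.

(* For one block w of the gradient: [gr s] is the finite-difference estimate from sample
   [s], [dg s] the exact partial gradient. *)
Section EstimatorBounds.
Context {R : realType} {N d : nat} {Z : Type}.
Hypothesis N0 : (0 < N)%N.
Variables (gr dg : Z -> 'I_N -> 'cV[R]_d) (beta : R).
Hypothesis bias : forall z, mean (fun s => sqnorm (gr z s - dg z s) : R^o) <= beta.

Lemma estimator_lipschitz (z z' : Z) (A : R) :
  mean (fun s => sqnorm (dg z s - dg z' s) : R^o) <= A ->
  mean (fun s => sqnorm (gr z s - gr z' s) : R^o) <= 3 * A + 6 * beta.
Proof.
move=> hA; have h1 := bias z; have h2 := bias z'.
pose G s : R^o := (3 * sqnorm (gr z s - dg z s) : R^o)
  + ((3 * sqnorm (dg z s - dg z' s) : R^o) + (3 * sqnorm (gr z' s - dg z' s) : R^o)).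
apply: (@le_trans _ _ (mean G)).
  apply: le_mean => s; rewrite /G addrA.
  apply: le_trans (_ : _ <= 3 * sqnorm (gr z s - dg z s) + 3 * sqnorm (dg z s - dg z' s)
    + 3 * sqnorm (dg z' s - gr z' s)) _; last by rewrite [sqnorm (dg z' s - _)]sqnormBC.
  have -> : gr z s - gr z' s
      = gr z s - dg z s + (dg z s - dg z' s) + (dg z' s - gr z' s) by rewrite !addrA !subrK.
  exact: sqnormD_le3.
rewrite /G !meanD !meanMl; lra.
Qed.

Lemma estimator_bias (z : Z) :
  sqnorm (mean (gr z) - mean (dg z)) <= beta.
Proof. by rewrite -meanB; apply: le_trans (sqnorm_mean N0 _) (bias z). Qed.

Lemma estimator_variance (z : Z) (s2 : R) :
  mean (fun s => sqnorm (dg z s - mean (dg z)) : R^o) <= s2 ->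
  mean (fun s => sqnorm (gr z s - mean (gr z)) : R^o) <= 2 * beta + 2 * s2.
Proof.
move=> hs; have h1 := bias z.
apply: le_trans (variance_le N0 _ (mean (dg z))) _.
pose G s : R^o := (2 * sqnorm (gr z s - dg z s) : R^o)
  + (2 * sqnorm (dg z s - mean (dg z)) : R^o).
apply: (@le_trans _ _ (mean G)).
  apply: le_mean => s; rewrite /G.
  have -> : gr z s - mean (dg z) = gr z s - dg z s + (dg z s - mean (dg z)).
    by rewrite addrA subrK.
  exact: sqnormD_le2.
rewrite /G meanD !meanMl; lra.
Qed.

End EstimatorBounds.

(** * Exact diffusion *)

Section Stacking.
Context {R : realType} {K d : nat}.

Lemma agent_stack (u : 'I_K -> 'cV[R]_d) k : agent (stack u) k = u k.
Proof. by apply/colP => j; rewrite !mxE mxtens_indexK. Qed.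

Lemma agentD (X Y : 'cV[R]_(K * d)) k : agent (X + Y) k = agent X k + agent Y k.
Proof. by apply/colP => j; rewrite !mxE. Qed.

Lemma agentN (X : 'cV[R]_(K * d)) k : agent (- X) k = - agent X k.
Proof. by apply/colP => j; rewrite !mxE. Qed.

Lemma agentB (X Y : 'cV[R]_(K * d)) k : agent (X - Y) k = agent X k - agent Y k.
Proof. by rewrite agentD agentN. Qed.

Lemma agentZ a (X : 'cV[R]_(K * d)) k : agent (a *: X) k = a *: agent X k.
Proof. by apply/colP => j; rewrite !mxE. Qed.

Lemma sum_mxtens (V : nmodType) (F : 'I_(K * d) -> V) :
  \sum_i F i = \sum_(k < K) \sum_(j < d) F (mxtens_index (k, j)).
Proof.
rewrite pair_bigA (reindex (@mxtens_index K d)) /=; last first.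
  apply: onW_bij; exact: (Bijective (@mxtens_indexK _ _) (@mxtens_unindexK _ _)).
by apply: eq_bigr => -[].
Qed.

Lemma sqnorm_agents (X : 'cV[R]_(K * d)) : sqnorm X = \sum_(k < K) sqnorm (agent X k).
Proof.
rewrite /sqnorm sum_mxtens; apply: eq_bigr => k _.
by apply: eq_bigr => j _; rewrite mxE.
Qed.

Lemma agent_tensmx (M : 'M[R]_K) (X : 'cV[R]_(K * d)) k :
  agent ((M *t 1%:M) *m X) k = \sum_(l < K) M k l *: agent X l.
Proof.
apply/colP => j; rewrite !mxE summxE sum_mxtens; apply: eq_bigr => l _.
rewrite !mxE (bigD1 j) //= big1 => [|i ij].
  by rewrite !mxE !mxtens_indexK eqxx mulr1 addr0.
by rewrite !mxE !mxtens_indexK eq_sym (negbTE ij) mulr0 mul0r.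
Qed.

Lemma agent_averaging (X : 'cV[R]_(K * d)) k :
  agent (averaging R K d *m X) k = mean (agent X).
Proof.
rewrite agent_tensmx /mean scaler_sumr.
by apply: eq_bigr => l _; rewrite mxE.
Qed.

Lemma stack_eq (X Y : 'cV[R]_(K * d)) : (forall k, agent X k = agent Y k) -> X = Y.
Proof.
move=> e; apply/colP => i; rewrite -(mxtens_unindexK i).
by have /colP/(_ (mxtens_unindex i).2) := e (mxtens_unindex i).1; rewrite !mxE -surjective_pairing.
Qed.

Lemma sqnorm_consensus (X : 'cV[R]_(K * d)) :
  sqnorm (X - averaging R K d *m X) = \sum_(k < K) sqnorm (agent X k - mean (agent X)).
Proof.
by rewrite sqnorm_agents; apply: eq_bigr => k _; rewrite agentB agent_averaging.
Qed.

Lemma mean_agent_mix (W : 'M[R]_K) (X : 'cV[R]_(K * d)) :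
  (forall l, \sum_k W k l = 1) -> mean (agent ((W *t 1%:M) *m X)) = mean (agent X).
Proof.
move=> hW; rewrite /mean; congr (_ *: _).
under eq_bigr do rewrite agent_tensmx.
rewrite exchange_big /=; apply: eq_bigr => l _.
by rewrite -scaler_suml hW scale1r.
Qed.

End Stacking.

(** The dimensions [K.-1 * d + 1 * d] and [K * d] agree only propositionally, so their equality is
    an argument that gets substituted away. *)
Lemma mulmx1C_eq (R : comUnitRingType) m n (A : 'M[R]_(m, n)) (B : 'M[R]_(n, m)) :
  m = n -> A *m B = 1%:M -> B *m A = 1%:M.
Proof. by move=> e; subst n; exact: mulmx1C. Qed.

Section ComplementBasis.
Context {R : realType} {K d : nat}.
Hypothesis K0 : (0 < K)%N.
Variable U : 'M[R]_(K * d, K.-1 * d).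
Let c := (const_mx 1 : 'cV[R]_K) *t (1%:M : 'M[R]_d).
Hypotheses (UU : U^T *m U = 1%:M) (cU : c^T *m U = 0).

(** By a dimension count the columns of [U] and [c] together form a square matrix [M], so its left
    inverse [A] is also a right inverse; expanding [M *m A = 1] blockwise gives the formula. *)
Lemma complement_projection : U *m U^T = 1%:M - averaging R K d.
Proof.
have KR : (K%:R : R) != 0 by rewrite pnatr_eq0 -lt0n.
have iE (u v : 'I_1 * 'I_d) : (mxtens_index u == mxtens_index v) = (u.2 == v.2).
  rewrite (inj_eq (can_inj (@mxtens_indexK 1 d))).
  by case: u v => u1 u2 [v1 v2]; rewrite xpair_eqE !ord1 eqxx.
have cc : c^T *m c = K%:R *: 1%:M.
  apply/matrixP => i j; rewrite -(mxtens_unindexK i) -(mxtens_unindexK j).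
  rewrite trmx_tens tensmx_mul tensmxE trmx1 mulmx1 !mxE iE.
  under eq_bigr do rewrite !mxE mulr1.
  by rewrite sumr_const card_ord.
have cct : c *m c^T = K%:R *: averaging R K d.
  apply/matrixP => i j; rewrite -(mxtens_unindexK i) -(mxtens_unindexK j).
  rewrite trmx_tens tensmx_mul [RHS]mxE !tensmxE trmx1 mulmx1 !mxE.
  by rewrite big_ord1 !mxE mulr1 mulrA divff // mul1r.
have Uc : U^T *m c = 0 by rewrite -[c]trmxK -trmx_mul cU trmx0.
pose A := col_mx U^T (K%:R^-1 *: c^T); pose M := row_mx U c.
have AM : A *m M = 1%:M.
  rewrite mul_col_row UU Uc -!scalemxAl cU cc scaler0 scalerA mulVf // scale1r.
  by rewrite -scalar_mx_block.
have e : (K.-1 * d + 1 * d = K * d)%N by rewrite -mulnDl addn1 prednK.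
have := mulmx1C_eq e AM.
rewrite mul_row_col -scalemxAr cct scalerA mulVf // scale1r => <-.
by rewrite addrK.
Qed.

Lemma complement_sqnorm (X : 'cV[R]_(K * d)) :
  sqnorm (U^T *m X) = sqnorm (X - averaging R K d *m X).
Proof.
have -> : X - averaging R K d *m X = U *m (U^T *m X).
  by rewrite mulmxA complement_projection mulmxBl mul1mx.
by rewrite !sqnorm_mulmx [(U *m _)^T]trmx_mul -!mulmxA (mulmxA U^T U) UU mul1mx.
Qed.

Lemma complement_sqnorm_le (X : 'cV[R]_(K * d)) : sqnorm (U^T *m X) <= sqnorm X.
Proof.
rewrite complement_sqnorm sqnorm_consensus sqnorm_agents.
have KR : (0 : R) < K%:R^-1 by rewrite invr_gt0 ltr0n.
rewrite -(ler_pM2l KR).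
have := variance_le K0 (agent X) 0.
rewrite [X in _ <= X](eq_mean (G := fun k => sqnorm (agent X k) : R^o)) //.
by move=> k; rewrite subr0.
Qed.

End ComplementBasis.

Section ModeRecursion.
Context {R : realType}.
Implicit Types a lam u x f : R.

(* One eigenmode of exact diffusion: in the variable u = x^+ - a x the quadratic form
   u^2 + a (1 - a) x^2 = |x^+ - mu x|^2, mu being a root of mu^2 - 2 a mu + a, is
   multiplied by a = |mu|^2. *)
Lemma mode_contraction a lam u x f : 0 <= a <= lam -> lam < 1 ->
  (a * u - a * (1 - a) * x + f) ^+ 2 + a * (1 - a) * (u + a * x) ^+ 2
  <= (1 + lam) / 2 * (u ^+ 2 + a * (1 - a) * x ^+ 2) + 3 / (1 - lam) * f ^+ 2.
Proof.
move=> /andP[a0 al] l1.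
set V := u ^+ 2 + a * (1 - a) * x ^+ 2; set w := a * u - a * (1 - a) * x.
have a1 : 0 <= a * (1 - a) by rewrite mulr_ge0 // subr_ge0 (le_trans al) ?ltW.
have V0 : 0 <= V by rewrite addr_ge0 ?sqr_ge0 // mulr_ge0 ?sqr_ge0.
have e : w ^+ 2 + a * (1 - a) * (u + a * x) ^+ 2 = a * V by rewrite /V /w; ring.
have wV : w ^+ 2 <= a * V by rewrite -e lerDl mulr_ge0 ?sqr_ge0.
have s0 : 0 < 1 - lam by rewrite subr_gt0.
(* This Young weight raises the factor [a] to [a (3 - lam) / 2], and [lam (3 - lam) <= 1 + lam]
   amounts to [(1 - lam)^2 >= 0]. *)
have cross : 2 * (w * f) <= (1 - lam) / 2 * w ^+ 2 + 2 / (1 - lam) * f ^+ 2.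
  have := sqr_ge0 ((1 - lam) / 2 * w - f) => h.
  have : 0 <= 2 / (1 - lam) * ((1 - lam) / 2 * w - f) ^+ 2.
    by rewrite mulr_ge0 // divr_ge0 // ltW.
  suff -> : 2 / (1 - lam) * ((1 - lam) / 2 * w - f) ^+ 2
     = (1 - lam) / 2 * w ^+ 2 + 2 / (1 - lam) * f ^+ 2 - 2 * (w * f) by lra.
  by field; rewrite gt_eqF.
have f0 := sqr_ge0 f.
have g : f ^+ 2 + 2 / (1 - lam) * f ^+ 2 <= 3 / (1 - lam) * f ^+ 2.
  have -> : f ^+ 2 + 2 / (1 - lam) * f ^+ 2 = (3 - lam) / (1 - lam) * f ^+ 2.
    by field; rewrite gt_eqF.
  rewrite ler_wpM2r // ler_wpM2r ?invr_ge0 ?(ltW s0) //; lra.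
have : a * V + (1 - lam) / 2 * (a * V) <= (1 + lam) / 2 * V.
  have -> : a * V + (1 - lam) / 2 * (a * V) = (a * (3 - lam) / 2) * V by field.
  rewrite ler_wpM2r //; nra.
have : (1 - lam) / 2 * w ^+ 2 <= (1 - lam) / 2 * (a * V).
  by rewrite ler_wpM2l // divr_ge0 // ltW.
have -> : (w + f) ^+ 2 = w ^+ 2 + 2 * (w * f) + f ^+ 2 by ring.
lra.
Qed.

(** Here [u + a x] is the mode of the next iterate. The form exceeds [(1 - a) (u + a x)^2] by
    [a (u - (1 - a) x)^2], and [1 - a >= 1 - lam]. *)
Lemma mode_bound a lam u x : 0 <= a <= lam -> lam < 1 ->
  (u + a * x) ^+ 2 <= (u ^+ 2 + a * (1 - a) * x ^+ 2) / (1 - lam).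
Proof.
move=> /andP[a0 al] l1; have s0 : 0 < 1 - lam by rewrite subr_gt0.
rewrite ler_pdivlMr //.
have : (u + a * x) ^+ 2 * (1 - lam) <= (u + a * x) ^+ 2 * (1 - a).
  by rewrite ler_wpM2l ?sqr_ge0 // lerB.
have : 0 <= a * (u - (1 - a) * x) ^+ 2 by rewrite mulr_ge0 ?sqr_ge0.
have -> : a * (u - (1 - a) * x) ^+ 2
  = u ^+ 2 + a * (1 - a) * x ^+ 2 - (u + a * x) ^+ 2 * (1 - a) by ring.
lra.
Qed.

End ModeRecursion.

Section ExactDiffusion.
Context {R : realType} {K d : nat}.
Hypothesis K0 : (0 < K)%N.
Variables (A B : 'M[R]_(K * d)) (U : 'M[R]_(K * d, K.-1 * d)) (a : 'rV[R]_(K.-1 * d))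
  (lam : R).
Hypotheses (UU : U^T *m U = 1%:M)
  (cU : ((const_mx 1 : 'cV[R]_K) *t (1%:M : 'M[R]_d))^T *m U = 0)
  (AT : A^T = A) (AU : A *m U = U *m diag_mx a) (BB : B *m B = 1%:M - A)
  (ha : forall j, 0 <= a 0 j <= lam) (lam1 : lam < 1).
Implicit Types (eta : R) (X G D : 'cV[R]_(K * d)).

(** The stacked form of the mode variable [u = x^+ - a x]. Using it in place of the dual variable
    [D] keeps the spectrum of [B] out of the analysis. *)
Definition increment eta G D : 'cV[R]_(K * d) := - (eta *: (A *m G) + B *m D).

Definition next_iterate eta X G D : 'cV[R]_(K * d) := A *m X + increment eta G D.

Definition energy eta X G D : R :=
  K%:R^-1 * \sum_j ((U^T *m increment eta G D) j 0 ^+ 2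
     + a 0 j * (1 - a 0 j) * (U^T *m X) j 0 ^+ 2).

Lemma complement_eigen (X : 'cV[R]_(K * d)) j : (U^T *m (A *m X)) j 0 = a 0 j * (U^T *m X) j 0.
Proof. by rewrite mulmxA -{1}AT -trmx_mul AU trmx_mul tr_diag_mx -mulmxA mul_diag_mx mxE. Qed.

Lemma energy_ge0 eta X G D : 0 <= energy eta X G D.
Proof.
rewrite mulr_ge0 ?invr_ge0 // sumr_ge0 // => j _.
rewrite addr_ge0 ?sqr_ge0 // mulr_ge0 ?sqr_ge0 //.
by have /andP[a0 al] := ha j; rewrite mulr_ge0 // subr_ge0 (le_trans al) ?ltW.
Qed.

(** [B] survives only through [B *m B = 1 - A]. The forcing is the change [G' - G] of the
    estimators, not [G] itself, so differences between the agents' local gradients enter only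
    through the initial energy. *)
Lemma next_increment eta X G G' D :
  increment eta G' (D + B *m next_iterate eta X G D)
  = A *m increment eta G D - (A *m X - A *m (A *m X)) - eta *: (A *m (G' - G)).
Proof.
set v := increment eta G D.
have e : increment eta G' (D + B *m next_iterate eta X G D)
   = v - eta *: (A *m (G' - G)) - (next_iterate eta X G D - A *m next_iterate eta X G D).
  rewrite /v /increment mulmxDr (mulmxA B B) BB mulmxBl mul1mx (mulmxBr A G') scalerBr.
  move: (next_iterate _ _ _ _) => Y.
  move: (B *m D) (eta *: (A *m G)) (eta *: (A *m G')) (A *m Y) => p q r s.
  by apply/colP => i; rewrite !mxE; ring.
rewrite {}e /next_iterate -/v mulmxDr.
move: (eta *: _) (A *m X) (A *m (A *m X)) (A *m v) => p q r s.
by apply/colP => i; rewrite !mxE; ring.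
Qed.

(** [mode_contraction] in each mode, with forcing [- eta a (G' - G)]; the eigenvalue [a <= lam] in
    front of it is the origin of [lam ^+ 2]. *)
Lemma energy_step eta X G G' D :
  energy eta (next_iterate eta X G D) G' (D + B *m next_iterate eta X G D)
  <= (1 + lam) / 2 * energy eta X G D
     + 3 / (1 - lam) * (eta ^+ 2 * lam ^+ 2) * (K%:R^-1 * sqnorm (G' - G)).
Proof.
have iK : (0 : R) <= K%:R^-1 by rewrite invr_ge0.
have s0 : 0 < 1 - lam by rewrite subr_gt0.
apply: (@le_trans _ _ ((1 + lam) / 2 * energy eta X G D
     + 3 / (1 - lam) * (eta ^+ 2 * lam ^+ 2) * (K%:R^-1 * sqnorm (U^T *m (G' - G))))); last first.
  rewrite lerD2l ler_wpM2l ?ler_wpM2l ?(complement_sqnorm_le K0 UU cU) //.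
  apply: mulr_ge0; first by rewrite divr_ge0 // ltW.
  by rewrite mulr_ge0 ?sqr_ge0.
rewrite /energy [X in _ <= X + _]mulrCA [X in _ <= _ + X]mulrCA -mulrDr ler_wpM2l //.
rewrite /sqnorm !mulr_sumr -big_split /=; apply: ler_sum => j _.
set v := increment eta G D.
have -> : (U^T *m next_iterate eta X G D) j 0 = (U^T *m v) j 0 + a 0 j * (U^T *m X) j 0.
  by rewrite mulmxDr mxE complement_eigen addrC.
have -> : (U^T *m increment eta G' (D + B *m next_iterate eta X G D)) j 0
  = a 0 j * (U^T *m v) j 0 - a 0 j * (1 - a 0 j) * (U^T *m X) j 0
    + - (eta * a 0 j * (U^T *m (G' - G)) j 0).
  rewrite next_increment -/v; move: (G' - G) => H.
  have cB (x y : 'cV[R]_(K.-1 * d)) : (x - y) j 0 = x j 0 - y j 0 by rewrite !mxE.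
  have cZ (x : 'cV[R]_(K.-1 * d)) : (eta *: x) j 0 = eta * x j 0 by rewrite mxE.
  rewrite !mulmxBr -scalemxAr !cB cZ !complement_eigen; ring.
apply: le_trans (mode_contraction _ _ _ (ha j) lam1) _; rewrite lerD2l sqrrN.
rewrite -[leRHS]mulrA; apply: ler_wpM2l; first by rewrite divr_ge0 // ltW.
rewrite !exprMn; apply: ler_wpM2r; first exact: sqr_ge0.
apply: ler_wpM2l; first exact: sqr_ge0.
by have /andP[a0 al] := ha j; rewrite ler_pXn2r ?nnegrE // (le_trans a0).
Qed.

(** The energy controls the disagreement one round later; the disagreement of the current iterate is
    therefore a separate component of the Lyapunov function. *)
Lemma consensus_step eta X X' G D : X' = next_iterate eta X G D ->
  K%:R^-1 * sqnorm (X' - averaging R K d *m X') <= energy eta X G D / (1 - lam).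
Proof.
move=> ->; rewrite -(complement_sqnorm K0 UU cU) /energy -mulrA ler_wpM2l ?invr_ge0 //.
rewrite /sqnorm mulr_suml; apply: ler_sum => j _.
by rewrite mulmxDr mxE complement_eigen addrC; exact: mode_bound (ha j) lam1.
Qed.

(** A consensual start removes the [x^2] part and [B *m D = 0] the dual part. Since [U^T]
    annihilates the averaging matrix, that matrix may be subtracted from [A], which produces
    [zeta0]. *)
Lemma energy_initial eta X G D : B *m D = 0 -> U^T *m X = 0 ->
  energy eta X G D <= eta ^+ 2 * (K%:R^-1 * sqnorm ((A - averaging R K d) *m G)).
Proof.
move=> BD UX; rewrite /energy mulrCA ler_wpM2l ?invr_ge0 //.
rewrite (_ : \sum_j _ = sqnorm (U^T *m increment eta G D)); last first.
  apply: eq_bigr => j _; have -> : (U^T *m X) j 0 = 0 by rewrite UX mxE.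
  by rewrite expr0n mulr0 addr0.
have Uavg : U^T *m averaging R K d = 0.
  have -> : averaging R K d = 1%:M - U *m U^T.
    by rewrite (complement_projection K0 UU cU) opprB addrC subrK.
  by rewrite mulmxBr mulmx1 mulmxA UU mul1mx subrr.
rewrite /increment BD addr0 mulmxN sqnormN -scalemxAr sqnormZ ler_wpM2l ?sqr_ge0 //.
have -> : U^T *m (A *m G) = U^T *m ((A - averaging R K d) *m G).
  by rewrite mulmxBl [in RHS]mulmxBr [in X in _ - X]mulmxA Uavg mul0mx subr0.
exact: (complement_sqnorm_le K0 UU cU).
Qed.

End ExactDiffusion.

(** * Spectrum of the mixing matrix *)

Section NetworkSpectrum.
Context {R : realType} {K : nat}.
Variables (W : 'M[R]_K).
Hypotheses (K2 : (2 <= K)%N) (hW : network_matrix W) (pW : psd W).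

Let K0 : (0 < K)%N. Proof. exact: ltnW. Qed.
Let k0 : 'I_K := Ordinal K0.
Let WT : W^T = W. Proof. by case: hW. Qed.
Let W0 k l : 0 <= W k l. Proof. by case: hW. Qed.
Let Wr k : \sum_l W k l = 1. Proof. by case: hW. Qed.

Let e : 'cV[R]_K := const_mx 1.

Let We : W *m e = e.
Proof.
by apply/colP => k; rewrite !mxE -[RHS](Wr k); apply: eq_bigr => l _; rewrite mxE mulr1.
Qed.

(** Maximum principle for the positive power [W ^+ m]: at a maximal entry [v i0 0] a strictly
    positive average of the nonnegative numbers [v i0 0 - v l 0] vanishes. *)
Lemma network_fixed_const (v : 'cV[R]_K) : W *m v = v -> forall k l, v k 0 = v l 0.
Proof.
move=> Wv; have [_ _ _ _ [m mpos]] := hW.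
have iter_fix (u : 'cV[R]_K) i : W *m u = u -> W ^+ i *m u = u.
  by move=> Wu; elim: i => [|i IH]; rewrite ?expr0 ?mul1mx // exprS -mulmxA IH.
have [i0 _ imax] := @Order.TotalTheory.arg_maxP _ _ 'I_K k0 xpredT (fun k => v k 0) isT.
suff cst j : v j 0 = v i0 0 by move=> k l; rewrite !cst.
have s1 : \sum_l (W ^+ m) i0 l = 1.
  have /colP/(_ i0) := iter_fix e m We; rewrite !mxE => <-.
  by apply: eq_bigr => l _; rewrite mxE mulr1.
have s2 : \sum_l (W ^+ m) i0 l * v l 0 = v i0 0.
  by have /colP/(_ i0) := iter_fix v m Wv; rewrite mxE.
have : \sum_l (W ^+ m) i0 l * (v i0 0 - v l 0) = 0.
  under eq_bigr do rewrite mulrBr.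
  by rewrite sumrB -mulr_suml s1 s2 mul1r subrr.
move/eqP; rewrite psumr_eq0 => [|l _]; last first.
  by rewrite mulr_ge0 ?(ltW (mpos _ _)) // subr_ge0; exact: imax.
move=> /allP /(_ j (mem_index_enum _)) /=.
by rewrite mulf_eq0 (gt_eqF (mpos _ _)) subr_eq0 eq_sym => /eqP.
Qed.

Lemma network_fixed0 (v : 'cV[R]_K) : W *m v = v -> \sum_k v k 0 = 0 -> v = 0.
Proof.
move=> Wv v0; have cst := network_fixed_const Wv.
apply/colP => k; rewrite mxE; move: v0.
rewrite (eq_bigr (fun=> v k 0)) => [|l _]; last exact: cst.
by rewrite sumr_const card_ord => /eqP; rewrite mulrn_eq0 eqn0Ngt K0 => /eqP.
Qed.

Lemma network_eigenvalue (a : R) (v : 'cV[R]_K) : v != 0 -> W *m v = a *: v -> 0 <= a <= 1.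
Proof.
move=> v0 Wv; apply/andP; split.
  have [_ /(_ v)] := pW; rewrite -mulmxA Wv -scalemxAr mxE -sqnorm_mulmx.
  suff vp : 0 < sqnorm v by rewrite pmulr_lge0.
  rewrite lt_def sqnorm_ge0 andbT; apply: contra v0 => /eqP s0.
  by apply/eqP; exact: sqnorm_eq0.
have [i0 _ imax] := @Order.TotalTheory.arg_maxP _ _ 'I_K k0 xpredT (fun k => `|v k 0|) isT.
have vp : 0 < `|v i0 0|.
  rewrite lt_def normr_ge0 andbT; apply: contra v0 => /eqP s0.
  apply/eqP/colP => j; rewrite mxE; apply/eqP; rewrite -normr_le0 -s0; exact: imax.
have : `|a| * `|v i0 0| <= `|v i0 0|.
  have /colP/(_ i0) := Wv; rewrite !mxE -normrM => <-.
  apply: le_trans (ler_norm_sum _ _ _) _.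
  rewrite -[leRHS]mul1r -(Wr i0) mulr_suml; apply: ler_sum => l _.
  by rewrite normrM ger0_norm // ler_wpM2l //; exact: imax.
rewrite -[X in _ <= X -> _]mul1r ler_pM2r // => a1; exact: le_trans (ler_norm a) a1.
Qed.

(* Column operations on the block matrix [[M, -u], [e^T, 1]], with M e = (X - 1) e and
   u = e / K. *)
Lemma char_poly_deflation :
  ('X - 1%:P) * \det (char_poly_mx W + const_mx (K%:R^-1)%:P)
  = 'X * \det (char_poly_mx W).
Proof.
set M := char_poly_mx W.
pose ep : 'cV[{poly R}]_K := const_mx 1.
pose u : 'cV[{poly R}]_K := (K%:R^-1)%:P *: ep.
have Me : M *m ep = ('X - 1%:P) *: ep.
  have mapWe : map_mx polyC W *m ep = ep.
    have -> : ep = map_mx polyC e by rewrite map_const_mx.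
    by rewrite -map_mxM We.
  rewrite /M /char_poly_mx mulmxBl mapWe mul_scalar_mx scalerBl; congr (_ - _).
  by rewrite scale1r.
have eu : ep^T *m u = 1%:M.
  apply/matrixP => i j; rewrite !mxE !ord1 eqxx.
  under eq_bigr do rewrite !mxE mul1r mulr1.
  rewrite sumr_const card_ord -polyCMn -[_ *+ K]mulr_natl divff //.
  by rewrite pnatr_eq0 -lt0n.
have J : u *m ep^T = const_mx (K%:R^-1)%:P.
  by apply/matrixP => i j; rewrite !mxE big_ord1 !mxE !mulr1.
pose Nb := block_mx M (- u) ep^T (1%:M : 'M[{poly R}]_1).
have d1 : \det Nb = \det (M + u *m ep^T).
  have : \det (Nb *m block_mx 1%:M 0 (- ep^T) 1%:M) = \det (M + u *m ep^T).
    rewrite mulmx_block !mulmx1 !mulmx0 !add0r mulNmx mulmxN opprK mul1mx subrr.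
    by rewrite det_ublock det1 mulr1.
  by rewrite det_mulmx det_lblock !det1 !mulr1.
have : \det (Nb *m block_mx 1%:M u 0 ('X - 1%:P)%:M) = \det M * 'X.
  rewrite mulmx_block !mulmx1 !mulmx0 !addr0 eu mul1mx.
  have -> : M *m u + - u *m ('X - 1%:P)%:M = 0.
    rewrite /u -scalemxAr Me mulNmx mul_mx_scalar !scalerA mulrC subrr //.
  have -> : 1%:M + ('X - 1%:P)%:M = 'X%:M :> 'M[{poly R}]_1.
    by apply/matrixP => i j; rewrite !mxE !ord1 eqxx !mulr1n addrC subrK.
  by rewrite det_lblock det_scalar1.
rewrite det_mulmx det_ublock det1 mul1r det_scalar1 d1 J => h.
by rewrite mulrC h mulrC.
Qed.

(** [second_eigenvalue] counts roots of the characteristic polynomial, so a one-dimensional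
    eigenspace is not enough. If 1 were a double root, deflation would leave it a root of the
    determinant of [X - W + 1/K], where [1/K] is the constant matrix. A vector in the kernel of
    [1 - W + 1/K] has zero sum and is fixed by [W], hence vanishes. *)
Lemma network_one_simple : ~~ (('X - 1%:P) ^+ 2 %| char_poly W).
Proof.
apply/negP => /dvdpP[r hr].
have X1 : 'X - 1%:P != 0 :> {poly R} by rewrite polyXsubC_eq0.
have := char_poly_deflation; rewrite -/(char_poly W) hr expr2 mulrA mulrCA => h.
have {}h : \det (char_poly_mx W + const_mx (K%:R^-1)%:P) = 'X * (r * ('X - 1%:P)).
  by apply: (mulfI X1); rewrite h; ring.
have : \det (1%:M - W + const_mx K%:R^-1) = 0.
  have -> : 1%:M - W + const_mx K%:R^-1
      = map_mx (horner_eval 1) (char_poly_mx W + const_mx (K%:R^-1)%:P).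
    apply/matrixP => i j; rewrite !mxE /horner_eval !hornerE.
    by case: (i == j); rewrite ?mulr1n ?mulr0n !hornerE.
  by rewrite det_map_mx h /= /horner_eval !hornerE subrr !mulr0.
move/eqP/det0P => [v v0 hv].
have ve : \sum_k v 0 k = 0.
  have := congr1 (fun M => (M *m e) 0 0) hv.
  rewrite mul0mx [RHS]mxE -mulmxA mulmxDl mulmxBl mul1mx We subrr add0r.
  have -> : const_mx K%:R^-1 *m e = e.
    apply/colP => k; rewrite !mxE.
    under eq_bigr do rewrite !mxE mulr1.
    by rewrite sumr_const card_ord -[_ *+ K]mulr_natl divff // pnatr_eq0 -lt0n.
  by move=> ve; rewrite -[RHS]ve mxE; apply: eq_bigr => k _; rewrite mxE mulr1.
have vJ : v *m const_mx K%:R^-1 = 0 :> 'rV[R]_K.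
  apply/rowP => j; rewrite !mxE.
  under eq_bigr do rewrite mxE.
  by rewrite -mulr_suml ve mul0r.
move: hv; rewrite mulmxDr vJ addr0 mulmxBr mulmx1 => /eqP; rewrite subr_eq0 => /eqP hv.
have : v^T = 0.
  apply: network_fixed0; first by rewrite -{1}WT -trmx_mul -hv.
  by rewrite -[RHS]ve; apply: eq_bigr => k _; rewrite mxE.
by move/(congr1 trmx); rewrite trmxK trmx0 => /eqP; rewrite (negbTE v0).
Qed.

Variables (lam : R).
Hypothesis hlam : second_eigenvalue W lam.

(** All eigenvalues lie in [[0, 1]], so the sorted list starts with 1, and simplicity keeps its
    second entry below 1. An eigenvector with zero sum cannot belong to 1, so its eigenvalue sits in
    the tail of the list, which [lam] dominates. *)
Lemma second_eigenvalue_bounds : 0 <= lam < 1 /\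
  forall (a : R) (v : 'cV[R]_K), v != 0 -> W *m v = a *: v -> \sum_k v k 0 = 0 ->
    0 <= a <= lam.
Proof.
case: hlam => s [cs srt ->].
have rootP a : a \in s -> exists2 v : 'cV[R]_K, v != 0 & W *m v = a *: v.
  move=> ain; have : root (char_poly W) a by rewrite cs root_prod_XsubC.
  rewrite -eigenvalue_root_char => /eigenvalueP[v hv v0].
  exists v^T; first by rewrite trmx_eq0.
  by rewrite -{1}WT -trmx_mul hv linearZ.
have memP a (v : 'cV[R]_K) : v != 0 -> W *m v = a *: v -> a \in s.
  move=> v0 Wv; rewrite -root_prod_XsubC -cs -eigenvalue_root_char.
  apply/eigenvalueP; exists v^T; last by rewrite trmx_eq0.
  by rewrite -[X in _ *m X]WT -trmx_mul Wv linearZ.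
have bnd a : a \in s -> 0 <= a <= 1.
  by case/rootP => v v0 Wv; exact: network_eigenvalue v0 Wv.
have e0 : e != 0.
  by apply/eqP => /colP/(_ k0); rewrite !mxE => /eqP; rewrite oner_eq0.
have one_in : 1 \in s by apply: (memP _ e e0); rewrite We scale1r.
have sz : size s = K.
  have := size_char_poly W; rewrite cs size_prod_XsubC => -[]; done.
case: s cs srt rootP memP bnd one_in sz => [|s0 [|s1 s]] cs srt rootP memP bnd one_in sz.
- by [].
(* For a list of length one the entry at index 1 would be the default value; [K >= 2] excludes
   this. *)
- by exfalso; move: K2; rewrite -sz.
have tr : transitive (fun a b : R => `|b| <= `|a|) by move=> x y z h1 h2; exact: le_trans h2 h1.
have s01 : s0 = 1.
  apply/eqP; rewrite eq_le; have /andP[s00 ->] := bnd s0 (mem_head _ _); rewrite /=.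
  move: one_in; rewrite inE => /orP[/eqP<- //|one_in].
  have /allP/(_ _ one_in) /= := order_path_min tr srt.
  by rewrite normr1 ger0_norm.
have /andP[s10 s11] : 0 <= s1 <= 1 by apply: bnd; rewrite !inE eqxx orbT.
have nat1 : `|[:: s0, s1 & s]`_1| = s1 by rewrite /= ger0_norm.
rewrite nat1; split.
  rewrite s10 lt_neqAle s11 andbT; apply/negP => /eqP s1e.
  move: network_one_simple; rewrite cs s01 s1e !big_cons mulrA -expr2 => /negP; apply.
  exact: dvdp_mulr.
move=> a v v0 Wv sv; have ain := memP _ _ v0 Wv.
have /andP[a0 a1] := bnd _ ain; rewrite a0 /=.
have an1 : a != 1.
  apply: contra v0 => /eqP ae; apply/eqP/network_fixed0 => //.
  by rewrite Wv ae scale1r.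
move: ain; rewrite inE s01 (negbTE an1) /= inE => /orP[/eqP-> //|ain].
have /= /andP[_ ps] := srt.
have /allP/(_ _ ain) /= := order_path_min tr ps.
by rewrite !ger0_norm.
Qed.

Variables (d : nat) (U : 'M[R]_(K * d, K.-1 * d)) (a : 'rV[R]_(K.-1 * d)).
Hypotheses (UU : U^T *m U = 1%:M)
  (cU : ((const_mx 1 : 'cV[R]_K) *t (1%:M : 'M[R]_d))^T *m U = 0)
  (AU : (W *t 1%:M) *m U = U *m diag_mx a).

(** A column of [U] is nonzero, hence so is its slice at some coordinate [c] of a single agent's
    vector. That slice is an eigenvector of [W] itself and has zero sum. *)
Lemma complement_eigenvalues j : 0 <= a 0 j <= lam.
Proof.
have [_ bnd] := second_eigenvalue_bounds.
pose v (c : 'I_d) : 'cV[R]_K := \col_k U (mxtens_index (k, c)) j.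
have [c vc] : exists c, v c != 0.
  apply/existsP; rewrite -[[exists _, _]]negbK negb_exists; apply/negP => /forallP h.
  have /matrixP/(_ j j) := UU; rewrite !mxE eqxx => /eqP; rewrite eq_sym.
  rewrite big1 ?oner_eq0 // => i _; rewrite -(mxtens_unindexK i).
  have := h (mxtens_unindex i).2; rewrite negbK => /eqP/colP/(_ (mxtens_unindex i).1).
  by rewrite !mxE -surjective_pairing => ->; rewrite mulr0.
apply: (bnd _ _ vc).
  apply/colP => k; rewrite !mxE.
  have /matrixP/(_ (mxtens_index (k, c)) j) := AU.
  rewrite mul_mx_diag !mxE mulrC => <-.
  rewrite sum_mxtens.
  apply: eq_bigr => l _; rewrite (bigD1 c) //= big1 => [|c' cc'].
    by rewrite !tensmxE !mxE eqxx mulr1 addr0.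
  by rewrite !tensmxE !mxE eq_sym (negbTE cc') mulr0 mul0r.
have /matrixP/(_ (mxtens_index (0, c)) j) := cU.
rewrite mxE [RHS]mxE => h; rewrite -[RHS]h sum_mxtens.
apply: eq_bigr => l _; rewrite (bigD1 c) //= big1 => [|c' cc'].
  by rewrite mxE [_^T _ _]mxE tensmxE !mxE eqxx !mul1r addr0.
by rewrite [_^T _ _]mxE tensmxE !mxE (negbTE cc') mulr0 mul0r.
Qed.

End NetworkSpectrum.

(** * Sampling *)

Definition sample_mean {R : realType} {I : finType} {N : nat}
    (F : {ffun I -> 'I_N} -> R) : R :=
  N%:R^-1 ^+ #|I| * \sum_f F f.

Section SampleMean.
Context {R : realType} {I : finType} {N : nat}.
Hypothesis N0 : (0 < N)%N.
Implicit Types F G : {ffun I -> 'I_N} -> R.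

Let NR0 : (N%:R : R) != 0. Proof. by rewrite pnatr_eq0 -lt0n. Qed.

Lemma sample_meanD F G :
  sample_mean (fun f => F f + G f) = sample_mean F + sample_mean G.
Proof. by rewrite /sample_mean big_split mulrDr. Qed.

Lemma sample_meanZ a F : sample_mean (fun f => a * F f) = a * sample_mean F.
Proof. by rewrite /sample_mean -mulr_sumr mulrCA. Qed.

Lemma eq_sample_mean F G : F =1 G -> sample_mean F = sample_mean G.
Proof. by move=> e; congr (_ * _); apply: eq_bigr. Qed.

Lemma le_sample_mean F G : (forall f, F f <= G f) -> sample_mean F <= sample_mean G.
Proof.
by move=> le; rewrite ler_wpM2l ?exprn_ge0 ?invr_ge0 // ler_sum.
Qed.

Lemma sample_mean_sum (J : Type) (r : seq J) (P : pred J)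
    (F : J -> {ffun I -> 'I_N} -> R) :
  sample_mean (fun f => \sum_(j <- r | P j) F j f)
  = \sum_(j <- r | P j) sample_mean (F j).
Proof. by rewrite /sample_mean exchange_big mulr_sumr. Qed.

(** Independence of the draws in the form of distributivity; a single draw and a pair of draws
    follow by setting the other factors to 1. *)
Lemma sample_mean_prod (G : I -> 'I_N -> R) :
  sample_mean (fun f => \prod_i G i (f i)) = \prod_i mean (G i : 'I_N -> R^o).
Proof.
rewrite /sample_mean /mean -[RHS]/(\prod_i (N%:R^-1 * \sum_s G i s)).
by rewrite big_split /= prodr_const bigA_distr_bigA.
Qed.

Lemma sample_mean_cst (a : R) : sample_mean (fun _ : {ffun I -> 'I_N} => a) = a.
Proof.
rewrite /sample_mean sumr_const card_ffun card_ord -[a *+ _]mulr_natl mulrA natrX.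
by rewrite exprVn mulVf ?mul1r // expf_neq0.
Qed.

Lemma sample_mean_coord i (phi : 'I_N -> R) :
  sample_mean (fun f : {ffun I -> 'I_N} => phi (f i)) = mean (phi : 'I_N -> R^o).
Proof.
have := sample_mean_prod (fun l s => if l == i then phi s else 1).
rewrite (bigD1 i) //= big1 => [|l li]; last by rewrite (negbTE li); exact: (mean_cst N0).
rewrite eqxx mulr1 => <-; apply: eq_sample_mean => f.
by rewrite (bigD1 i) //= eqxx big1 ?mulr1 // => l /negbTE ->.
Qed.

Lemma sample_mean_indep i j (phi psi : 'I_N -> R) : i != j ->
  sample_mean (fun f : {ffun I -> 'I_N} => phi (f i) * psi (f j))
  = mean (phi : 'I_N -> R^o) * mean (psi : 'I_N -> R^o).
Proof.
move=> ij.
have := sample_mean_prod (fun l s => if l == i then phi s else if l == j then psi s else 1).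
have ji : j != i by rewrite eq_sym.
rewrite (bigD1 i) //= (bigD1 j) //= eqxx (negbTE ji) eqxx big1 => [|l /andP[li lj]]; last first.
  by rewrite (negbTE li) (negbTE lj); exact: (mean_cst N0).
rewrite mulr1 => <-; apply: eq_sample_mean => f.
rewrite (bigD1 i) //= (bigD1 j) //= eqxx (negbTE ji) eqxx big1 ?mulr1 // => l /andP[li lj].
by rewrite (negbTE li) (negbTE lj).
Qed.

(** Centred independent terms have vanishing cross products, coordinate by coordinate. The weights
    [c] cover two uses: the constant [1 / (K b)] for the network average, and [1 / b] times the
    indicator of one agent. *)
Lemma sample_mean_variance d (e : 'cV[R]_d) (c : I -> R) (v : I -> 'I_N -> 'cV[R]_d) :
  sample_mean (fun f => sqnorm (e + \sum_i c i *: (v i (f i) - mean (v i))))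
  = sqnorm e + \sum_i c i ^+ 2 * mean (fun s => sqnorm (v i s - mean (v i)) : R^o).
Proof.
pose u i s := c i *: (v i s - mean (v i)).
have u0 i : mean (u i) = 0 by rewrite meanZ meanB mean_cst // subrr scaler0.
transitivity (sample_mean (fun f => sqnorm e + (2 * \sum_i dot e (u i (f i))
    + \sum_i \sum_j dot (u i (f i)) (u j (f j))))).
  apply: eq_sample_mean => f; rewrite sqnormD -addrA; congr (_ + (_ * _ + _)).
    by rewrite dot_sumr.
  by rewrite sqnormE dot_suml; apply: eq_bigr => i _; rewrite dot_sumr.
rewrite sample_meanD sample_mean_cst sample_meanD sample_meanZ !sample_mean_sum.
congr (_ + _); rewrite big1 ?mulr0 ?add0r => [|i _]; last first.
  rewrite (sample_mean_coord i (fun s => dot e (u i s))).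
  rewrite (eq_mean (G := fun s => dot (u i s) e : R^o)) => [|s]; last by rewrite dotC.
  by rewrite -mean_dotl u0 dot0l.
apply: eq_bigr => i _; rewrite sample_mean_sum (bigD1 i) //= big1 ?addr0 => [|j ji].
  rewrite (sample_mean_coord i (fun s => dot (u i s) (u i s))) -meanMl.
  by apply: eq_mean => s; rewrite -sqnormE sqnormZ.
rewrite sample_mean_sum big1 // => l _.
rewrite (sample_mean_indep (fun s => u i s l 0) (fun s => u j s l 0)); last by rewrite eq_sym.
rewrite (_ : mean (fun s => u i s l 0 : R^o) = mean (u i) l 0); last first.
  by rewrite /mean mxE summxE.
by rewrite u0 mxE mul0r.
Qed.

End SampleMean.

(* In order: coin, large batches, small-batch samples. *)
Definition round (K N b : nat) : finType :=
  (bool * {ffun 'I_K -> {ffun 'I_N -> 'I_N}} * {ffun 'I_K * 'I_b -> 'I_N})%type.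

Definition large_weight {R : realType} {N B : nat} (f : {ffun 'I_B -> 'I_N}) : R :=
  if injectiveb f then (N ^_ B)%:R^-1 else 0.

Definition round_weight {R : realType} {K N b : nat} (p : R) (r : round K N b) : R :=
  (if r.1.1 then p else 1 - p) * \prod_k large_weight (r.1.2 k)
    * N%:R^-1 ^+ #|{: 'I_K * 'I_b}|.

Definition round_mean {R : realType} {K N b : nat} (p : R) (F : round K N b -> R) : R :=
  \sum_r round_weight p r * F r.

Section RoundMean.
Context {R : realType} {K N b : nat} (p : R).
Hypotheses (N0 : (0 < N)%N) (p01 : 0 <= p <= 1).
Implicit Types F G : round K N b -> R.

Lemma large_weight_ge0 B (f : {ffun 'I_B -> 'I_N}) : 0 <= large_weight f :> R.
Proof. by rewrite /large_weight; case: ifP; rewrite ?invr_ge0. Qed.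

Lemma sum_large_weight : \sum_(f : {ffun 'I_N -> 'I_N}) large_weight f = 1 :> R.
Proof.
rewrite /large_weight -big_mkcond /= sumr_const.
have -> : #|[pred f : {ffun 'I_N -> 'I_N} | injectiveb f]| = N ^_ N.
  by rewrite -[in RHS](card_ord N) -card_inj_ffuns cardsE.
rewrite -[_ *+ _]mulr_natl divff // pnatr_eq0 ffactnn; exact: lt0n_neq0 (fact_gt0 _).
Qed.

Lemma round_weight_ge0 (r : round K N b) : 0 <= round_weight p r.
Proof.
have /andP[p0 p1] := p01.
rewrite !mulr_ge0 ?exprn_ge0 ?invr_ge0 //; first by case: ifP; rewrite // subr_ge0.
by apply: prodr_ge0 => k _; exact: large_weight_ge0.
Qed.

(** A batch of size [N] drawn without replacement is a permutation of the samples, so under a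
    successful coin the value is a constant [A] wherever the weight is nonzero; under a failed coin
    the large batches sum out to one. *)
Lemma round_mean_split (A : R) (H : {ffun 'I_K * 'I_b -> 'I_N} -> R) F :
  (forall (lg : {ffun 'I_K -> {ffun 'I_N -> 'I_N}}) sm,
     (forall k, injectiveb (lg k)) -> F (true, lg, sm) = A) ->
  (forall lg sm, F (false, lg, sm) = H sm) ->
  round_mean p F = p * A + (1 - p) * sample_mean H.
Proof.
move=> FA FH.
have -> : round_mean p F = \sum_(c : bool) \sum_(lg : {ffun 'I_K -> {ffun 'I_N -> 'I_N}})
    \sum_(sm : {ffun 'I_K * 'I_b -> 'I_N}) round_weight p (c, lg, sm) * F (c, lg, sm).
  by rewrite !pair_bigA /=; apply: eq_bigr => -[[c lg] sm].
rewrite big_bool /=; congr (_ + _).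
  transitivity (\sum_(lg : {ffun 'I_K -> {ffun 'I_N -> 'I_N}})
     \prod_k large_weight (lg k) * (p * A)); last first.
    rewrite -mulr_suml -(bigA_distr_bigA (fun _ f => large_weight f)) big1 ?mul1r //.
    by move=> k _; exact: sum_large_weight.
  apply: eq_bigr => lg _; rewrite /round_weight /=.
  have [inj|ninj] := boolP [forall k, injectiveb (lg k)].
    have FAl sm : F (true, lg, sm) = A by apply: FA; exact/forallP.
    under eq_bigr do rewrite FAl.
    rewrite -big_distrl /= -mulr_sumr.
    set P := \prod_k _.
    have := @sample_mean_cst R {: 'I_K * 'I_b} N N0 1; rewrite /sample_mean => e.
    transitivity (p * P * (N%:R^-1 ^+ #|{: 'I_K * 'I_b}|
       * (\sum_(f : {ffun 'I_K * 'I_b -> 'I_N}) 1)) * A).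
      by congr (_ * _); congr (_ * _); rewrite mulr_sumr; apply: eq_bigr => f _; rewrite mulr1.
    by rewrite e; ring.
  have [k nk] := forallPn ninj.
  have P0 : \prod_k large_weight (lg k) = 0 :> R.
    by rewrite (bigD1 k) //= {1}/large_weight (negbTE nk) mul0r.
  by rewrite P0 mul0r big1 // => f _; rewrite mulr0 !mul0r.
transitivity (\sum_(lg : {ffun 'I_K -> {ffun 'I_N -> 'I_N}})
   \prod_k large_weight (lg k) * ((1 - p) * sample_mean H)); last first.
  rewrite -mulr_suml -(bigA_distr_bigA (fun _ f => large_weight f)) big1 ?mul1r //.
  by move=> k _; exact: sum_large_weight.
apply: eq_bigr => lg _; rewrite /round_weight /sample_mean !mulr_sumr.
by apply: eq_bigr => f _; rewrite FH /=; ring.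
Qed.

Lemma round_meanD F G : round_mean p (fun r => F r + G r) = round_mean p F + round_mean p G.
Proof. by rewrite /round_mean -big_split; apply: eq_bigr => r _; rewrite mulrDr. Qed.

Lemma round_meanZ a F : round_mean p (fun r => a * F r) = a * round_mean p F.
Proof. by rewrite /round_mean mulr_sumr; apply: eq_bigr => r _; rewrite mulrCA. Qed.

Lemma le_round_mean F G : (forall r, F r <= G r) -> round_mean p F <= round_mean p G.
Proof. by move=> le; apply: ler_sum => r _; rewrite ler_wpM2l // round_weight_ge0. Qed.

Lemma round_mean_cst (a : R) : round_mean p (fun _ : round K N b => a) = a.
Proof.
rewrite (@round_mean_split a (fun=> a)) // sample_mean_cst // -mulrDl.
by rewrite addrCA subrr addr0 mul1r.
Qed.

End RoundMean.

(** * One round of the variance-reduced estimator *)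

Section Estimator.
Context {R : realType} {K N b d1 d2 d : nat} (p : R).
Local Notation Z := ('cV[R]_d1 * 'cV[R]_d2)%type.
Hypotheses (K0 : (0 < K)%N) (N0 : (0 < N)%N) (b0 : (0 < b)%N) (p01 : 0 <= p <= 1).
Variables (gr : 'I_K -> Z -> 'I_N -> 'cV[R]_d).

Let bR : (b%:R : R) != 0. Proof. by rewrite pnatr_eq0 -lt0n. Qed.
Let KR : (K%:R : R) != 0. Proof. by rewrite pnatr_eq0 -lt0n. Qed.

(** The average over the agents sees [K b] independent draws, each agent only [b]. This factor [K]
    is the gain from cooperation, and it permits batches of size [sqrt (N / K)]. *)
Lemma batch_deviation (v : 'I_K -> 'I_N -> 'cV[R]_d) (e : 'I_K -> 'cV[R]_d) :
  let dev (f : {ffun 'I_K * 'I_b -> 'I_N}) k :=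
    e k + (batch_mean (fun j => f (k, j)) (v k) - mean (v k)) in
  let Vbar := mean (fun k => mean (fun s => sqnorm (v k s - mean (v k)) : R^o) : R^o) in
  sample_mean (fun f => sqnorm (mean (dev f))) = sqnorm (mean e) + (K%:R * b%:R)^-1 * Vbar
  /\ sample_mean (fun f => mean (fun k => sqnorm (dev f k) : R^o))
     = mean (fun k => sqnorm (e k) : R^o) + b%:R^-1 * Vbar.
Proof.
move=> dev Vbar.
have devE f k : dev f k = e k + \sum_(j < b) b%:R^-1 *: (v k (f (k, j)) - mean (v k)).
  rewrite /dev /batch_mean -scaler_sumr sumrB scalerBr sumr_const card_ord.
  by rewrite -[mean _ *+ b]scaler_nat scalerA mulVf // scale1r.
split.
  rewrite (eq_sample_mean (G := fun f => sqnorm (mean e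
     + \sum_(i : 'I_K * 'I_b) (K%:R * b%:R)^-1 *: (v i.1 (f i) - mean (v i.1))))); last first.
    move=> f; congr sqnorm; rewrite (eq_mean (G := fun k => e k
      + \sum_(j < b) b%:R^-1 *: (v k (f (k, j)) - mean (v k)))) // meanD; congr (_ + _).
    transitivity (\sum_(k < K) \sum_(j < b)
        (K%:R * b%:R)^-1 *: (v k (f (k, j)) - mean (v k))); last by rewrite pair_bigA; apply: eq_bigr => -[].
    rewrite -[LHS]/(K%:R^-1 *: \sum_(k < K) \sum_(j < b)
        b%:R^-1 *: (v k (f (k, j)) - mean (v k))) scaler_sumr.
    apply: eq_bigr => k _; rewrite scaler_sumr; apply: eq_bigr => j _.
    by rewrite scalerA invfM.
  rewrite (sample_mean_variance N0 (mean e) (fun=> (K%:R * b%:R)^-1) (fun i => v i.1)).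
  congr (_ + _); rewrite -mulr_sumr.
  rewrite -(pair_bigA _ (fun k (j : 'I_b) => mean (fun s => sqnorm (v k s - mean (v k)) : R^o))) /=.
  under eq_bigr do rewrite sumr_const card_ord -[_ *+ b]mulr_natl.
  rewrite -mulr_sumr /Vbar {2}/mean -[X in _ = _ * X]/(_ * _).
  by move: (\sum_(k < K) _) => S; field; rewrite bR KR.
rewrite /mean -[LHS]/(sample_mean (fun f => K%:R^-1 * \sum_k sqnorm (dev f k))).
rewrite sample_meanZ sample_mean_sum.
have one k : sample_mean (fun f => sqnorm (dev f k))
    = sqnorm (e k) + b%:R^-1 * mean (fun s => sqnorm (v k s - mean (v k)) : R^o).
  rewrite (eq_sample_mean (G := fun f => sqnorm (e k
     + \sum_(i : 'I_K * 'I_b) (if i.1 == k then b%:R^-1 else 0)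
        *: (v i.1 (f i) - mean (v i.1))))); last first.
    move=> f; rewrite devE; congr (sqnorm (_ + _)).
    transitivity (\sum_(k' < K) \sum_(j < b) (if k' == k then b%:R^-1 else 0)
       *: (v k' (f (k', j)) - mean (v k'))); last by rewrite pair_bigA; apply: eq_bigr => -[].
    rewrite (bigD1 k) //= eqxx.
    by rewrite [X in _ + X]big1 ?addr0 // => l /negbTE ->; rewrite big1 // => j _; rewrite scale0r.
  rewrite (sample_mean_variance N0 (e k) (fun i => if i.1 == k then b%:R^-1 else 0)
     (fun i => v i.1)); congr (_ + _).
  rewrite -(pair_bigA _ (fun k' (j : 'I_b) => (if k' == k then b%:R^-1 else 0) ^+ 2
     * mean (fun s => sqnorm (v k' s - mean (v k')) : R^o))) /= (bigD1 k) //= eqxx.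
  rewrite [X in _ + X]big1 ?addr0 => [|l /negbTE ->]; last first.
    by rewrite big1 // => j _; rewrite expr0n mul0r.
  by rewrite sumr_const card_ord -[_ *+ b]mulr_natl; move: (mean _) => m; field.
under eq_bigr do rewrite one.
rewrite big_split /= mulrDr; congr (_ + _).
by rewrite /Vbar {2}/mean -mulr_sumr mulrCA.
Qed.

(** Measured against the mean finite difference instead of the gradient: a full batch then has error
    exactly zero, and the discretisation bias is paid separately in each round rather than carried
    along by the recursion. *)
Definition estimation_error (z : 'I_K -> Z) (g : 'I_K -> 'cV[R]_d) k : 'cV[R]_d :=
  g k - mean (gr k (z k)).

Definition sample_increment (z zn : 'I_K -> Z) : R := mean (fun k =>
  mean (fun s => sqnorm (gr k (zn k) s - gr k (z k) s) : R^o) : R^o).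

Definition next_gradients (z zn : 'I_K -> Z) (g : 'I_K -> 'cV[R]_d) (r : round K N b) k :
    'cV[R]_d :=
  next_estimator 0 r.1.1 (r.1.2 k) (fun j => r.2 (k, j)) (gr k) (z k) (zn k) (g k).

Variables (z zn : 'I_K -> Z) (g : 'I_K -> 'cV[R]_d).

Local Notation gn := (next_gradients z zn g).
Local Notation err := (estimation_error z g).
Local Notation errn r := (estimation_error zn (gn r)).
Local Notation Dbar := (sample_increment z zn).

Let batch_mean_inj (f : {ffun 'I_N -> 'I_N}) (q : 'I_N -> 'cV[R]_d) :
  injectiveb f -> batch_mean f q = mean q.
Proof.
move=> /injectiveP fi; rewrite /batch_mean /mean; congr (_ *: _).
by rewrite [RHS](reindex f) //; exact: onW_bij (injF_bij fi).
Qed.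

Let gn_true (lg : {ffun 'I_K -> {ffun 'I_N -> 'I_N}}) sm k : (forall k, injectiveb (lg k)) -> gn (true, lg, sm) k = mean (gr k (zn k)).
Proof. by move=> inj; rewrite /next_gradients /=; exact: batch_mean_inj. Qed.

Let gn_false lg sm k : gn (false, lg, sm) k
  = g k + batch_mean (fun j => sm (k, j)) (fun s => gr k (zn k) s - gr k (z k) s).
Proof.
rewrite /next_gradients /= subr0 scale1r -addrA; congr (_ + _).
by rewrite /batch_mean sumrB scalerBr addrC.
Qed.

Let errn_false lg sm k : errn (false, lg, sm) k
  = err k + (batch_mean (fun j => sm (k, j)) (fun s => gr k (zn k) s - gr k (z k) s)
     - mean (fun s => gr k (zn k) s - gr k (z k) s)).
Proof.
rewrite /estimation_error gn_false meanB.
move: (g k) (batch_mean _ _) (mean _) (mean _) => x y m n.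
by apply/colP => i; rewrite !mxE; ring.
Qed.

Let Dbar_ge0 : 0 <= Dbar.
Proof. by apply: mean_ge0 => k; apply: mean_ge0 => s; exact: sqnorm_ge0. Qed.

Let variance_Dbar : mean (fun k => mean (fun s => sqnorm (gr k (zn k) s - gr k (z k) s
   - mean (fun s => gr k (zn k) s - gr k (z k) s)) : R^o) : R^o) <= Dbar.
Proof.
apply: le_mean => k; apply: le_trans (variance_le N0 _ 0) _.
by apply: le_mean => s; rewrite subr0.
Qed.

(** With probability [p] the full batch resets the error to zero; otherwise the old error persists
    and the centred sample increment adds its variance, which is at most its second moment. *)
Lemma estimator_mean_error :
  round_mean p (fun r => sqnorm (mean (errn r)))
  <= (1 - p) * (sqnorm (mean err) + (K%:R * b%:R)^-1 * Dbar).
Proof.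
have /andP[p0 p1] := p01.
have [dv _] := batch_deviation (fun k s => gr k (zn k) s - gr k (z k) s) err.
rewrite (round_mean_split p N0 (A := 0) (H := fun f => sqnorm (mean (fun k => err k +
  (batch_mean (fun j => f (k, j)) (fun s => gr k (zn k) s - gr k (z k) s)
     - mean (fun s => gr k (zn k) s - gr k (z k) s)))))).
- rewrite mulr0 add0r ler_wpM2l ?subr_ge0 // dv lerD2l ler_wpM2l //.
- move=> lg sm inj; rewrite (eq_mean (G := fun=> 0)) => [|k].
    by rewrite mean_cst // sqnorm0.
  by rewrite /estimation_error gn_true // subrr.
- by move=> lg sm; congr sqnorm; apply: eq_mean => k; exact: errn_false.
Qed.

Lemma estimator_error :
  round_mean p (fun r => mean (fun k => sqnorm (errn r k) : R^o))
  <= (1 - p) * (mean (fun k => sqnorm (err k) : R^o) + b%:R^-1 * Dbar).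
Proof.
have /andP[p0 p1] := p01.
have [_ dv] := batch_deviation (fun k s => gr k (zn k) s - gr k (z k) s) err.
rewrite (round_mean_split p N0 (A := 0) (H := fun f => mean (fun k => sqnorm (err k +
  (batch_mean (fun j => f (k, j)) (fun s => gr k (zn k) s - gr k (z k) s)
     - mean (fun s => gr k (zn k) s - gr k (z k) s))) : R^o))).
- rewrite mulr0 add0r ler_wpM2l ?subr_ge0 // dv lerD2l ler_wpM2l //.
- move=> lg sm inj; rewrite (eq_mean (G := fun=> 0)) => [|k]; first exact: mean_cst.
  by rewrite /estimation_error gn_true // subrr sqnorm0.
- by move=> lg sm; apply: eq_mean => k; rewrite errn_false.
Qed.

(** A reset moves the estimator by its whole error, which happens with probability [p]. The same [p]
    governs the decay of the individual errors, so their weight in the Lyapunov function needs no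
    factor [1 / p]. *)
Lemma estimator_increment :
  round_mean p (fun r => mean (fun k => sqnorm (gn r k - g k) : R^o))
  <= 2 * p * mean (fun k => sqnorm (err k) : R^o) + 2 * Dbar.
Proof.
have /andP[p0 p1] := p01.
pose v k s := gr k (zn k) s - gr k (z k) s.
rewrite (round_mean_split p N0
   (A := mean (fun k => sqnorm (mean (gr k (zn k)) - g k) : R^o))
   (H := fun f => mean (fun k => sqnorm (batch_mean (fun j => f (k, j)) (v k)) : R^o))).
- have hA : mean (fun k => sqnorm (mean (gr k (zn k)) - g k) : R^o)
      <= 2 * Dbar + 2 * mean (fun k => sqnorm (err k) : R^o).
    rewrite -!meanMl -meanD; apply: le_mean => k.
    have -> : mean (gr k (zn k)) - g k = mean (v k) - err k.
      rewrite /estimation_error /v meanB; move: (g k) (mean _) (mean _) => x m n.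
      by apply/colP => i; rewrite !mxE; ring.
    apply: le_trans (sqnormB_le2 _ _) _; rewrite lerD2r ler_wpM2l //.
    exact: sqnorm_mean.
  have hH : sample_mean (fun f : {ffun 'I_K * 'I_b -> 'I_N} =>
      mean (fun k => sqnorm (batch_mean (fun j => f (k, j)) (v k)) : R^o)) <= Dbar.
    apply: (@le_trans _ _ (sample_mean (fun f : {ffun 'I_K * 'I_b -> 'I_N} =>
      K%:R^-1 * \sum_k b%:R^-1 * \sum_j sqnorm (v k (f (k, j)))))).
      apply: le_sample_mean => f; apply: le_mean => k.
      exact: (sqnorm_mean b0 (fun j => v k (f (k, j)))).
    rewrite sample_meanZ sample_mean_sum ler_wpM2l ?invr_ge0 //.
    apply: ler_sum => k _; rewrite sample_meanZ sample_mean_sum.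
    under eq_bigr do rewrite (sample_mean_coord N0 _ (fun s => sqnorm (v k s))).
    by rewrite sumr_const card_ord -[mean _ *+ b]mulr_natl mulKf.
  have e0 : 0 <= mean (fun k => sqnorm (err k) : R^o).
    by apply: mean_ge0 => k; exact: sqnorm_ge0.
  have D0 := Dbar_ge0.
  have : p * mean (fun k => sqnorm (mean (gr k (zn k)) - g k) : R^o)
     <= p * (2 * Dbar + 2 * mean (fun k => sqnorm (err k) : R^o)) by rewrite ler_wpM2l.
  have q0 : 0 <= 1 - p by rewrite subr_ge0.
  have := ler_wpM2l q0 hH.
  have : 0 <= (1 - p) * Dbar by rewrite mulr_ge0.
  move: Dbar (mean (fun k => sqnorm (err k))) (mean _) (sample_mean _) => D e m s.
  by lra.
- by move=> lg sm inj; apply: eq_mean => k; rewrite gn_true.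
- by move=> lg sm; apply: eq_mean => k; rewrite gn_false addrC addKr.
Qed.

End Estimator.

(** * Descent of the merit function *)

Section Objective.
Context {R : realType} {K N d1 d2 : nat}.
Local Notation Z := ('cV[R]_d1 * 'cV[R]_d2)%type.
Variables (Q : loss R K N d1 d2) (L : R).
Hypotheses (K0 : (0 < K)%N) (N0 : (0 < N)%N) (sQ : expected_smoothness Q L).

Let dQ k s z : differentiable (Q k s) z.
Proof. by have [/(_ k s)[]] := sQ. Qed.

Let Qx k : forall z z', mean (fun s => sqnorm (grad_x (Q k s) z - grad_x (Q k s) z') : R^o)
          <= L ^+ 2 * sqnorm2 (z - z').
Proof. by have [_ + _] := sQ; exact. Qed.

Let Qy k : forall z z', mean (fun s => sqnorm (grad_y (Q k s) z - grad_y (Q k s) z') : R^o)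
          <= L ^+ 2 * sqnorm2 (z - z').
Proof. by have [_ _] := sQ; exact. Qed.

Lemma differentiable_Jloc k z : differentiable (Jloc Q k) z.
Proof. exact: (differentiable_mean (dQ k)). Qed.

Lemma differentiable_Jglob z : differentiable (Jglob Q) z.
Proof. exact: (differentiable_mean differentiable_Jloc). Qed.

Lemma grad_x_Jloc k z : grad_x (Jloc Q k) z = mean (fun s => grad_x (Q k s) z).
Proof. exact: (grad_x_mean (dQ k)). Qed.

Lemma grad_y_Jloc k z : grad_y (Jloc Q k) z = mean (fun s => grad_y (Q k s) z).
Proof. exact: (grad_y_mean (dQ k)). Qed.

Lemma grad_x_Jglob z : grad_x (Jglob Q) z = mean (fun k => grad_x (Jloc Q k) z).
Proof. exact: (grad_x_mean differentiable_Jloc). Qed.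

Lemma grad_y_Jglob z : grad_y (Jglob Q) z = mean (fun k => grad_y (Jloc Q k) z).
Proof. exact: (grad_y_mean differentiable_Jloc). Qed.

Lemma smooth_x_Jloc k z z' :
  sqnorm (grad_x (Jloc Q k) z - grad_x (Jloc Q k) z') <= L ^+ 2 * sqnorm2 (z - z').
Proof. exact: (smooth_mean_x N0 (dQ k) (Qx k z z')). Qed.

Lemma smooth_y_Jloc k z z' :
  sqnorm (grad_y (Jloc Q k) z - grad_y (Jloc Q k) z') <= L ^+ 2 * sqnorm2 (z - z').
Proof. exact: (smooth_mean_y N0 (dQ k) (Qy k z z')). Qed.

Lemma smooth_x_Jglob z z' :
  sqnorm (grad_x (Jglob Q) z - grad_x (Jglob Q) z') <= L ^+ 2 * sqnorm2 (z - z').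
Proof.
apply: (smooth_mean_x K0 differentiable_Jloc).
rewrite -[leRHS](mean_cst K0 (_ : R^o)); apply: le_mean => k; exact: smooth_x_Jloc.
Qed.

Lemma smooth_y_Jglob z z' :
  sqnorm (grad_y (Jglob Q) z - grad_y (Jglob Q) z') <= L ^+ 2 * sqnorm2 (z - z').
Proof.
apply: (smooth_mean_y K0 differentiable_Jloc).
rewrite -[leRHS](mean_cst K0 (_ : R^o)); apply: le_mean => k; exact: smooth_y_Jloc.
Qed.

Variables (nu : R).
Hypotheses (L0 : 0 < L) (PL : PL_condition Q nu) (nuL : nu <= L).

Let kappa := L / nu.
Let nu0 : 0 < nu. Proof. by case: PL. Qed.

Lemma Pmax_attained x : exists2 y, Pmax Q x = Jglob Q (x, y) &
  forall y', Jglob Q (x, y') <= Jglob Q (x, y).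
Proof.
have [_ /(_ x)[y hy] _ _] := PL; exists y => //.
have ub : ubound (range (fun y => Jglob Q (x, y))) (Jglob Q (x, y)) by move=> _ [y' _ <-].
apply/eqP; rewrite eq_le; apply/andP; split.
  by apply: ge_sup => //; exists (Jglob Q (x, y)), y.
by apply: ub_le_sup; [exists (Jglob Q (x, y))|exists y].
Qed.

Lemma Jglob_le_Pmax z : Jglob Q z <= Pmax Q z.1.
Proof. by have [y -> h] := Pmax_attained z.1; case: z h => x y' /=. Qed.

Lemma Pstar_le x : Pstar Q <= Pmax Q x.
Proof. by apply: ge_inf; [case: PL|exists x]. Qed.

(** Differentiability of [Pmax] is bypassed. For an almost maximiser [y'] at [x + u], smoothness
    bounds [J (x + u, y')] in terms of [J (x, y') <= P x], and the error bound for [y'] lets the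
    gradient at [(x, y')] be replaced by the one at [(x, y)]. The free parameter [a] weighs the
    resulting cross term. *)
Lemma Pmax_step x u y (a : R) : 0 < a ->
  Pmax Q (x + u) - Pmax Q x <= dot (grad_x (Jglob Q) (x, y)) u + (L + a / 2) * sqnorm u
    + 4 * kappa ^+ 2 / a * (sqnorm (grad_y (Jglob Q) (x, y)) + L ^+ 2 * sqnorm u).
Proof.
move=> a0; apply/ler_addgt0Pr => eps eps0.
have [|||y' hy' dy'] := @PL_error_bound R d2 (fun y => Jglob Q (x + u, y))
    (fun y => grad_y (Jglob Q) (x + u, y)) L nu (Pmax Q (x + u)) y eps L0 nu0 nuL
    (fun y => Jglob_le_Pmax (x + u, y)).
- by move=> w; have [_ _ /(_ (x + u, w)) + _] := PL.
- move=> w v.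
  exact: (smooth_lower_y L0 differentiable_Jglob smooth_x_Jglob smooth_y_Jglob (x + u, w) v).
- exact: eps0.
have := smooth_upper_x L0 differentiable_Jglob smooth_x_Jglob smooth_y_Jglob (x, y') u.
have := Jglob_le_Pmax (x, y'); rewrite /= => h1 h2.
have gap : 2 * dot (grad_x (Jglob Q) (x, y') - grad_x (Jglob Q) (x, y)) u
    <= a^-1 * (4 * kappa ^+ 2 * (2 * sqnorm (grad_y (Jglob Q) (x, y)) + 2 * (L ^+ 2 * sqnorm u)))
       + a * sqnorm u.
  apply: le_trans (dot_young _ _ a0) _; rewrite lerD2r ler_wpM2l ?invr_ge0 ?(ltW a0) //.
  apply: le_trans (smooth_x_Jglob _ _) _.
  rewrite /sqnorm2 /= subrr sqnorm0 add0r.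
  apply: (@le_trans _ _ (L ^+ 2 * (4 * sqnorm (grad_y (Jglob Q) (x + u, y)) / nu ^+ 2))).
    by rewrite ler_wpM2l ?sqr_ge0.
  have -> : L ^+ 2 * (4 * sqnorm (grad_y (Jglob Q) (x + u, y)) / nu ^+ 2)
     = 4 * kappa ^+ 2 * sqnorm (grad_y (Jglob Q) (x + u, y)).
    by rewrite /kappa exprMn exprVn; ring.
  apply: ler_wpM2l; first by rewrite mulr_ge0 ?sqr_ge0.
  have -> : grad_y (Jglob Q) (x + u, y) = grad_y (Jglob Q) (x, y)
      + (grad_y (Jglob Q) (x + u, y) - grad_y (Jglob Q) (x, y)) by rewrite [RHS]addrC subrK.
  apply: le_trans (sqnormD_le2 _ _) _; rewrite lerD2l ler_wpM2l //.
  apply: le_trans (smooth_y_Jglob _ _) _.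
  by rewrite /sqnorm2 /= subrr sqnorm0 addr0 addrC addKr.
move: gap; rewrite dotBl.
set G := grad_y _ _; set k2 := kappa ^+ 2.
have -> : a^-1 * (4 * k2 * (2 * sqnorm G + 2 * (L ^+ 2 * sqnorm u)))
   = 2 * (4 * k2 / a * (sqnorm G + L ^+ 2 * sqnorm u)) by ring.
have -> : (L + a / 2) * sqnorm u = L * sqnorm u + a * sqnorm u / 2 by ring.
move: hy' h1 h2; set J1 := Jglob Q (x + u, y'); set J2 := Jglob Q (x, y').
move: (Pmax Q _) (Pmax Q _) (dot _ _) (dot _ _) => p1 p2 q1 q2.
lra.
Qed.

(** Up to a constant this is [2 P - J]: to first order a step in [x] changes [P] and [J] alike, so a
    net decrease of weight one remains, while the growth of [J] along [y] pays for the drift of the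
    maximiser. *)
Definition merit (z : Z) : R := (Pmax Q z.1 - Pstar Q) + (Pmax Q z.1 - Jglob Q z).

Lemma merit_ge0 z : 0 <= merit z.
Proof. by rewrite addr_ge0 // subr_ge0 ?Pstar_le ?Jglob_le_Pmax. Qed.

Variables (etax etay : R).
(* Products such as [10 * (10 * x)] stand for [100 * x]: numerals unfold to unary naturals,
   and large ones make conversion slow. *)
Hypotheses (etax0 : 0 < etax) (etaxy : 32 * (32 * (kappa ^+ 2 * etax)) <= etay)
  (etayL : 10 * (10 * (L * etay)) <= 1).

Lemma kappa_ge1 : 1 <= kappa.
Proof. by rewrite ler_pdivlMr // mul1r. Qed.

Lemma etax_le : 32 * (32 * etax) <= etay.
Proof.
apply: le_trans etaxy; rewrite ler_wpM2l // ler_wpM2l // ler_peMl ?(ltW etax0) //.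
by rewrite expr_ge1 ?kappa_ge1 // (le_trans ler01) ?kappa_ge1.
Qed.

Lemma merit_descent x y (gx : 'cV[R]_d1) (gy : 'cV[R]_d2) :
  merit (x - etax *: gx, y + etay *: gy) <= merit (x, y)
    - etax / 2 * sqnorm (grad_x (Jglob Q) (x, y)) - etax / 4 * sqnorm gx
    - etay / 4 * sqnorm (grad_y (Jglob Q) (x, y)) - etay / 4 * sqnorm gy
    + etax / 2 * sqnorm (gx - grad_x (Jglob Q) (x, y))
    + etay / 2 * sqnorm (gy - grad_y (Jglob Q) (x, y)).
Proof.
(* With this parameter in [Pmax_step] the quadratic term is only [etax |gx|^2 / 32], at the price
   [64 kappa^2 etax |grad_y J|^2]. Twice that price is at most [etay / 8] times [|grad_y J|^2] by
   the ratio [32 * 32], within the [etay / 4] that can be spared. *)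
have a0 : 0 < (16 * etax)^-1 by rewrite invr_gt0 mulr_gt0.
have := Pmax_step x (- (etax *: gx)) y a0.
have := smooth_lower L0 differentiable_Jglob smooth_x_Jglob smooth_y_Jglob (x, y)
  (- (etax *: gx), etay *: gy).
rewrite /sqnorm2 /= !sqnormN !dotNr !dotZr !sqnormZ.
move: (grad_x (Jglob Q) (x, y)) (grad_y (Jglob Q) (x, y)) => Dx Dy.
rewrite -[(x, y) + _]/(x - etax *: gx, y + etay *: gy).
have := sqnormBC gx Dx; have := sqnormB gx Dx; have := sqnormB gy Dy.
rewrite (dotC gx) (dotC gy) /merit /=.
move: (dot Dx gx) (dot Dy gy) (Pmax Q (x - _)) (Pmax Q x) (Jglob Q (x - _, _)) (Jglob Q (x, y))
  (sqnorm (gx - Dx)) (sqnorm (gy - Dy)) => qx qy P1 P0 J1 J0 Ex Ey.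
have X0 := sqnorm_ge0 Dx; have Y0 := sqnorm_ge0 Dy.
have Gx0 := sqnorm_ge0 gx; have Gy0 := sqnorm_ge0 gy.
move: (sqnorm Dx) (sqnorm Dy) (sqnorm gx) (sqnorm gy) X0 Y0 Gx0 Gy0 => X Y Gx Gy X0 Y0 Gx0 Gy0.
move=> -> -> _ hJ.
have -> : (L + (16 * etax)^-1 / 2) * (etax ^+ 2 * Gx)
   = L * etax * (etax * Gx) + etax * Gx / 32 by field; rewrite gt_eqF.
have -> : 4 * kappa ^+ 2 / (16 * etax)^-1 * (Y + L ^+ 2 * (etax ^+ 2 * Gx))
   = 64 * (kappa ^+ 2 * etax * Y)
     + 64 * (kappa ^+ 2 * etax) * (L * etax) * (L * (etax * Gx)).
  by rewrite invrK; ring.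
move=> hP.
have etax0' := ltW etax0; have L0' := ltW L0.
have eyL := etayL; have exy := etaxy.
have etaxG : 0 <= etax * Gx by rewrite mulr_ge0.
have etay0 : 0 < etay by apply: lt_le_trans etax_le; rewrite !mulr_gt0.
have etay0' := ltW etay0.
have etayG : 0 <= etay * Gy by rewrite mulr_ge0.
have exL : 10 * (10 * (32 * (32 * (L * etax)))) <= 1.
  have h : L * (32 * (32 * etax)) <= L * etay by rewrite ler_wpM2l ?etax_le .
  lra.
have t1 : L * etax * (etax * Gx) <= 64^-1 * (etax * Gx) by rewrite ler_wpM2r //; lra.
have t2 : kappa ^+ 2 * etax * Y <= etay / 32 / 32 * Y by rewrite ler_wpM2r //; lra.
have k0 : 0 <= kappa ^+ 2 * etax by rewrite mulr_ge0 ?sqr_ge0.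
have t3 : 64 * (kappa ^+ 2 * etax) * (L * etax) * (L * (etax * Gx)) <= etax * Gx / 64.
  have -> : 64 * (kappa ^+ 2 * etax) * (L * etax) * (L * (etax * Gx))
    = (64 * (L * etax)) * (kappa ^+ 2 * etax * L) * (etax * Gx) by ring.
  rewrite [leRHS]mulrC ler_wpM2r // -[64^-1]mulr1.
  have h : kappa ^+ 2 * etax * L <= 1.
    have : 32 * (32 * (kappa ^+ 2 * etax)) * L <= etay * L by rewrite ler_wpM2r .
    lra.
  apply: ler_pM => //.
  - by rewrite mulr_ge0 ?mulr_ge0.
  - by rewrite mulr_ge0.
  - lra.
have t4 : L * etay * (etay * Gy) <= 32^-1 * (etay * Gy) by rewrite ler_wpM2r //; lra.
have -> : P1 - Pstar Q + (P1 - J1) = (P0 - Pstar Q + (P0 - J0)) + 2 * (P1 - P0) - (J1 - J0) by ring.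
have hJ' : J1 - J0 >= - (etax * qx) + etay * qy - 2 * (L * etax * (etax * Gx))
    - 2 * (L * etay * (etay * Gy)).
  have e : 2 * L * (etax ^+ 2 * Gx + etay ^+ 2 * Gy) = 2 * (L * etax * (etax * Gx))
    + 2 * (L * etay * (etay * Gy)) by ring.
  by move: hJ; rewrite e; lra.
have e1 : etax / 2 * (Gx - 2 * qx + X) = etax * Gx / 2 - etax * qx + etax * X / 2 by field.
have e2 : etay / 2 * (Gy - 2 * qy + Y) = etay * Gy / 2 - etay * qy + etay * Y / 2 by field.
have etaY : 0 <= etay * Y by rewrite mulr_ge0.
rewrite e1 e2; lra.
Qed.

End Objective.

(** * The Lyapunov function *)

(* The weight of the individual estimator errors in the Lyapunov function; the factor
   lam^2 it carries is the one of the sigma^2-term of the rate. *)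
Definition local_weight {R : realType} (L lam etay : R) : R :=
  6 * (14 * 14) * (L ^+ 2 * (etay ^+ 2 / (1 - lam) ^+ 3)) * lam ^+ 2.

Lemma local_weight_bound (R : realType) (L lam etay : R) : 0 <= lam < 1 ->
  (10 * (10 * (L * etay))) ^+ 2 <= (1 - lam) ^+ 3 ->
  0 <= local_weight L lam etay <= lam ^+ 2 / 4.
Proof.
move=> /andP[l0 l1] h; have w3 : 0 < (1 - lam) ^+ 3 by rewrite exprn_gt0 // subr_gt0.
have q0 : 0 <= L ^+ 2 * (etay ^+ 2 / (1 - lam) ^+ 3).
  by rewrite mulr_ge0 ?sqr_ge0 // divr_ge0 ?sqr_ge0 // ltW.
rewrite /local_weight; apply/andP; split.
  by rewrite mulr_ge0 ?sqr_ge0 // mulr_ge0.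
rewrite [leRHS]mulrC ler_wpM2r ?sqr_ge0 //.
have : 10 * (10 * (10 * (10 * (L ^+ 2 * (etay ^+ 2 / (1 - lam) ^+ 3))))) <= 1.
  have -> : 10 * (10 * (10 * (10 * (L ^+ 2 * (etay ^+ 2 / (1 - lam) ^+ 3)))))
    = (10 * (10 * (L * etay))) ^+ 2 / (1 - lam) ^+ 3 by ring.
  by rewrite ler_pdivrMr // mul1r.
move: (L ^+ 2 * _) => q; lra.
Qed.

(** [S], [I], [C], [V] stand for the averaged error, the individual errors, the disagreement and the
    energy, [D] for the sample increments, [m] for the movement of the agents; primes mark the next
    round. With [a] the local weight, [D] enters with total coefficient [2 + 2 a <= 5/2] and is at
    most [6 (L^2 m) + 6 beta], so [L^2 m] counts 15 times and each of [L^2 C], [L^2 C'] 45 times.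
    The gradient error adds [3 (L^2 C)], hence the weight 48. The energy then has to pay
    [48 + 45 = 93] times [L^2 C'], and half of [14 * 14] is 98. The weight [2 / p] releases [2 S]
    per round against [3/2 S] in the gradient error, and [beta] collects [15 + 3/2 <= 20]. *)
Lemma lyapunov_arith (R : realType)
  (L lam etax etay p b K M0 M1 X Y Gx Gy Ex Ey S S' I I' V V' C C' D m beta : R) :
  0 <= lam < 1 -> 0 < p <= 1 -> 0 < b -> 0 < K -> 1 <= p * b * K -> 1 <= b ->
  0 < L -> 0 < etax -> etax <= etay -> 10 * (10 * (L * etay)) <= 1 ->
  (10 * (10 * (L * etay))) ^+ 2 <= (1 - lam) ^+ 3 ->
  0 <= Gx -> 0 <= Gy -> 0 <= Ex -> 0 <= S -> 0 <= I -> 0 <= V -> 0 <= C -> 0 <= C' ->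
  0 <= D -> 0 <= beta ->
  M1 <= M0 - etax / 2 * X - etax / 4 * Gx - etay / 4 * Y - etay / 4 * Gy
     + etax / 2 * Ex + etay / 2 * Ey ->
  Ex + Ey <= 3 * S + 3 * beta + 6 * (L ^+ 2 * C) ->
  S' <= (1 - p) * (S + (K * b)^-1 * D) ->
  I' <= (1 - p) * (I + b^-1 * D) ->
  V' <= (1 + lam) / 2 * V + 3 / (1 - lam) * (etay ^+ 2 * lam ^+ 2) * (2 * p * I + 2 * D) ->
  C' <= V / (1 - lam) ->
  D <= 6 * (L ^+ 2 * m) + 6 * beta ->
  m <= 3 * C' + 3 * C + 3 * (etax ^+ 2 * Gx + etay ^+ 2 * Gy) ->
  M1 + etay * (2 / p * S' + 48 * (L ^+ 2 * C') + 14 * 14 * (L ^+ 2 / (1 - lam) ^+ 2 * V')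
      + local_weight L lam etay * I')
  <= M0 + etay * (2 / p * S + 48 * (L ^+ 2 * C) + 14 * 14 * (L ^+ 2 / (1 - lam) ^+ 2 * V)
      + local_weight L lam etay * I)
     - etax / 2 * X - etay / 4 * Y + 20 * (etay * beta).
Proof.
move=> lam01 /andP[p0 p1] b0 K0 pbK b1 L0 etax0 etaxy etayL etay3 Gx0 Gy0 Ex0 S0 I0 V0 C0 C'0 D0
  beta0 hM hE hS hI hV hC hD hm.
have /andP[l0 l1] := lam01.
have w0 : 0 < 1 - lam by rewrite subr_gt0.
have ey0 : 0 < etay by exact: lt_le_trans etaxy.
have ex0' := ltW etax0; have ey0' := ltW ey0; have L0' := ltW L0.
have p0' := ltW p0; have b0' := ltW b0; have K0' := ltW K0; have w0' := ltW w0.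
have L2 : 0 <= L ^+ 2 by exact: sqr_ge0.
have /andP[a0 a1] := local_weight_bound lam01 etay3.
set a := local_weight L lam etay in a0 a1 *.
have a4 : a <= 4^-1.
  apply: le_trans a1 _; rewrite -[leRHS]mul1r ler_wpM2r // expr_le1 //; exact: ltW.
have T1 : 2 / p * S' <= 2 / p * S - 2 * S + 2 * D.
  have h : S' <= S - p * S + (K * b)^-1 * D.
    apply: le_trans hS _.
    have : 0 <= p * ((K * b)^-1 * D).
      by rewrite mulr_ge0 ?mulr_ge0 ?invr_ge0 ?mulr_ge0.
    by move: ((K * b)^-1 * D) => z; lra.
  have p2 : 0 <= 2 / p by rewrite divr_ge0.
  apply: le_trans (ler_wpM2l p2 h) _.
  have -> : 2 / p * (S - p * S + (K * b)^-1 * D)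
     = 2 / p * S - 2 * S + 2 * ((p * b * K)^-1 * D) by field; rewrite !gt_eqF.
  rewrite lerD2l ler_wpM2l // ler_piMl // invf_le1 // (lt_le_trans ltr01) //.
have T2 : I' <= I - p * I + D.
  apply: le_trans hI _.
  have ib : b^-1 * D <= D by rewrite ler_piMl // invf_le1.
  have : 0 <= p * (b^-1 * D) by rewrite !mulr_ge0 ?invr_ge0.
  by move: ib; move: (b^-1 * D) => z; lra.
have pI : 0 <= p * I by rewrite mulr_ge0.
(* [local_weight] is exactly the coefficient of [p * I + D] in the forcing of the weighted energy;
   its part [a * (p * I)] cancels against the decay of [I] in [T2]. *)
have T3 : 14 * 14 * (L ^+ 2 / (1 - lam) ^+ 2 * V')
   <= 14 * 14 * (L ^+ 2 / (1 - lam) ^+ 2 * V) - 14 * 7 * (L ^+ 2 * (V / (1 - lam)))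
      + a * (p * I + D).
  have c0 : 0 <= L ^+ 2 / (1 - lam) ^+ 2 by rewrite divr_ge0 // sqr_ge0.
  have -> : a * (p * I + D) = 14 * 14 * (L ^+ 2 / (1 - lam) ^+ 2
      * (3 / (1 - lam) * (etay ^+ 2 * lam ^+ 2) * (2 * p * I + 2 * D))).
    by rewrite /a /local_weight; field; rewrite gt_eqF.
  have -> : 14 * 14 * (L ^+ 2 / (1 - lam) ^+ 2 * V) - 14 * 7 * (L ^+ 2 * (V / (1 - lam)))
    = 14 * 14 * (L ^+ 2 / (1 - lam) ^+ 2 * ((1 + lam) / 2 * V)).
    by field; rewrite gt_eqF.
  by rewrite -mulrDr -mulrDr ler_wpM2l // ler_wpM2l.
have T4 := ler_wpM2l a0 T2.
have T5 : a * D <= 4^-1 * D by rewrite ler_wpM2r.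
have T6 : L ^+ 2 * C' <= L ^+ 2 * (V / (1 - lam)) by rewrite ler_wpM2l.
have T7 := ler_wpM2l L2 hm.
have LC : 0 <= L ^+ 2 * C' by rewrite mulr_ge0.
have gxb : L ^+ 2 * (etax ^+ 2 * Gx) * etay <= etax * Gx / 64 / 64.
  have -> : L ^+ 2 * (etax ^+ 2 * Gx) * etay = (L * etax) * (L * etay) * (etax * Gx) by ring.
  have ee : L * etax <= L * etay by rewrite ler_wpM2l.
  have : (L * etax) * (L * etay) <= 64^-1 * 64^-1 by apply: ler_pM; rewrite ?mulr_ge0 //; lra.
  move=> h; have := ler_wpM2r (_ : 0 <= etax * Gx) h; rewrite mulr_ge0 // => /(_ isT).
  by lra.
have gyb : L ^+ 2 * (etay ^+ 2 * Gy) * etay <= etay * Gy / 64 / 64.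
  have -> : L ^+ 2 * (etay ^+ 2 * Gy) * etay = (L * etay) * (L * etay) * (etay * Gy) by ring.
  have : (L * etay) * (L * etay) <= 64^-1 * 64^-1 by apply: ler_pM; rewrite ?mulr_ge0 //; lra.
  move=> h; have := ler_wpM2r (_ : 0 <= etay * Gy) h; rewrite mulr_ge0 // => /(_ isT).
  by lra.
have ExE : etax / 2 * Ex + etay / 2 * Ey <= etay / 2 * (3 * S + 3 * beta + 6 * (L ^+ 2 * C)).
  apply: (@le_trans _ _ (etay / 2 * (Ex + Ey))); last by rewrite ler_wpM2l // divr_ge0.
  by rewrite mulrDr lerD2r ler_wpM2r // ler_wpM2r.
have core : 2 / p * S' + 48 * (L ^+ 2 * C') + 14 * 14 * (L ^+ 2 / (1 - lam) ^+ 2 * V') + a * I'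
    + 3 / 2 * S + 3 / 2 * beta + 3 * (L ^+ 2 * C)
  <= 2 / p * S + 48 * (L ^+ 2 * C) + 14 * 14 * (L ^+ 2 / (1 - lam) ^+ 2 * V) + a * I
    + 20 * beta + 45 * (L ^+ 2 * (etax ^+ 2 * Gx + etay ^+ 2 * Gy)).
  move: T1 T3 T4 T5 T6 T7 LC.
  have -> : a * (p * I + D) = a * (p * I) + a * D by ring.
  have -> : a * (I - p * I + D) = a * I - a * (p * I) + a * D by ring.
  have -> : L ^+ 2 * (3 * C' + 3 * C + 3 * (etax ^+ 2 * Gx + etay ^+ 2 * Gy))
    = 3 * (L ^+ 2 * C') + 3 * (L ^+ 2 * C) + 3 * (L ^+ 2 * (etax ^+ 2 * Gx + etay ^+ 2 * Gy)).
    by ring.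
  move: (L ^+ 2 * (etax ^+ 2 * Gx + etay ^+ 2 * Gy)) => g.
  move: (2 / p * S') (2 / p * S) (L ^+ 2 / (1 - lam) ^+ 2 * V') (L ^+ 2 / (1 - lam) ^+ 2 * V)
    (L ^+ 2 * C') (L ^+ 2 * C) (L ^+ 2 * (V / (1 - lam))) (a * I') (a * I) (a * D) (a * (p * I)).
  move=> *; lra.
have {core} := ler_wpM2l ey0' core.
have exG : 0 <= etax * Gx by rewrite mulr_ge0.
have eyG : 0 <= etay * Gy by rewrite mulr_ge0.
set A1 := 2 / p * S' + _ + _ + _; set A0 := 2 / p * S + _ + _ + _.
have -> : etay * (A1 + 3 / 2 * S + 3 / 2 * beta + 3 * (L ^+ 2 * C))
   = etay * A1 + etay / 2 * (3 * S + 3 * beta + 6 * (L ^+ 2 * C)) by field.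
have -> : etay * (A0 + 20 * beta + 45 * (L ^+ 2 * (etax ^+ 2 * Gx + etay ^+ 2 * Gy)))
   = etay * A0 + 20 * (etay * beta) + 45 * (L ^+ 2 * (etax ^+ 2 * Gx) * etay
       + L ^+ 2 * (etay ^+ 2 * Gy) * etay) by ring.
move: gxb gyb ExE hM; move: (etay * A1) (etay * A0) (L ^+ 2 * (etax ^+ 2 * Gx) * etay)
  (L ^+ 2 * (etay ^+ 2 * Gy) * etay).
move=> *; lra.
Qed.

Lemma trmx_mix (R : realType) (K d : nat) (W : 'M[R]_K) : W^T = W ->
  (W *t (1%:M : 'M[R]_d))^T = W *t 1%:M.
Proof. by move=> WT; rewrite trmx_tens trmx1 WT. Qed.

(** * Centroid motion and gradient error over the network *)

Section MixingBlock.
Context {R : realType} {K d : nat}.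
Variables (W : 'M[R]_K) (B : 'M[R]_(K * d)).
Let A : 'M[R]_(K * d) := W *t 1%:M.
Hypotheses (K0 : (0 < K)%N) (WT : W^T = W) (Wr : forall k, \sum_l W k l = 1)
  (BT : B^T = B) (BB : B *m B = 1%:M - A).
Implicit Types X G D : 'cV[R]_(K * d).

Lemma mean_agentD X G : mean (agent (X + G)) = mean (agent X) + mean (agent G).
Proof. by rewrite -meanD; apply: eq_mean => k; exact: agentD. Qed.

Lemma mean_agentN X : mean (agent (- X)) = - mean (agent X).
Proof. by rewrite -meanN; apply: eq_mean => k; exact: agentN. Qed.

Lemma mean_agentZ a X : mean (agent (a *: X)) = a *: mean (agent X).
Proof. by rewrite -meanZ; apply: eq_mean => k; exact: agentZ. Qed.

(** On consensual vectors [|B v|^2 = v^T (1 - A) v = 0], so [B] kills them; being symmetric, it has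
    its range orthogonal to them. Hence the dual variable never moves the centroid. *)
Lemma mean_agent_sqrt D : mean (agent (B *m D)) = 0.
Proof.
have AE : A *m averaging R K d = averaging R K d.
  rewrite /A /averaging tensmx_mul mulmx1; congr (_ *t _).
  apply/matrixP => k l; rewrite !mxE.
  by under eq_bigr do rewrite mxE; rewrite -mulr_suml Wr mul1r.
have ET : (averaging R K d)^T = averaging R K d by rewrite trmx_tens trmx1 trmx_const.
have BE (v : 'cV[R]_(K * d)) : B *m (averaging R K d *m v) = 0.
  apply: sqnorm_eq0; rewrite sqnorm_mulmx trmx_mul BT -mulmxA (mulmxA B) BB.
  by rewrite mulmxBl mul1mx (mulmxA A) AE subrr mulmx0 mxE.
have E0 : averaging R K d *m (B *m D) = 0.
  apply: sqnorm_eq0; rewrite sqnorm_mulmx {1}trmx_mul ET trmx_mul BT -!mulmxA.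
  by rewrite BE mulmx0 mxE.
have : agent (averaging R K d *m (B *m D)) (Ordinal K0) = 0.
  by rewrite E0; apply/colP => j; rewrite !mxE.
by rewrite agent_averaging.
Qed.

Lemma mean_next_iterate eta X G D :
  mean (agent (next_iterate A B eta X G D)) = mean (agent X) - eta *: mean (agent G).
Proof.
have Wc l : \sum_k W k l = 1.
  by rewrite -(Wr l); apply: eq_bigr => k _; rewrite -[in LHS]WT mxE.
rewrite /next_iterate /increment mean_agentD mean_agentN mean_agentD mean_agentZ.
by rewrite !mean_agent_mix // mean_agent_sqrt addr0.
Qed.

Lemma movement_bound X X' :
  mean (fun k => sqnorm (agent X' k - agent X k) : R^o)
  <= 3 * (K%:R^-1 * sqnorm (X' - averaging R K d *m X'))
   + 3 * sqnorm (mean (agent X') - mean (agent X))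
   + 3 * (K%:R^-1 * sqnorm (X - averaging R K d *m X)).
Proof.
rewrite !sqnorm_consensus.
rewrite -[3 * sqnorm _](mean_cst K0 (_ : R^o)).
rewrite -[K%:R^-1 * \sum_k sqnorm (agent X' k - _)]/(mean (fun k => sqnorm (agent X' k - _) : R^o)).
rewrite -[K%:R^-1 * \sum_k sqnorm (agent X k - _)]/(mean (fun k => sqnorm (agent X k - _) : R^o)).
rewrite -!meanMl -!meanD; apply: le_mean => k.
have -> : agent X' k - agent X k = (agent X' k - mean (agent X'))
    + (mean (agent X') - mean (agent X)) + (mean (agent X) - agent X k).
  by rewrite !addrA !subrK.
by apply: le_trans (sqnormD_le3 _ _ _) _; rewrite [sqnorm (mean _ - agent X k)]sqnormBC.
Qed.

End MixingBlock.

Section GradientBlock.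
Context {R : realType} {K N d1 d2 d : nat}.
Local Notation Z := ('cV[R]_d1 * 'cV[R]_d2)%type.
Hypotheses (K0 : (0 < K)%N) (N0 : (0 < N)%N).
Variables (gr dg : 'I_K -> Z -> 'I_N -> 'cV[R]_d) (L beta : R).
Hypotheses
  (bias : forall k z, mean (fun s => sqnorm (gr k z s - dg k z s) : R^o) <= beta)
  (lip : forall k z z', mean (fun s => sqnorm (dg k z s - dg k z' s) : R^o)
     <= L ^+ 2 * sqnorm2 (z - z')).

Lemma sample_increment_bound (z zn : 'I_K -> Z) :
  sample_increment gr z zn
  <= 3 * (L ^+ 2 * mean (fun k => sqnorm2 (zn k - z k) : R^o)) + 6 * beta.
Proof.
rewrite -[6 * beta](mean_cst K0 (_ : R^o)) -!meanMl -meanD; apply: le_mean => k.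
exact: (estimator_lipschitz (bias k) (lip k _ _)).
Qed.

(** Three sources of error, one for each summand: the estimation error, the finite-difference bias,
    and evaluation at the agents' points instead of at [zc]. *)
Lemma mean_gradient_error (z : 'I_K -> Z) (zc : Z) (g : 'I_K -> 'cV[R]_d) :
  sqnorm (mean g - mean (fun k => mean (dg k zc)))
  <= 3 * sqnorm (mean (estimation_error gr z g)) + 3 * beta
    + 3 * (L ^+ 2 * mean (fun k => sqnorm2 (z k - zc) : R^o)).
Proof.
have -> : mean g - mean (fun k => mean (dg k zc))
  = mean (estimation_error gr z g) + mean (fun k => mean (gr k (z k)) - mean (dg k (z k)))
    + mean (fun k => mean (dg k (z k)) - mean (dg k zc)).
  by rewrite !meanB !addrA !subrK.
apply: le_trans (sqnormD_le3 _ _ _) _; apply: lerD; first apply: lerD => //.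
  rewrite ler_wpM2l //; apply: le_trans (sqnorm_mean K0 _) _.
  rewrite -[leRHS](mean_cst K0 (_ : R^o)); apply: le_mean => k.
  exact: (estimator_bias N0 (bias k)).
rewrite ler_wpM2l //; apply: le_trans (sqnorm_mean K0 _) _.
rewrite -meanMl; apply: le_mean => k.
by rewrite -meanB; apply: le_trans (sqnorm_mean N0 _) (lip _ _ _).
Qed.

End GradientBlock.

(** * Finite noise histories *)

Definition noise_of {K N b : nat} (f : {ffun 'I_K * 'I_b -> 'I_N}) (h : nat -> round K N b) :
    noise K N b N b :=
  {| coin := fun i => (h i).1.1;
     large := fun k i => (h i).1.2 k;
     small := fun k i j => (h i).2 (k, j);
     first := fun k j => f (k, j) |}.

(** A round depends on the noise of that round alone, so indexing the step by a single [round] turns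
    a run into a fold over its history. *)
Definition round_step {R : realType} {K N b d1 d2 : nat} (Q : loss R K N d1 d2)
    (prm : params R K d1 d2) (r : round K N b) (st : state R K d1 d2) : state R K d1 d2 :=
  zoma_step Q prm (noise_of r.2 (fun=> r)) 0 st.

(** The most recent round stands at the head: [foldr] then replays the rounds in chronological
    order, and averaging over the head is averaging over the last round. *)
Fixpoint histories (K N b i : nat) : seq (seq (round K N b)) :=
  if i is i'.+1 then [seq r :: h | h <- histories K N b i', r <- enum (round K N b)]
  else [:: [::]].

Definition history_mean {R : realType} {K N b : nat} (p : R) (i : nat)
    (F : seq (round K N b) -> R) : R :=
  \sum_(h <- histories K N b i) (\prod_(r <- h) round_weight p r) * F h.

Section HistoryMean.
Context {R : realType} {K N b : nat} (p : R).
Hypotheses (N0 : (0 < N)%N) (p01 : 0 <= p <= 1).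
Implicit Types F G : seq (round K N b) -> R.

Lemma history_mean0 F : history_mean p 0 F = F [::].
Proof. by rewrite /history_mean /= big_seq1 big_nil mul1r. Qed.

Lemma history_meanS i F :
  history_mean p i.+1 F = history_mean p i (fun h => round_mean p (fun r => F (r :: h))).
Proof.
rewrite /history_mean /= big_allpairs_dep /=; apply: eq_bigr => h _.
rewrite /round_mean mulr_sumr big_enum /=; apply: eq_bigr => r _.
by rewrite big_cons mulrCA mulrA.
Qed.

Lemma history_meanD i F G :
  history_mean p i (fun h => F h + G h) = history_mean p i F + history_mean p i G.
Proof. by rewrite /history_mean -big_split; apply: eq_bigr => h _; rewrite mulrDr. Qed.

Lemma history_meanZ i a F : history_mean p i (fun h => a * F h) = a * history_mean p i F.
Proof. by rewrite /history_mean mulr_sumr; apply: eq_bigr => h _; rewrite mulrCA. Qed.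

Lemma history_weight_ge0 (h : seq (round K N b)) : 0 <= \prod_(r <- h) round_weight p r.
Proof. by apply: prodr_ge0 => r _; exact: round_weight_ge0. Qed.

Lemma le_history_mean i F G : (forall h, F h <= G h) -> history_mean p i F <= history_mean p i G.
Proof. by move=> le; apply: ler_sum => h _; rewrite ler_wpM2l // history_weight_ge0. Qed.

Lemma history_mean_cst i (a : R) : history_mean p i (fun _ : seq (round K N b) => a) = a.
Proof.
elim: i => [|i IH]; first exact: history_mean0.
rewrite history_meanS -[RHS]IH /history_mean; apply: eq_bigr => h _.
by rewrite round_mean_cst.
Qed.

(** The one-round inequality holds from every state, so no conditional expectation is needed: the
    earlier history is fixed and only its newest round is averaged. The final value of [phi] is
    discarded by its sign. *)
Lemma telescope_history (S : Type) (step : round K N b -> S -> S) (s0 : S)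
    (phi psi : S -> R) (c : R) (T : nat) :
  (forall s, 0 <= phi s) ->
  (forall s, round_mean p (fun r => phi (step r s)) <= phi s - psi s + c) ->
  \sum_(i < T) history_mean p i (fun h => psi (foldr step s0 h)) <= phi s0 + T%:R * c.
Proof.
move=> phi0 hstep.
suff : history_mean p T (fun h => phi (foldr step s0 h))
    + \sum_(i < T) history_mean p i (fun h => psi (foldr step s0 h)) <= phi s0 + T%:R * c.
  apply: le_trans; rewrite lerDr -[leLHS](history_mean_cst T); exact: le_history_mean.
elim: T => [|T IH]; first by rewrite big_ord0 mul0r !addr0 history_mean0.
rewrite big_ord_recr /= history_meanS -natr1 mulrDl mul1r.
have : history_mean p T (fun h => round_mean p (fun r => phi (foldr step s0 (r :: h))))
   <= history_mean p T (fun h => phi (foldr step s0 h))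
      + ((-1) * history_mean p T (fun h => psi (foldr step s0 h)) + c).
  rewrite -history_meanZ -[X in _ + (_ + X)](history_mean_cst T) -!history_meanD.
  by apply: le_history_mean => h; apply: le_trans (hstep _) _; rewrite mulN1r addrA.
move: IH; move: (\sum_(i < T) _) (T%:R * c) (phi s0) => a d e; lra.
Qed.

End HistoryMean.

(** * Decrease of the Lyapunov function in one round *)

Section LyapunovStep.
Context {R : realType} {K N b d1 d2 : nat}.
Local Notation Z := ('cV[R]_d1 * 'cV[R]_d2)%type.
Variables (Q : loss R K N d1 d2) (L nu lam p etax etay dx dy : R)
  (W : 'M[R]_K) (Bx : 'M[R]_(K * d1)) (By : 'M[R]_(K * d2))
  (Ux : 'M[R]_(K * d1, K.-1 * d1)) (Uy : 'M[R]_(K * d2, K.-1 * d2))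
  (ax : 'rV[R]_(K.-1 * d1)) (ay : 'rV[R]_(K.-1 * d2)).
Let Wx : 'M[R]_(K * d1) := W *t 1%:M.
Let Wy : 'M[R]_(K * d2) := W *t 1%:M.
Let kappa := L / nu.
Hypotheses (K0 : (0 < K)%N) (N0 : (0 < N)%N) (b0 : (0 < b)%N).
Hypotheses (L0 : 0 < L) (PL : PL_condition Q nu) (sQ : expected_smoothness Q L)
  (nuL : nu <= L).
Hypotheses (WT : W^T = W) (Wr : forall k, \sum_l W k l = 1)
  (BxT : Bx^T = Bx) (BxB : Bx *m Bx = 1%:M - Wx)
  (ByT : By^T = By) (ByB : By *m By = 1%:M - Wy).
Hypotheses
  (UxU : Ux^T *m Ux = 1%:M)
  (cUx : ((const_mx 1 : 'cV[R]_K) *t (1%:M : 'M[R]_d1))^T *m Ux = 0)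
  (WUx : Wx *m Ux = Ux *m diag_mx ax) (hax : forall j, 0 <= ax 0 j <= lam)
  (UyU : Uy^T *m Uy = 1%:M)
  (cUy : ((const_mx 1 : 'cV[R]_K) *t (1%:M : 'M[R]_d2))^T *m Uy = 0)
  (WUy : Wy *m Uy = Uy *m diag_mx ay) (hay : forall j, 0 <= ay 0 j <= lam).
Hypotheses (lam01 : 0 <= lam < 1) (p01 : 0 < p <= 1) (pbK : 1 <= p * b%:R * K%:R)
  (dx0 : 0 < dx) (dy0 : 0 < dy) (etax0 : 0 < etax)
  (etaxy : 32 * (32 * (kappa ^+ 2 * etax)) <= etay)
  (etayL : 10 * (10 * (L * etay)) <= 1)
  (etay3 : (10 * (10 * (L * etay))) ^+ 2 <= (1 - lam) ^+ 3).

Let prm : params R K d1 d2 := {|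
  par_p := p; par_beta := 0; eta_x := etax; eta_y := etay; delta_x := dx; delta_y := dy;
  mat_Ax := Wx; mat_Bx := Bx; mat_Cx := 1%:M;
  mat_Ay := Wy; mat_By := By; mat_Cy := 1%:M |}.

Let bx : R := d1%:R * (L ^+ 2 * dx ^+ 2).
Let by_ : R := d2%:R * (L ^+ 2 * dy ^+ 2).
Let grx k (z : Z) s := cw_x dx (Q k s) z.
Let gry k (z : Z) s := cw_y dy (Q k s) z.
Let dgx k (z : Z) s := grad_x (Q k s) z.
Let dgy k (z : Z) s := grad_y (Q k s) z.

Let dQ k s z : differentiable (Q k s) z.
Proof. by have [/(_ k s)[]] := sQ. Qed.

Lemma x_bias k z : mean (fun s => sqnorm (grx k z s - dgx k z s) : R^o) <= bx.
Proof. by have [_ Qx _] := sQ; exact: (cw_x_bias N0 (dQ k) (Qx k) _ dx0). Qed.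

Lemma y_bias k z : mean (fun s => sqnorm (gry k z s - dgy k z s) : R^o) <= by_.
Proof. by have [_ _ Qy] := sQ; exact: (cw_y_bias N0 (dQ k) (Qy k) _ dy0). Qed.

Let x_lip k z z' : mean (fun s => sqnorm (dgx k z s - dgx k z' s) : R^o)
  <= L ^+ 2 * sqnorm2 (z - z').
Proof. by have [_ Qx _] := sQ; exact: Qx. Qed.

Let y_lip k z z' : mean (fun s => sqnorm (dgy k z s - dgy k z' s) : R^o)
  <= L ^+ 2 * sqnorm2 (z - z').
Proof. by have [_ _ Qy] := sQ; exact: Qy. Qed.

Implicit Type st : state R K d1 d2.

Definition points st k : Z := agent_z (st_x st) (st_y st) k.
Definition x_error st k := estimation_error grx (points st) (agent (st_gx st)) k.
Definition y_error st k := estimation_error gry (points st) (agent (st_gy st)) k.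
Definition mean_error st : R := sqnorm (mean (x_error st)) + sqnorm (mean (y_error st)).
Definition local_error st : R :=
  mean (fun k => sqnorm (x_error st k) : R^o) + mean (fun k => sqnorm (y_error st k) : R^o).
Definition x_disagreement st : R :=
  K%:R^-1 * sqnorm (st_x st - averaging R K d1 *m st_x st).
Definition y_disagreement st : R :=
  K%:R^-1 * sqnorm (st_y st - averaging R K d2 *m st_y st).
Definition disagreement st : R := x_disagreement st + y_disagreement st.
Definition x_energy st : R := energy Wx Bx Ux ax etax (st_x st) (st_gx st) (st_dx st).
(** Ascent in [y] is descent with step [- etay], so one analysis of exact diffusion covers both
    blocks. *)
Definition y_energy st : R := energy Wy By Uy ay (- etay) (st_y st) (st_gy st) (st_dy st).
Definition network_energy st : R := x_energy st + y_energy st.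

Definition lyapunov st : R :=
  merit Q (centroid st) + etay * (2 / p * mean_error st + 48 * (L ^+ 2 * disagreement st)
    + 14 * 14 * (L ^+ 2 / (1 - lam) ^+ 2 * network_energy st)
    + local_weight L lam etay * local_error st).

Lemma disagreement_points st :
  mean (fun k => sqnorm2 (points st k - centroid st) : R^o) = disagreement st.
Proof.
rewrite /disagreement /x_disagreement /y_disagreement !sqnorm_consensus.
rewrite -[K%:R^-1 * \sum_k sqnorm (agent (st_x st) k - _)]/(mean (fun k => sqnorm (_ - _) : R^o)).
rewrite -[K%:R^-1 * \sum_k sqnorm (agent (st_y st) k - _)]/(mean (fun k => sqnorm (_ - _) : R^o)).
by rewrite -meanD.
Qed.

Section OneState.
Variable st : state R K d1 d2.

Let X' := next_iterate Wx Bx etax (st_x st) (st_gx st) (st_dx st).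
Let Y' := next_iterate Wy By (- etay) (st_y st) (st_gy st) (st_dy st).
Let nxt (r : round K N b) := round_step Q prm r st.
Let zs' k : Z := agent_z X' Y' k.

Let nxt_x r : st_x (nxt r) = X'.
Proof.
rewrite /X' /next_iterate /increment /= mul1mx mulmxBr -scalemxAr opprD.
by rewrite addrA.
Qed.

Let nxt_y r : st_y (nxt r) = Y'.
Proof.
rewrite /Y' /next_iterate /increment /= mul1mx mulmxDr -scalemxAr opprD scaleNr opprK.
by rewrite addrA.
Qed.

Let nxt_dx r : st_dx (nxt r) = st_dx st + Bx *m X'.
Proof. by rewrite -(nxt_x r). Qed.

Let nxt_dy r : st_dy (nxt r) = st_dy st + By *m Y'.
Proof. by rewrite -(nxt_y r). Qed.

Let nxt_points r k : points (nxt r) k = zs' k.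
Proof. by rewrite /points nxt_x nxt_y. Qed.

Let nxt_gx r k : agent (st_gx (nxt r)) k
  = next_gradients grx (points st) zs' (agent (st_gx st)) r k.
Proof.
rewrite -[st_gx _]/(stack _) agent_stack /next_gradients.
by rewrite -[zs' k](nxt_points r).
Qed.

Let nxt_gy r k : agent (st_gy (nxt r)) k
  = next_gradients gry (points st) zs' (agent (st_gy st)) r k.
Proof.
rewrite -[st_gy _]/(stack _) agent_stack /next_gradients.
by rewrite -[zs' k](nxt_points r).
Qed.

Let p01' : 0 <= p <= 1. Proof. by case/andP: p01 => /ltW -> ->. Qed.

Let Dx := sample_increment grx (points st) zs'.
Let Dy := sample_increment gry (points st) zs'.

Let centroid_nxt r : centroid (nxt r)
  = ((centroid st).1 - etax *: mean (agent (st_gx st)),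
     (centroid st).2 + etay *: mean (agent (st_gy st))).
Proof.
rewrite /centroid nxt_x nxt_y /X' /Y' /=.
rewrite (mean_next_iterate K0 WT Wr BxT BxB) (mean_next_iterate K0 WT Wr ByT ByB).
by rewrite scaleNr opprK.
Qed.

Let mean_error_nxt : round_mean p (fun r => mean_error (nxt r))
  <= (1 - p) * (mean_error st + (K%:R * b%:R)^-1 * (Dx + Dy)).
Proof.
rewrite round_meanD.
have e (r : round K N b) : sqnorm (mean (x_error (nxt r)))
    = sqnorm (mean (estimation_error grx zs' (next_gradients grx (points st) zs' (agent (st_gx st)) r))).
  apply: (congr1 sqnorm); apply: eq_mean => k.
  by rewrite /x_error /estimation_error nxt_gx nxt_points.
have e' (r : round K N b) : sqnorm (mean (y_error (nxt r)))
    = sqnorm (mean (estimation_error gry zs' (next_gradients gry (points st) zs' (agent (st_gy st)) r))).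
  apply: (congr1 sqnorm); apply: eq_mean => k.
  by rewrite /y_error /estimation_error nxt_gy nxt_points.
have hx := estimator_mean_error K0 N0 b0 p01' grx (points st) zs' (agent (st_gx st)).
have hy := estimator_mean_error K0 N0 b0 p01' gry (points st) zs' (agent (st_gy st)).
rewrite /round_mean (eq_bigr _ (fun r _ => congr1 _ (e r))).
rewrite (eq_bigr _ (fun r _ => congr1 _ (e' r))).
apply: le_trans (lerD hx hy) _; rewrite le_eqVlt; apply/orP; left; apply/eqP.
rewrite /mean_error /local_error -/Dx -/Dy; ring.
Qed.

Let local_error_nxt : round_mean p (fun r => local_error (nxt r))
  <= (1 - p) * (local_error st + b%:R^-1 * (Dx + Dy)).
Proof.
rewrite round_meanD.
have e (r : round K N b) : mean (fun k => sqnorm (x_error (nxt r) k) : R^o)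
    = mean (fun k => sqnorm (estimation_error grx zs'
        (next_gradients grx (points st) zs' (agent (st_gx st)) r) k) : R^o).
  by apply: eq_mean => k; rewrite /x_error /estimation_error nxt_gx nxt_points.
have e' (r : round K N b) : mean (fun k => sqnorm (y_error (nxt r) k) : R^o)
    = mean (fun k => sqnorm (estimation_error gry zs'
        (next_gradients gry (points st) zs' (agent (st_gy st)) r) k) : R^o).
  by apply: eq_mean => k; rewrite /y_error /estimation_error nxt_gy nxt_points.
have hx := estimator_error K0 N0 b0 p01' grx (points st) zs' (agent (st_gx st)).
have hy := estimator_error K0 N0 b0 p01' gry (points st) zs' (agent (st_gy st)).
rewrite /round_mean (eq_bigr _ (fun r _ => congr1 _ (e r))).
rewrite (eq_bigr _ (fun r _ => congr1 _ (e' r))).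
apply: le_trans (lerD hx hy) _; rewrite le_eqVlt; apply/orP; left; apply/eqP.
rewrite /mean_error /local_error -/Dx -/Dy; ring.
Qed.

Let lam1 : lam < 1. Proof. by case/andP: lam01. Qed.
Let lamw : 0 < 1 - lam. Proof. by rewrite subr_gt0. Qed.
Let etay0 : 0 < etay.
Proof. by apply: lt_le_trans (etax_le PL nuL etax0 etaxy); rewrite !mulr_gt0. Qed.
Let etax_etay : etax <= etay.
Proof.
apply: le_trans (etax_le PL nuL etax0 etaxy).
by rewrite mulrA ler_peMl ?(ltW etax0) // -natrM ler1n.
Qed.

Let x_energy_nxt : round_mean p (fun r => x_energy (nxt r))
  <= (1 + lam) / 2 * x_energy st + 3 / (1 - lam) * (etay ^+ 2 * lam ^+ 2)
     * (2 * p * mean (fun k => sqnorm (x_error st k) : R^o) + 2 * Dx).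
Proof.
have hi := estimator_increment N0 b0 p01' grx (points st) zs' (agent (st_gx st)).
have c0 : 0 <= 3 / (1 - lam) * (etay ^+ 2 * lam ^+ 2).
  apply: mulr_ge0; first by rewrite divr_ge0 // (ltW lamw).
  by rewrite mulr_ge0 ?sqr_ge0.
apply: le_trans _ (_ : (1 + lam) / 2 * x_energy st + 3 / (1 - lam) * (etay ^+ 2 * lam ^+ 2)
    * round_mean p (fun r : round K N b => mean (fun k => sqnorm
      (next_gradients grx (points st) zs' (agent (st_gx st)) r k - agent (st_gx st) k) : R^o)) <= _).
  rewrite -round_meanZ -[(1 + lam) / 2 * _](@round_mean_cst R K N b p N0) -round_meanD.
  apply: (le_round_mean p01') => r; rewrite /x_energy nxt_x nxt_dx.
  apply: le_trans (energy_step K0 UxU cUx (trmx_mix _ WT) WUx BxB hax lam1 _ _ _ _ _) _.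
  rewrite lerD2l sqnorm_agents -[K%:R^-1 * \sum_k _]/(mean (fun k => sqnorm (agent _ k) : R^o)).
  rewrite (eq_mean (G := fun k => sqnorm (next_gradients grx (points st) zs'
     (agent (st_gx st)) r k - agent (st_gx st) k) : R^o)) => [|k]; last first.
    by rewrite agentB nxt_gx.
  apply: ler_wpM2r; first by apply: mean_ge0 => k; exact: sqnorm_ge0.
  apply: ler_wpM2l; first by rewrite divr_ge0 // (ltW lamw).
  apply: ler_wpM2r; first exact: sqr_ge0.
  exact: ler_pM (ltW etax0) (ltW etax0) etax_etay etax_etay.
by rewrite lerD2l ler_wpM2l.
Qed.

Let y_energy_nxt : round_mean p (fun r => y_energy (nxt r))
  <= (1 + lam) / 2 * y_energy st + 3 / (1 - lam) * (etay ^+ 2 * lam ^+ 2)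
     * (2 * p * mean (fun k => sqnorm (y_error st k) : R^o) + 2 * Dy).
Proof.
have hi := estimator_increment N0 b0 p01' gry (points st) zs' (agent (st_gy st)).
have c0 : 0 <= 3 / (1 - lam) * (etay ^+ 2 * lam ^+ 2).
  apply: mulr_ge0; first by rewrite divr_ge0 // (ltW lamw).
  by rewrite mulr_ge0 ?sqr_ge0.
apply: le_trans _ (_ : (1 + lam) / 2 * y_energy st + 3 / (1 - lam) * (etay ^+ 2 * lam ^+ 2)
    * round_mean p (fun r : round K N b => mean (fun k => sqnorm
      (next_gradients gry (points st) zs' (agent (st_gy st)) r k - agent (st_gy st) k) : R^o)) <= _).
  rewrite -round_meanZ -[(1 + lam) / 2 * _](@round_mean_cst R K N b p N0) -round_meanD.
  apply: (le_round_mean p01') => r; rewrite /y_energy nxt_y nxt_dy.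
  apply: le_trans (energy_step K0 UyU cUy (trmx_mix _ WT) WUy ByB hay lam1 _ _ _ _ _) _.
  rewrite lerD2l sqnorm_agents -[K%:R^-1 * \sum_k _]/(mean (fun k => sqnorm (agent _ k) : R^o)).
  rewrite (eq_mean (G := fun k => sqnorm (next_gradients gry (points st) zs'
     (agent (st_gy st)) r k - agent (st_gy st) k) : R^o)) => [|k]; last first.
    by rewrite agentB nxt_gy.
  by rewrite sqrrN.
by rewrite lerD2l ler_wpM2l.
Qed.

Let disagreement_nxt r : disagreement (nxt r) <= network_energy st / (1 - lam).
Proof.
rewrite /disagreement /x_disagreement /y_disagreement nxt_x nxt_y /network_energy mulrDl.
apply: lerD.
  exact: (consensus_step K0 UxU cUx (trmx_mix _ WT) WUx hax lam1 (erefl _)).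
exact: (consensus_step K0 UyU cUy (trmx_mix _ WT) WUy hay lam1 (erefl _)).
Qed.

Let move : R := mean (fun k => sqnorm2 (zs' k - points st k) : R^o).

Let move_bound r : move <= 3 * disagreement (nxt r) + 3 * disagreement st
  + 3 * (etax ^+ 2 * sqnorm (mean (agent (st_gx st)))
       + etay ^+ 2 * sqnorm (mean (agent (st_gy st)))).
Proof.
have hx := movement_bound K0 (st_x st) X'; have hy := movement_bound K0 (st_y st) Y'.
have ex : mean (agent X') - mean (agent (st_x st)) = - (etax *: mean (agent (st_gx st))).
  by rewrite (mean_next_iterate K0 WT Wr BxT BxB) addrC addKr.
have ey : mean (agent Y') - mean (agent (st_y st)) = etay *: mean (agent (st_gy st)).
  by rewrite (mean_next_iterate K0 WT Wr ByT ByB) addrC addKr scaleNr opprK.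
move: hx hy; rewrite ex ey sqnormN !sqnormZ => hx hy.
rewrite /move /disagreement /x_disagreement /y_disagreement nxt_x nxt_y.
have -> : mean (fun k => sqnorm2 (zs' k - points st k) : R^o)
   = mean (fun k => sqnorm (agent X' k - agent (st_x st) k) : R^o)
   + mean (fun k => sqnorm (agent Y' k - agent (st_y st) k) : R^o) by rewrite -meanD.
move: hx hy; move: (K%:R^-1 * _) (K%:R^-1 * _) (K%:R^-1 * _) (K%:R^-1 * _) (mean _) (mean _)
  (etax ^+ 2 * _) (etay ^+ 2 * _) => *; lra.
Qed.

Let D_bound : Dx + Dy <= 6 * (L ^+ 2 * move) + 6 * (bx + by_).
Proof.
have hx := sample_increment_bound K0 x_bias x_lip (points st) zs'.
have hy := sample_increment_bound K0 y_bias y_lip (points st) zs'.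
have := lerD hx hy; rewrite -/move -/Dx -/Dy; move: (L ^+ 2 * move) => *; lra.
Qed.

Let gradient_error_bound :
  sqnorm (mean (agent (st_gx st)) - grad_x (Jglob Q) (centroid st))
  + sqnorm (mean (agent (st_gy st)) - grad_y (Jglob Q) (centroid st))
  <= 3 * mean_error st + 3 * (bx + by_) + 6 * (L ^+ 2 * disagreement st).
Proof.
rewrite (grad_x_Jglob sQ) (grad_y_Jglob sQ).
have -> : mean (fun k => grad_x (Jloc Q k) (centroid st)) = mean (fun k => mean (dgx k (centroid st))).
  by apply: eq_mean => k; exact: (grad_x_Jloc sQ).
have -> : mean (fun k => grad_y (Jloc Q k) (centroid st)) = mean (fun k => mean (dgy k (centroid st))).
  by apply: eq_mean => k; exact: (grad_y_Jloc sQ).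
have hx := mean_gradient_error K0 N0 x_bias x_lip (points st) (centroid st) (agent (st_gx st)).
have hy := mean_gradient_error K0 N0 y_bias y_lip (points st) (centroid st) (agent (st_gy st)).
have := lerD hx hy; rewrite disagreement_points.
rewrite -[sqnorm (mean (estimation_error grx _ _)) ]/(sqnorm (mean (x_error st))).
rewrite -[sqnorm (mean (estimation_error gry _ _)) ]/(sqnorm (mean (y_error st))).
rewrite /mean_error; move: (sqnorm _) (sqnorm _) (sqnorm _) (sqnorm _) (L ^+ 2 * _) => *; lra.
Qed.

Lemma lyapunov_step :
  round_mean p (fun r : round K N b => lyapunov (round_step Q prm r st))
  <= lyapunov st - etax / 2 * sqnorm (grad_x (Jglob Q) (centroid st))
     - etay / 4 * sqnorm (grad_y (Jglob Q) (centroid st)) + 20 * (etay * (bx + by_)).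
Proof.
(* The next iterates are determined by the current state, only the estimators depend on the round.
   Merit and disagreement after the step are therefore constants, represented by their values at an
   arbitrary round [r0]. *)
have [r0 _] : {r0 : round K N b | true}.
  by exists (true, [ffun=> [ffun=> Ordinal N0]], [ffun=> Ordinal N0]).
pose M1 := merit Q (centroid (nxt r0)); pose C' := disagreement (nxt r0).
have -> : round_mean p (fun r : round K N b => lyapunov (round_step Q prm r st)) = M1 + etay *
   (2 / p * round_mean p (fun r => mean_error (nxt r)) + 48 * (L ^+ 2 * C')
    + 14 * 14 * (L ^+ 2 / (1 - lam) ^+ 2 * round_mean p (fun r => network_energy (nxt r)))
    + local_weight L lam etay * round_mean p (fun r => local_error (nxt r))).
  rewrite -!round_meanZ -[48 * (L ^+ 2 * C')](@round_mean_cst R K N b p N0) -!round_meanD.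
  rewrite -round_meanZ -[M1](@round_mean_cst R K N b p N0) -round_meanD.
  by apply: eq_bigr => r _; congr (_ * _); rewrite /lyapunov /M1 /C' !centroid_nxt.
have /andP[p0 p1] := p01.
have bR : (0 : R) < b%:R by rewrite ltr0n.
have KR : (0 : R) < K%:R by rewrite ltr0n.
have sq0 n (v : 'cV[R]_n) := sqnorm_ge0 v.
have iK : (0 : R) <= K%:R^-1 by rewrite invr_ge0.
have msq n (F : 'I_K -> 'cV[R]_n) : 0 <= mean (fun k => sqnorm (F k) : R^o).
  by apply: mean_ge0 => k; exact: sq0.
have D0 n (gr : 'I_K -> Z -> 'I_N -> 'cV[R]_n) z z' : 0 <= sample_increment gr z z'.
  by apply: mean_ge0 => k; apply: mean_ge0 => s; exact: sq0.
have b0' n (t : R) : 0 <= n%:R * (L ^+ 2 * t ^+ 2).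
  by apply: mulr_ge0 => //; apply: mulr_ge0; exact: sqr_ge0.
apply: (@lyapunov_arith R L lam etax etay p b%:R K%:R (merit Q (centroid st)) M1
  (sqnorm (grad_x (Jglob Q) (centroid st))) (sqnorm (grad_y (Jglob Q) (centroid st)))
  (sqnorm (mean (agent (st_gx st)))) (sqnorm (mean (agent (st_gy st))))
  (sqnorm (mean (agent (st_gx st)) - grad_x (Jglob Q) (centroid st)))
  (sqnorm (mean (agent (st_gy st)) - grad_y (Jglob Q) (centroid st)))
  (mean_error st) _ (local_error st) _ (network_energy st) _ (disagreement st) C'
  (Dx + Dy) move (bx + by_)).
- exact: lam01.
- exact: p01.
- exact: bR.
- exact: KR.
- exact: pbK.
- by rewrite ler1n.
- exact: L0.
- exact: etax0.
- exact: etax_etay.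
- exact: etayL.
- exact: etay3.
- exact: sq0.
- exact: sq0.
- exact: sq0.
- by apply: addr_ge0; exact: sq0.
- by apply: addr_ge0; exact: msq.
- by apply: addr_ge0; [exact: (energy_ge0 _ _ _ hax lam1)|exact: (energy_ge0 _ _ _ hay lam1)].
- by apply: addr_ge0; apply: mulr_ge0.
- by apply: addr_ge0; apply: mulr_ge0.
- by apply: addr_ge0; exact: D0.
- by apply: addr_ge0; exact: b0'.
- rewrite /M1 centroid_nxt.
  exact: (merit_descent K0 N0 sQ L0 PL nuL etax0 etaxy etayL).
- exact: gradient_error_bound.
- exact: mean_error_nxt.
- exact: local_error_nxt.
- rewrite round_meanD; apply: le_trans (lerD x_energy_nxt y_energy_nxt) _.
  rewrite /network_energy /local_error; set c := 3 / (1 - lam) * _.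
  move: (mean _) (mean _) (x_energy st) (y_energy st) => m1 m2 e1 e2.
  rewrite le_eqVlt; apply/orP; left; apply/eqP; ring.
- exact: disagreement_nxt.
- exact: D_bound.
- exact: move_bound.
Qed.

End OneState.

(** * Initial value and sum over the rounds *)

Section Run.
Variables (sigma : R) (Dx0 : 'cV[R]_(K * d1)) (Dy0 : 'cV[R]_(K * d2)).
Hypotheses (hsigma : bounded_variance Q sigma) (BDx : Bx *m Dx0 = 0) (BDy : By *m Dy0 = 0).

Let init (z : Z) (f : {ffun 'I_K * 'I_b -> 'I_N}) : state R K d1 d2 :=
  zoma_init Q prm z Dx0 Dy0 (noise_of f (fun=> (true, [ffun=> [ffun=> Ordinal N0]], f))).

Definition state_after (z : Z) (f : {ffun 'I_K * 'I_b -> 'I_N}) (h : seq (round K N b)) :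
    state R K d1 d2 :=
  foldr (round_step Q prm) (init z f) h.

Definition initial_disagreement (z : Z) (f : {ffun 'I_K * 'I_b -> 'I_N}) : R :=
  K%:R^-1 * sqnorm ((Wx - averaging R K d1) *m st_gx (init z f))
  + K%:R^-1 * sqnorm ((Wy - averaging R K d2) *m st_gy (init z f)).

Let KR : (0 : R) < K%:R. Proof. by rewrite ltr0n. Qed.
Let bR : (0 : R) < b%:R. Proof. by rewrite ltr0n. Qed.
Let iK : (0 : R) <= K%:R^-1. Proof. by rewrite invr_ge0. Qed.

Lemma lyapunov_ge0 st : 0 <= lyapunov st.
Proof.
have /andP[p0 p1] := p01; have /andP[l0 l1] := lam01.
have sq0 n (v : 'cV[R]_n) := sqnorm_ge0 v.
have msq n (F : 'I_K -> 'cV[R]_n) : 0 <= mean (fun k => sqnorm (F k) : R^o).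
  by apply: mean_ge0 => k; exact: sq0.
have ey0 : 0 < etay by apply: lt_le_trans (etax_le PL nuL etax0 etaxy); rewrite !mulr_gt0.
have /andP[a0 _] := local_weight_bound lam01 etay3.
have e0 : 0 <= network_energy st.
  by apply: addr_ge0; [exact: (energy_ge0 _ _ _ hax l1)|exact: (energy_ge0 _ _ _ hay l1)].
apply: addr_ge0; first exact: merit_ge0 PL _.
apply: mulr_ge0; first exact: ltW.
apply: addr_ge0; last by apply: mulr_ge0 => //; apply: addr_ge0; exact: msq.
apply: addr_ge0; last first.
  by apply: mulr_ge0 => //; apply: mulr_ge0 => //; apply: divr_ge0; exact: sqr_ge0.
apply: addr_ge0.
  apply: mulr_ge0; first by rewrite divr_ge0 // ltW.
  by apply: addr_ge0; exact: sq0.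
apply: mulr_ge0 => //; apply: mulr_ge0; first exact: sqr_ge0.
by apply: addr_ge0; apply: mulr_ge0.
Qed.

Lemma centroid_init z f : centroid (init z f) = z.
Proof.
rewrite /centroid /=; case: z => x y /=; congr pair.
  by rewrite (eq_mean (G := fun=> x)) ?mean_cst // => k; rewrite agent_stack.
by rewrite (eq_mean (G := fun=> y)) ?mean_cst // => k; rewrite agent_stack.
Qed.

Let points_init z f k : points (init z f) k = z.
Proof. by rewrite /points /agent_z /= !agent_stack; case: z. Qed.

Let x_error_init z f k : x_error (init z f) k
  = 0 + (batch_mean (fun j => f (k, j)) (grx k z) - mean (grx k z)).
Proof. by rewrite /x_error /estimation_error points_init /= agent_stack add0r. Qed.

Let y_error_init z f k : y_error (init z f) k
  = 0 + (batch_mean (fun j => f (k, j)) (gry k z) - mean (gry k z)).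
Proof. by rewrite /y_error /estimation_error points_init /= agent_stack add0r. Qed.

Let x_variance z : mean (fun k => mean (fun s => sqnorm (grx k z s - mean (grx k z)) : R^o) : R^o)
  <= 2 * bx + 2 * sigma ^+ 2.
Proof.
rewrite -[leRHS](mean_cst K0 (_ : R^o)); apply: le_mean => k.
apply: (estimator_variance N0 (x_bias k)); rewrite -[mean (dgx k z)](grad_x_Jloc sQ).
by have [_ _ h _] := hsigma; exact: h.
Qed.

Let y_variance z : mean (fun k => mean (fun s => sqnorm (gry k z s - mean (gry k z)) : R^o) : R^o)
  <= 2 * by_ + 2 * sigma ^+ 2.
Proof.
rewrite -[leRHS](mean_cst K0 (_ : R^o)); apply: le_mean => k.
apply: (estimator_variance N0 (y_bias k)); rewrite -[mean (dgy k z)](grad_y_Jloc sQ).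
by have [_ _ _ h] := hsigma; exact: h.
Qed.

Let init_errors z :
  sample_mean (fun f => mean_error (init z f)) <= (K%:R * b%:R)^-1 * (2 * (bx + by_) + 4 * sigma ^+ 2)
  /\ sample_mean (fun f => local_error (init z f)) <= b%:R^-1 * (2 * (bx + by_) + 4 * sigma ^+ 2).
Proof.
have [hx1 hx2] := batch_deviation K0 N0 b0 (fun k => grx k z) (fun=> 0).
have [hy1 hy2] := batch_deviation K0 N0 b0 (fun k => gry k z) (fun=> 0).
have vx := x_variance z; have vy := y_variance z.
have m0 d : sqnorm (mean (fun _ : 'I_K => 0 : 'cV[R]_d)) = 0 by rewrite mean_cst // sqnorm0.
have m0' d : mean (fun _ : 'I_K => sqnorm (0 : 'cV[R]_d) : R^o) = 0.
  by rewrite sqnorm0; exact: mean_cst.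
move: hx1 hy1 hx2 hy2; rewrite !m0 !m0' !add0r => hx1 hy1 hx2 hy2.
have key (c : R) : 0 <= c ->
    c * mean (fun k => mean (fun s => sqnorm (grx k z s - mean (grx k z)) : R^o) : R^o)
    + c * mean (fun k => mean (fun s => sqnorm (gry k z s - mean (gry k z)) : R^o) : R^o)
    <= c * (2 * (bx + by_) + 4 * sigma ^+ 2).
  move=> c0; rewrite -mulrDr; apply: ler_wpM2l => //; apply: le_trans (lerD vx vy) _; lra.
split; rewrite sample_meanD.
  apply: le_trans _ (key _ _); last by rewrite invr_ge0 mulr_ge0.
  rewrite -hx1 -hy1 le_eqVlt; apply/orP; left; apply/eqP.
  congr (_ + _); apply: eq_sample_mean => f; congr sqnorm; apply: eq_mean => k.
    exact: x_error_init.
  exact: y_error_init.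
apply: le_trans _ (key _ _); last by rewrite invr_ge0.
rewrite -hx2 -hy2 le_eqVlt; apply/orP; left; apply/eqP.
congr (_ + _); apply: eq_sample_mean => f; apply: eq_mean => k; congr sqnorm.
  exact: x_error_init.
exact: y_error_init.
Qed.

Let consensual d (v : 'cV[R]_d) :
  stack (fun _ : 'I_K => v) - averaging R K d *m stack (fun _ : 'I_K => v) = 0.
Proof.
apply/eqP; rewrite subr_eq0; apply/eqP; apply: stack_eq => k.
by rewrite agent_averaging agent_stack (eq_mean (G := fun=> v)) ?mean_cst // => l; rewrite agent_stack.
Qed.

Let init_energy z f : network_energy (init z f) <= etay ^+ 2 * initial_disagreement z f.
Proof.
have ey : etax ^+ 2 <= etay ^+ 2.
  have e : etax <= etay.
    apply: le_trans (etax_le PL nuL etax0 etaxy).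
    by rewrite mulrA ler_peMl ?(ltW etax0) // -natrM ler1n.
  by rewrite !expr2 ler_pM ?(ltW etax0).
rewrite mulrDr; apply: lerD.
  have U0 : Ux^T *m stack (fun _ : 'I_K => z.1) = 0.
    by apply: sqnorm_eq0; rewrite (complement_sqnorm K0 UxU cUx) consensual sqnorm0.
  apply: le_trans (energy_initial K0 _ _ UxU cUx _ _ BDx U0) _.
  by apply: ler_wpM2r => //; apply: mulr_ge0 => //; exact: sqnorm_ge0.
have U0 : Uy^T *m stack (fun _ : 'I_K => z.2) = 0.
  by apply: sqnorm_eq0; rewrite (complement_sqnorm K0 UyU cUy) consensual sqnorm0.
by apply: le_trans (energy_initial K0 _ _ UyU cUy _ _ BDy U0) _; rewrite sqrrN.
Qed.

Lemma initial_disagreement_ge0 z f : 0 <= initial_disagreement z f.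
Proof. by apply: addr_ge0; apply: mulr_ge0 => //; exact: sqnorm_ge0. Qed.

(** At a consensual start the disagreement vanishes. The weight [2 / p] meets a variance divided by
    [K b], so [p b K >= 1] leaves [8 sigma^2]; the local weight, at most [lam^2 / 4], meets a
    variance divided by [b] and yields the term [lam^2 sigma^2 / b]. *)
Lemma lyapunov_initial z :
  sample_mean (fun f => lyapunov (init z f)) <= merit Q z
    + etay * (9 * (bx + by_) + 8 * sigma ^+ 2 + (1 - lam) * sample_mean (initial_disagreement z)
       + lam ^+ 2 * (b%:R^-1 * sigma ^+ 2)).
Proof.
have /andP[p0 p1] := p01; have /andP[l0 l1] := lam01.
have ey0 : 0 < etay by apply: lt_le_trans (etax_le PL nuL etax0 etaxy); rewrite !mulr_gt0.
have [h1 h2] := init_errors z.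
have /andP[a0 a1] := local_weight_bound lam01 etay3.
have beta0 : 0 <= bx + by_.
  by apply: addr_ge0; apply: mulr_ge0 => //; apply: mulr_ge0; exact: sqr_ge0.
have s0 : 0 <= sigma ^+ 2 by exact: sqr_ge0.
have dis0 f : disagreement (init z f) = 0.
  by rewrite /disagreement /x_disagreement /y_disagreement /= !consensual !sqnorm0 !mulr0 addr0.
(* The step-size condition provides [(1 - lam)^3], of which the weight of the energy consumes two
   powers; the remaining one is the coefficient of [zeta0]. *)
have e3 : L ^+ 2 / (1 - lam) ^+ 2 * etay ^+ 2 * (14 * 14) <= 1 - lam.
  have w0 : 0 < 1 - lam by rewrite subr_gt0.
  have hl := etay3.
  have -> : L ^+ 2 / (1 - lam) ^+ 2 * etay ^+ 2 * (14 * 14)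
    = (14 * 14 * (L * etay) ^+ 2) / (1 - lam) ^+ 2 by field; rewrite gt_eqF.
  rewrite ler_pdivrMr ?exprn_gt0 // -exprS; apply: le_trans _ hl.
  have : 0 <= (L * etay) ^+ 2 by exact: sqr_ge0.
  have -> : (10 * (10 * (L * etay))) ^+ 2 = 10 * (10 * (10 * (10 * (L * etay) ^+ 2))) by ring.
  move: ((L * etay) ^+ 2) => t t0; lra.
apply: (@le_trans _ _ (sample_mean (fun f : {ffun 'I_K * 'I_b -> 'I_N} => merit Q z + etay *
   (2 / p * mean_error (init z f) + (1 - lam) * initial_disagreement z f
     + local_weight L lam etay * local_error (init z f))))).
  apply: le_sample_mean => f; rewrite /lyapunov centroid_init lerD2l dis0 !mulr0 addr0.
  apply: ler_wpM2l; first exact: ltW.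
  rewrite lerD2r lerD2l.
  have c0 : 0 <= 14 * 14 * (L ^+ 2 / (1 - lam) ^+ 2).
    by apply: mulr_ge0 => //; apply: divr_ge0; exact: sqr_ge0.
  rewrite mulrA; apply: le_trans (ler_wpM2l c0 (init_energy z f)) _.
  rewrite [leLHS]mulrA; apply: ler_wpM2r; first exact: initial_disagreement_ge0.
  by apply: le_trans e3; rewrite le_eqVlt; apply/orP; left; apply/eqP; ring.
rewrite sample_meanD sample_mean_cst // lerD2l sample_meanZ; apply: ler_wpM2l; first exact: ltW.
rewrite 2!sample_meanD 3!sample_meanZ.
have t1 : 2 / p * sample_mean (fun f => mean_error (init z f)) <= 4 * (bx + by_) + 8 * sigma ^+ 2.
  have p2 : 0 <= 2 / p by rewrite divr_ge0 // ltW.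
  apply: le_trans (ler_wpM2l p2 h1) _.
  have -> : 2 / p * ((K%:R * b%:R)^-1 * (2 * (bx + by_) + 4 * sigma ^+ 2))
    = (p * b%:R * K%:R)^-1 * (4 * (bx + by_) + 8 * sigma ^+ 2) by field; rewrite !gt_eqF.
  apply: ler_piMl; last by rewrite invf_le1 ?pbK // (lt_le_trans ltr01 pbK).
  by apply: addr_ge0; apply: mulr_ge0.
have t2 : local_weight L lam etay * sample_mean (fun f => local_error (init z f))
    <= bx + by_ + lam ^+ 2 * (b%:R^-1 * sigma ^+ 2).
  apply: le_trans (ler_wpM2l a0 h2) _.
  have ib : b%:R^-1 * (bx + by_) <= bx + by_.
    by apply: ler_piMl => //; rewrite invf_le1 // ler1n.
  have ib0 : 0 <= b%:R^-1 * (bx + by_) by apply: mulr_ge0 => //; rewrite invr_ge0.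
  have is0 : 0 <= b%:R^-1 * sigma ^+ 2 by apply: mulr_ge0 => //; rewrite invr_ge0.
  have l2 : lam ^+ 2 <= 1 by rewrite expr_le1 // ltW.
  have -> : b%:R^-1 * (2 * (bx + by_) + 4 * sigma ^+ 2)
     = 2 * (b%:R^-1 * (bx + by_)) + 4 * (b%:R^-1 * sigma ^+ 2) by ring.
  move: (b%:R^-1 * (bx + by_)) (b%:R^-1 * sigma ^+ 2) ib ib0 is0 => u v ib u0 v0.
  apply: le_trans (ler_wpM2r _ a1) _; first by apply: addr_ge0; apply: mulr_ge0.
  have : lam ^+ 2 * u <= u by apply: ler_piMl.
  have -> : lam ^+ 2 / 4 * (2 * u + 4 * v) = lam ^+ 2 * u / 2 + lam ^+ 2 * v by field.
  have : 0 <= lam ^+ 2 * u by apply: mulr_ge0 => //; exact: sqr_ge0.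
  lra.
move: t1 t2; set A1 := 2 / p * _; set A2 := local_weight L lam etay * _.
set A3 := (1 - lam) * _; set A4 := lam ^+ 2 * _.
move: A1 A2 A3 A4 => A1 A2 A3 A4; lra.
Qed.

Definition sqgrad (z : Z) : R := sqnorm (grad_x (Jglob Q) z) + sqnorm (grad_y (Jglob Q) z).

Theorem run_bound z T :
  \sum_(i < T) sample_mean (fun f => history_mean p i (fun h =>
      sqgrad (centroid (state_after z f h))))
  <= 4 / etax * (merit Q z + etay * (9 * (bx + by_) + 8 * sigma ^+ 2
        + (1 - lam) * sample_mean (initial_disagreement z)
        + lam ^+ 2 * (b%:R^-1 * sigma ^+ 2)) + T%:R * (20 * (etay * (bx + by_)))).
Proof.
have p01' : 0 <= p <= 1 by case/andP: p01 => /ltW -> ->.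
have exy : etax <= etay.
  apply: le_trans (etax_le PL nuL etax0 etaxy).
  by rewrite mulrA ler_peMl ?(ltW etax0) // -natrM ler1n.
(* The coefficient [etax / 4] lies below both gains, [etax / 2] along [x] and [etay / 4] along
   [y]. *)
pose psi st := etax / 4 * sqgrad (centroid st).
have step st : round_mean p (fun r : round K N b => lyapunov (round_step Q prm r st))
    <= lyapunov st - psi st + 20 * (etay * (bx + by_)).
  apply: le_trans (lyapunov_step st) _; rewrite lerD2r -addrA lerD2l -opprD lerN2 /psi /sqgrad.
  move: (sqnorm_ge0 (grad_x (Jglob Q) (centroid st))) (sqnorm_ge0 (grad_y (Jglob Q) (centroid st))).
  move: (sqnorm _) (sqnorm _) => x y x0 y0; rewrite mulrDr; apply: lerD; apply: ler_wpM2r => //.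
    have := etax0; lra.
  by rewrite ler_wpM2r.
have tel f := telescope_history N0 p01' (init z f) T lyapunov_ge0 step.
have c0 : 0 < etax / 4 by rewrite divr_gt0.
rewrite -(ler_pM2l c0) [leRHS]mulrA.
have -> : etax / 4 * (4 / etax) = 1 by field; rewrite gt_eqF.
rewrite mul1r -sample_mean_sum -sample_meanZ.
apply: (@le_trans _ _ (sample_mean (fun f : {ffun 'I_K * 'I_b -> 'I_N} =>
   lyapunov (init z f) + T%:R * (20 * (etay * (bx + by_)))))).
  apply: le_sample_mean => f; apply: le_trans _ (tel f).
  rewrite mulr_sumr; apply: ler_sum => i _.
  by rewrite -history_meanZ.
by rewrite sample_meanD sample_mean_cst // lerD2r lyapunov_initial.
Qed.

End Run.

End LyapunovStep.

(** * Law of the noise *)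

Section IndependentIntegral.
Context {d} {Om : measurableType d} {R : realType} (P : probability Om R).
Context {T : pointedType} (G : set (set T)).
Local Notation TG := (g_sigma_algebraType G).
Variable (z0 : Om -> T).
Hypothesis (mz0 : forall A, <<s G>> A -> measurable (z0 @^-1` A)).

Let mz0' : measurable_fun setT (z0 : Om -> TG).
Proof. by move=> _ A mA; rewrite setTI; exact: mz0. Qed.

Lemma measurable_source (g : TG -> R) : measurable_fun setT g ->
  measurable_fun setT (EFin \o (g \o z0)).
Proof. by move=> mg; apply/measurable_EFinP; exact: (measurableT_comp mg mz0'). Qed.

(** The identity is moved to the space of initial points: there the image of [P] restricted to [E]
    and [c] times the image of [P] are two measures that agree on every measurable set. Restricting
    the measure rather than the domain makes both sides integrals over the whole space. *)
Lemma independent_integral (E : set Om) (c : R) (g : TG -> R) :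
  0 <= c -> measurable E ->
  (forall A, <<s G>> A -> P (E `&` z0 @^-1` A) = (c%:E * P (z0 @^-1` A))%E) ->
  (forall x, 0 <= g x) -> measurable_fun setT g ->
  (\int[P]_(w in E) (g (z0 w))%:E = c%:E * \int[P]_w (g (z0 w))%:E)%E.
Proof.
move=> c0 mE indep g0 mg.
have mgE : measurable_fun setT (EFin \o g) by apply/measurable_EFinP.
have mgz := measurable_source mg.
pose mu := mrestr P mE.
transitivity (\int[mu]_(w in E) (g (z0 w))%:E)%E.
  apply: eq_measure_integral => A mA AE.
  by rewrite -[RHS]/(P (A `&` E)) setIidl.
transitivity (\int[mu]_w (g (z0 w))%:E)%E.
  rewrite (@ge0_negligible_integral _ _ _ mu setT (~` E)) //; first by rewrite setTD setCK.
  - exact: measurableC.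
  - by move=> w _; rewrite lee_fin.
  - by rewrite -[LHS]/(P (~` E `&` E)) setICl measure0.
pose push (m : {measure set Om -> \bar R}) :=
  measure_function_pushforward__canonical__measure_function_Measure m mz0'.
have pushE (m : {measure set Om -> \bar R}) :
    (\int[push m]_x (g x)%:E = \int[m]_w (g (z0 w))%:E)%E.
  by rewrite (ge0_integral_pushforward mz0') // => x _; rewrite lee_fin.
rewrite -pushE -[in RHS]pushE.
transitivity (\int[mscale (NngNum c0) (push P)]_x (g x)%:E)%E.
  apply: eq_measure_integral => A mA _.
  rewrite -[LHS]/(P (z0 @^-1` A `&` E)) setIC; exact: indep.
by rewrite ge0_integral_mscale // => x _; rewrite lee_fin.
Qed.

End IndependentIntegral.

Section NoiseLaw.
Context {R : realType} {K N b d1 d2 : nat}.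
Local Notation Z := ('cV[R]_d1 * 'cV[R]_d2)%type.
Context {disp} {Om : measurableType disp} (P : probability Om R).
Variables (p : R) (z0 : Om -> Z) (xi : Om -> noise K N b N b).
Hypotheses (N0 : (0 < N)%N) (law : noise_law P p z0 xi).

Definition first_of (x : noise K N b N b) : {ffun 'I_K * 'I_b -> 'I_N} :=
  [ffun kj => first x kj.1 kj.2].

Definition round_of (x : noise K N b N b) (i : nat) : round K N b :=
  (coin x i, [ffun k => large x k i], [ffun kj => small x kj.1 i kj.2]).

Fixpoint history_of (x : noise K N b N b) (i : nat) : seq (round K N b) :=
  if i is i'.+1 then round_of x i' :: history_of x i' else [::].

Section Config.
Variables (f : {ffun 'I_K * 'I_b -> 'I_N}) (c : nat -> round K N b) (A : set Z).
Hypothesis mA : <<s (open : set (set Z))>> A.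

Let Ev (a : source K b b) : set Om :=
  match a with
  | inl (inl (inl (inl _))) => z0 @^-1` A
  | inl (inl (inl (inr i))) => [set w | coin (xi w) i = (c i).1.1]
  | inl (inl (inr (k, i))) => [set w | large (xi w) k i = (c i).1.2 k]
  | inl (inr (k, i, j)) => [set w | small (xi w) k i j = (c i).2 (k, j)]
  | inr (k, j) => [set w | first (xi w) k j = f (k, j)]
  end.

Let EvP a : source_events z0 xi a (Ev a).
Proof.
case: a => [[[[u|i]|[k i]]|[[k i] j]]|[k j]] /=.
- by exists A.
- by exists [set (c i).1.1].
- by exists [set (c i).1.2 k].
- by exists [set (c i).2 (k, j)].
- by exists [set f (k, j)].
Qed.

Let mEv a : measurable (Ev a).
Proof. by have [[h _] _ _ _ _] := law; apply: (h a); exact: EvP. Qed.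

Variable i : nat.

(** The finitely many sources that act before round [i]; [phi] embeds them into [source], whose
    round indices are unbounded. [mutually_independent] asks for a duplicate-free list, which the
    injectivity of [phi] provides. *)
Let J : finType := (unit + 'I_i + ('I_K * 'I_i) + ('I_K * 'I_i * 'I_b) + ('I_K * 'I_b))%type.

Let phi (j : J) : source K b b :=
  match j with
  | inl (inl (inl (inl u))) => inl (inl (inl (inl u)))
  | inl (inl (inl (inr i))) => inl (inl (inl (inr (i : nat))))
  | inl (inl (inr (k, i))) => inl (inl (inr (k, i : nat)))
  | inl (inr (k, i, j)) => inl (inr (k, i : nat, j))
  | inr kj => inr kj
  end.

Let phi_inj : injective phi.
Proof.
case=> [[[[u|x]|[k x]]|[[k x] l]]|[k l]] [[[[u'|x']|[k' x']]|[[k' x'] l']]|[k' l']] //=.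
- by case: u u' => -[].
- by move=> [] /val_inj ->.
- by move=> [] -> /val_inj ->.
- by move=> [] -> /val_inj -> ->.
- by move=> [] -> ->.
Qed.

Let srcs := [seq phi j | j <- enum J].

Let EvI : \big[setI/setT]_(a <- srcs) Ev a
  = [set w | first_of (xi w) = f /\ forall j, (j < i)%N -> round_of (xi w) j = c j] `&` z0 @^-1` A.
Proof.
rewrite -bigcap_seq; apply/seteqP; split => w.
  move=> h.
  have hJ (j : J) : Ev (phi j) w by apply: h => /=; rewrite map_f // mem_enum.
  split; last exact: (hJ (inl (inl (inl (inl tt))))).
  split; first by apply/ffunP => -[k l]; rewrite ffunE; exact: (hJ (inr (k, l))).
  move=> j ji; rewrite [RHS]surjective_pairing [(c j).1]surjective_pairing.
  congr (_, _, _).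
  - exact: (hJ (inl (inl (inl (inr (Ordinal ji)))))).
  - by apply/ffunP => k; rewrite ffunE; exact: (hJ (inl (inl (inr (k, Ordinal ji))))).
  - by apply/ffunP => -[k l]; rewrite ffunE; exact: (hJ (inl (inr (k, Ordinal ji, l)))).
move=> [[hf hc] hA] a /= /mapP[j _ ->].
case: j => [[[[u|x]|[k x]]|[[k x] l]]|[k l]] //=.
- by rewrite -(hc x (ltn_ord x)).
- by rewrite -(hc x (ltn_ord x)) /= ffunE.
- by rewrite -(hc x (ltn_ord x)) /= ffunE.
- by rewrite -hf ffunE.
Qed.

Lemma config_measurable : measurable
  ([set w | first_of (xi w) = f /\ forall j, (j < i)%N -> round_of (xi w) j = c j]
      `&` z0 @^-1` A).
Proof. by rewrite -EvI; exact: bigsetI_measurable. Qed.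

(** Independence multiplies the probabilities of the prescribed outcomes; regrouped by rounds they
    form the round weights, and the event of the initial point stays as a factor. *)
Lemma config_probability :
  P ([set w | first_of (xi w) = f /\ forall j, (j < i)%N -> round_of (xi w) j = c j]
      `&` z0 @^-1` A)
  = ((N%:R^-1 ^+ #|{: 'I_K * 'I_b}| * \prod_(j < i) round_weight p (c j))%:E
       * P (z0 @^-1` A))%E.
Proof.
have [[_ indep] hcoin hlarge hsmall hfirst] := law.
rewrite -EvI indep; last first.
- exact: EvP.
- by rewrite map_inj_uniq ?enum_uniq.
pose w (j : J) : R := match j with
  | inl (inl (inl (inl _))) => fine (P (z0 @^-1` A))
  | inl (inl (inl (inr i))) => if (c i).1.1 then p else 1 - p
  | inl (inl (inr (k, i))) => large_weight ((c i).1.2 k)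
  | inl (inr _) => N%:R^-1
  | inr _ => N%:R^-1
  end.
have mz : measurable (z0 @^-1` A) by exact: (mEv (inl (inl (inl (inl tt))))).
have wP j : P (Ev (phi j)) = (w j)%:E.
  case: j => [[[[u|x]|[k x]]|[[k x] l]]|[k l]] /=.
  - by rewrite fineK // fin_num_measure.
  - case: ((c x).1.1); first exact: hcoin.
    have mc : measurable [set w | coin (xi w) x].
      have [[h _] _ _ _ _] := law.
      by apply: (h (inl (inl (inl (inr (x : nat)))))); exists [set true].
    have -> : [set w | coin (xi w) x = false] = ~` [set w | coin (xi w) x].
      by apply/seteqP; split => v /=; [move=> ->|move=> /negP/negbTE].
    by rewrite probability_setC // hcoin.
  - exact: hlarge.
  - exact: hsmall.
  - exact: hfirst.
rewrite big_map big_enum /= (eq_bigr _ (fun j _ => wP j)).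
have -> : (\prod_j (w j)%:E)%E = (\prod_j w j)%:E.
  by rewrite (big_morph EFin (@EFinM R) (erefl _)).
rewrite -[P (z0 @^-1` A)]fineK ?fin_num_measure // -EFinM; congr EFin.
rewrite !big_sumType /= big_const card_unit /= mulr1.
have -> : \prod_(q : 'I_K * 'I_i) (let (k, j) := q in large_weight ((c j).1.2 k) : R)
   = \prod_(j < i) \prod_(k < K) large_weight ((c j).1.2 k).
  by rewrite exchange_big pair_bigA /=; apply: eq_bigr => -[].
rewrite /round_weight !big_split /= !prodr_const card_ord -exprM !card_prod !card_ord.
rewrite (_ : (K * i * b)%N = (K * b * i)%N) 1?mulnAC //.
by ring.
Qed.

End Config.

End NoiseLaw.

(** Measurability for the sigma-algebra generated by the open sets, the one through which
    [source_events] sees the initial point. *)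
Definition borel {R : realType} {d1 d2 : nat} (g : 'cV[R]_d1 * 'cV[R]_d2 -> R) : Prop :=
  measurable_fun setT
    (g : g_sigma_algebraType (open : set (set ('cV[R]_d1 * 'cV[R]_d2))) -> R).

Section Law.
Context {R : realType} {K N b d1 d2 : nat}.
Local Notation Z := ('cV[R]_d1 * 'cV[R]_d2)%type.
Context {disp} {Om : measurableType disp} (P : probability Om R).
Variables (p : R) (z0 : Om -> Z) (xi : Om -> noise K N b N b).
Hypotheses (N0 : (0 < N)%N) (p01 : 0 <= p <= 1) (law : noise_law P p z0 xi).

Lemma measurable_initial A : <<s (open : set (set Z))>> A -> measurable (z0 @^-1` A).
Proof. by have [[h _] _ _ _ _] := law => mA; apply: (h (inl (inl (inl (inl tt))))); exists A. Qed.

Lemma history_of_in (x : noise K N b N b) i : history_of x i \in histories K N b i.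
Proof.
elim: i => [|i IH] /=; first by rewrite inE.
by apply/allpairsP; exists (history_of x i, round_of x i); rewrite IH mem_enum.
Qed.

Lemma uniq_histories i : uniq (histories K N b i).
Proof.
elim: i => [|i IH] //=; apply: allpairs_uniq => //; first exact: enum_uniq.
by move=> [h r] [h' r'] /= _ _ [-> ->].
Qed.

Lemma history_config i (h : seq (round K N b)) : h \in histories K N b i ->
  exists c : nat -> round K N b,
    (forall x, history_of x i = h <-> forall j, (j < i)%N -> round_of x j = c j)
    /\ \prod_(r <- h) round_weight p r = \prod_(j < i) round_weight p (c j).
Proof.
elim: i h => [|i IH] h /=.
  rewrite inE => /eqP ->.
  exists (fun=> (true, [ffun=> [ffun=> Ordinal N0]], [ffun=> Ordinal N0])).
  by split=> [x|]; rewrite ?big_nil ?big_ord0.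
case/allpairsP => -[h' r] /= [/IH[c [hc ew]] _ ->].
exists (fun j => if j == i then r else c j); split.
  move=> x; split.
    case=> xr /hc xc j; rewrite ltnS leq_eqVlt => /orP[/eqP ->|ji]; first by rewrite eqxx.
    by rewrite ltn_eqF // xc.
  move=> xc; congr cons; first by rewrite xc // eqxx.
  by apply/hc => j ji; rewrite xc ?(ltn_trans ji) // ltn_eqF.
rewrite big_cons big_ord_recr /= eqxx ew mulrC; congr (_ * _).
by apply: eq_bigr => j _; rewrite ltn_eqF.
Qed.

Lemma expectation_run i (F : {ffun 'I_K * 'I_b -> 'I_N} -> seq (round K N b) -> Z -> R) :
  (forall f h z, 0 <= F f h z) -> (forall f h, borel (F f h)) ->
  (\int[P]_w (F (first_of (xi w)) (history_of (xi w) i) (z0 w))%:E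
   = \int[P]_w (sample_mean (fun f => history_mean p i (fun h => F f h (z0 w))))%:E)%E.
Proof.
move=> F0 mF.
pose s := [seq (f, h) | f <- enum {ffun 'I_K * 'I_b -> 'I_N}, h <- histories K N b i].
pose E (a : {ffun 'I_K * 'I_b -> 'I_N} * seq (round K N b)) : set Om :=
  [set w | first_of (xi w) = a.1 /\ history_of (xi w) i = a.2].
pose wt (a : {ffun 'I_K * 'I_b -> 'I_N} * seq (round K N b)) : R :=
  N%:R^-1 ^+ #|{: 'I_K * 'I_b}| * \prod_(r <- a.2) round_weight p r.
pose G (a : {ffun 'I_K * 'I_b -> 'I_N} * seq (round K N b)) (w : Om) : \bar R :=
  (F a.1 a.2 (z0 w))%:E.
have us : uniq s.
  by apply: allpairs_uniq; [exact: enum_uniq|exact: uniq_histories|move=> [? ?] [? ?] /= _ _ [-> ->]].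
have wt0 a : 0 <= wt a.
  by apply: mulr_ge0; [rewrite exprn_ge0 // invr_ge0|exact: history_weight_ge0].
have G0 a w : (0 <= G a w)%E by rewrite lee_fin.
have mG a : measurable_fun setT (G a).
  exact: (measurable_source measurable_initial (mF a.1 a.2)).
have conf a : a \in s -> measurable (E a) /\ forall A, <<s (open : set (set Z))>> A ->
    P (E a `&` z0 @^-1` A) = ((wt a)%:E * P (z0 @^-1` A))%E.
  case/allpairsP => -[f h] /= [_ /history_config[c [hc ew]] ->].
  have -> : E (f, h) = [set w | first_of (xi w) = f /\
      forall j, (j < i)%N -> round_of (xi w) j = c j].
    by apply/seteqP; split => w -[e1 /hc e2]; split.
  have mT : <<s (open : set (set Z))>> setT by apply: sub_sigma_algebra; exact: openT.
  split; first by have := config_measurable law f c mT i; rewrite preimage_setT setIT.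
  by move=> A mA; rewrite /wt /= ew; exact: config_probability.
(* [conf] yields measurability of [E a] only for [a] in the list; the conditional makes every
   summand measurable, as the exchange of sum and integral demands. *)
have step (a : _) : a \in s -> (\int[P]_w (if a \in s then G a \_ (E a) else cst 0%E) w
    = \int[P]_w ((wt a)%:E * G a w))%E.
  move=> ins; rewrite ins -integral_mkcond; have [mE pE] := conf a ins.
  rewrite (independent_integral measurable_initial (wt0 a) mE pE) //; last exact: mF.
  by rewrite ge0_integralZl_EFin.
transitivity (\int[P]_w \sum_(a <- s) (if a \in s then G a \_ (E a) else cst 0%E) w)%E.
  apply: eq_integral => w _.
  have ins : (first_of (xi w), history_of (xi w) i) \in s.
    by apply/allpairsP; exists (first_of (xi w), history_of (xi w) i); rewrite mem_enum history_of_in.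
  rewrite (bigD1_seq _ ins us) /= ins [X in (_ + X)%E]big1_seq ?adde0.
    by rewrite patchE mem_set.
  move=> a /andP[na ia]; rewrite ia patchE memNset // => -[e1 e2].
  by move/eqP: na; apply; rewrite e1 e2 -surjective_pairing.
rewrite ge0_integral_sum //; last first.
- move=> a w _; case: ifP => // _; rewrite patchE; case: ifP => // _; exact: G0.
- move=> a; case: ifPn => [/conf[mE _]|_]; last exact: measurable_cst.
  by apply/(measurable_restrictT _ mE); exact: measurable_funTS.
rewrite big_seq (eq_bigr _ step) -big_seq -ge0_integral_sum //; last first.
- by move=> a w _; apply: mule_ge0; rewrite // lee_fin.
- by move=> a; exact: measurable_funeM.
apply: eq_integral => w _; rewrite /G.
under eq_bigr do rewrite -EFinM.
rewrite sumEFin; congr EFin.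
rewrite /s big_allpairs_dep /= big_enum /= /sample_mean mulr_sumr; apply: eq_bigr => f _.
by rewrite /history_mean mulr_sumr; apply: eq_bigr => h _; rewrite /wt /= mulrA.
Qed.

End Law.

(** * Measurability in the initial point *)

Lemma zoma_history {R : realType} {K N b d1 d2 : nat} (Q : loss R K N d1 d2)
    (p etax etay dx dy : R) (W : 'M[R]_K) (Bx : 'M[R]_(K * d1)) (By : 'M[R]_(K * d2))
    (N0 : (0 < N)%N) z Dx0 Dy0 (x : noise K N b N b) i :
  zoma Q {| par_p := p; par_beta := 0; eta_x := etax; eta_y := etay; delta_x := dx;
            delta_y := dy; mat_Ax := W *t 1%:M; mat_Bx := Bx; mat_Cx := 1%:M;
            mat_Ay := W *t 1%:M; mat_By := By; mat_Cy := 1%:M |} z Dx0 Dy0 x i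
  = state_after Q p etax etay dx dy W Bx By N0 Dx0 Dy0 z (first_of x) (history_of x i).
Proof.
elim: i => [|i IH] /=.
  rewrite /state_after /= /zoma_init /=.
  have e k : (fun j : 'I_b => first_of x (k, j)) = first x k.
    by apply/funext => j; rewrite ffunE.
  by congr State; congr stack; apply/funext => k; rewrite e.
rewrite IH /state_after /= /round_step /zoma_step /=.
have e1 k : [ffun k' => large x k' i] k = large x k i by rewrite ffunE.
have e2 k : (fun j : 'I_b => [ffun kj => small x kj.1 i kj.2] (k, j)) = small x k i.
  by apply/funext => j; rewrite ffunE.
by congr State; congr stack; apply/funext => k; rewrite e1 e2.
Qed.

Section Continuity.
Context {R : realType} {T : topologicalType}.

Lemma continuous_sum {V : normedModType R} (I : Type) (s : seq I) (F : I -> T -> V) :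
  (forall i, continuous (F i)) -> continuous (fun t => \sum_(i <- s) F i t).
Proof.
move=> cF; elim: s => [|i s IH] t.
  by under eq_fun do rewrite big_nil; exact: cvg_cst.
under eq_fun do rewrite big_cons.
by apply: cvgD; [exact: cF|exact: IH].
Qed.

Lemma continuous_coords {m n} (F : T -> 'M[R]_(m, n)) :
  (forall i j, continuous (fun t => F t i j)) -> continuous F.
Proof.
move=> cF; have -> : F = fun t => \sum_i \sum_j F t i j *: delta_mx i j.
  by apply/funext => t; exact: matrix_sum_delta.
apply: continuous_sum => i; apply: continuous_sum => j t.
by apply: cvgZr_tmp; exact: cF.
Qed.

Lemma continuous_coord {m n} (F : T -> 'M[R]_(m, n)) i j :
  continuous F -> continuous (fun t => F t i j).
Proof. by move=> cF t; exact: (continuous_comp (cF t) (@coord_continuous _ _ _ i j (F t))). Qed.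

Lemma continuous_mulmx {m n} (A : 'M[R]_(m, n)) (F : T -> 'cV[R]_n) :
  continuous F -> continuous (fun t => A *m F t).
Proof.
move=> cF; apply: continuous_coords => i j.
under eq_fun do rewrite mxE.
by apply: continuous_sum => k t; apply: cvgMl_tmp; exact: continuous_coord.
Qed.

Lemma continuous_mean {V : normedModType R} {n} (F : 'I_n -> T -> V) :
  (forall i, continuous (F i)) -> continuous (fun t => mean (F^~ t)).
Proof. by move=> cF t; apply: cvgZl_tmp; exact: continuous_sum. Qed.

Lemma continuous_stack {K d} (F : 'I_K -> T -> 'cV[R]_d) :
  (forall k, continuous (F k)) -> continuous (fun t => stack (F^~ t)).
Proof.
move=> cF; apply: continuous_coords => i j.
by under eq_fun do rewrite mxE; exact: continuous_coord.
Qed.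

Lemma continuous_agent {K d} (F : T -> 'cV[R]_(K * d)) k :
  continuous F -> continuous (fun t => agent (F t) k).
Proof.
move=> cF; apply: continuous_coords => i j.
by under eq_fun do rewrite mxE; exact: continuous_coord.
Qed.

Lemma continuous_sqnorm {n} (F : T -> 'cV[R]_n) :
  continuous F -> continuous (fun t => sqnorm (F t)).
Proof.
move=> cF; apply: continuous_sum => j t.
by under eq_fun do rewrite expr2; apply: cvgM; exact: continuous_coord.
Qed.

Lemma continuous_fst {U V : topologicalType} (F : T -> U * V) :
  continuous F -> continuous (fun t => (F t).1).
Proof. by move=> cF t; apply: continuous_comp; [exact: cF|exact: cvg_fst]. Qed.

Lemma continuous_snd {U V : topologicalType} (F : T -> U * V) :
  continuous F -> continuous (fun t => (F t).2).
Proof. by move=> cF t; apply: continuous_comp; [exact: cF|exact: cvg_snd]. Qed.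

Lemma continuous_pair {U V : topologicalType} (F : T -> U) (G : T -> V) :
  continuous F -> continuous G -> continuous (fun t => (F t, G t)).
Proof. by move=> cF cG t; apply: cvg_pair; [exact: cF|exact: cG]. Qed.

Lemma continuous_shift {V : normedModType R} (F : T -> V) (v : V) :
  continuous F -> continuous (fun t => F t + v).
Proof. by move=> cF t; apply: cvgD; [exact: cF|exact: cvg_cst]. Qed.

Context {d1 d2 : nat}.
Local Notation Z := ('cV[R]_d1 * 'cV[R]_d2)%type.

Lemma continuous_cw_x (delta : R) (f : Z -> R) (F : T -> Z) :
  continuous f -> continuous F -> continuous (fun t => cw_x delta f (F t)).
Proof.
move=> cf cF; apply: continuous_sum => j t; apply: cvgZr_tmp; apply: cvgMr_tmp; apply: cvgB.
  apply: (continuous_comp (f := fun t => ((F t).1 + delta *: delta_mx j 0, (F t).2))); last exact: cf.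
  by apply: continuous_pair; [apply: continuous_shift; exact: continuous_fst|exact: continuous_snd].
apply: (continuous_comp (f := fun t => ((F t).1 - delta *: delta_mx j 0, (F t).2))); last exact: cf.
by apply: continuous_pair; [apply: continuous_shift; exact: continuous_fst|exact: continuous_snd].
Qed.

Lemma continuous_cw_y (delta : R) (f : Z -> R) (F : T -> Z) :
  continuous f -> continuous F -> continuous (fun t => cw_y delta f (F t)).
Proof.
move=> cf cF; apply: continuous_sum => j t; apply: cvgZr_tmp; apply: cvgMr_tmp; apply: cvgB.
  apply: (continuous_comp (f := fun t => ((F t).1, (F t).2 + delta *: delta_mx j 0))); last exact: cf.
  by apply: continuous_pair; [exact: continuous_fst|apply: continuous_shift; exact: continuous_snd].
apply: (continuous_comp (f := fun t => ((F t).1, (F t).2 - delta *: delta_mx j 0))); last exact: cf.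
by apply: continuous_pair; [exact: continuous_fst|apply: continuous_shift; exact: continuous_snd].
Qed.

Lemma continuous_batch_mean {N m d} (draw : 'I_m -> 'I_N) (F : 'I_N -> T -> 'cV[R]_d) :
  (forall s, continuous (F s)) -> continuous (fun t => batch_mean draw (F^~ t)).
Proof. by move=> cF t; apply: cvgZl_tmp; apply: continuous_sum => j; exact: cF. Qed.

Lemma continuous_next_estimator {N b B d} (beta : R) c (lg : 'I_B -> 'I_N) (sm : 'I_b -> 'I_N)
    (gr : Z -> 'I_N -> 'cV[R]_d) (z z' : T -> Z) (g : T -> 'cV[R]_d) :
  (forall s, continuous (fun t => gr (z t) s)) -> (forall s, continuous (fun t => gr (z' t) s)) ->
  continuous g -> continuous (fun t => next_estimator beta c lg sm gr (z' t) (z t) (g t)).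
Proof.
move=> cz cz' cg; rewrite /next_estimator; case: c.
  exact: (continuous_batch_mean (F := fun s t => gr (z t) s) (draw := lg) cz).
move=> t; apply: cvgD; last exact: (continuous_batch_mean (F := fun s t => gr (z t) s) (draw := sm) cz).
apply: cvgZl_tmp; apply: cvgB; first exact: cg.
exact: (continuous_batch_mean (F := fun s t => gr (z' t) s) (draw := sm) cz').
Qed.

End Continuity.

Section BorelRun.
Context {R : realType} {K N b d1 d2 : nat}.
Local Notation Z := ('cV[R]_d1 * 'cV[R]_d2)%type.
Variables (Q : loss R K N d1 d2) (L nu : R).
Hypotheses (K0 : (0 < K)%N) (N0 : (0 < N)%N).
Hypotheses (sQ : expected_smoothness Q L) (PL : PL_condition Q nu).

Let cQ k s : continuous (Q k s).
Proof. by have [/(_ k s)[dQ _ _] _ _] := sQ => z; exact: differentiable_continuous. Qed.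

Record continuous_state {T : topologicalType} (st : T -> state R K d1 d2) : Prop := {
  continuous_st_x : continuous (fun t => st_x (st t));
  continuous_st_y : continuous (fun t => st_y (st t));
  continuous_st_gx : continuous (fun t => st_gx (st t));
  continuous_st_gy : continuous (fun t => st_gy (st t));
  continuous_st_dx : continuous (fun t => st_dx (st t));
  continuous_st_dy : continuous (fun t => st_dy (st t)) }.

Variable (prm : params R K d1 d2).

Lemma continuous_init Dx0 Dy0 (x : noise K N b N b) :
  continuous_state (fun z => zoma_init Q prm z Dx0 Dy0 x).
Proof.
split=> /=; try by move=> z; exact: cvg_cst.
- by apply: (continuous_stack (F := fun _ z => z.1)) => k; apply: continuous_fst => z; exact: cvg_id.
- by apply: (continuous_stack (F := fun _ z => z.2)) => k; apply: continuous_snd => z; exact: cvg_id.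
- apply: (continuous_stack (F := fun k z => batch_mean (first x k) (fun s => cw_x (delta_x prm) (Q k s) z))) => k.
  apply: (continuous_batch_mean (F := fun s z => cw_x (delta_x prm) (Q k s) z)) => s.
  by apply: continuous_cw_x => // z; exact: cvg_id.
- apply: (continuous_stack (F := fun k z => batch_mean (first x k) (fun s => cw_y (delta_y prm) (Q k s) z))) => k.
  apply: (continuous_batch_mean (F := fun s z => cw_y (delta_y prm) (Q k s) z)) => s.
  by apply: continuous_cw_y => // z; exact: cvg_id.
Qed.

Lemma continuous_step {T : topologicalType} (st : T -> state R K d1 d2) (x : noise K N b N b) i :
  continuous_state st -> continuous_state (fun t => zoma_step Q prm x i (st t)).
Proof.
move=> [cx cy cgx cgy cdx cdy].
have cX : continuous (fun t => st_x (zoma_step Q prm x i (st t))).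
  have cI : continuous (fun t => mat_Cx prm *m st_x (st t) - eta_x prm *: st_gx (st t)).
    by move=> t; apply: cvgB; [exact: continuous_mulmx|apply: cvgZl_tmp; exact: cgx].
  by move=> t; apply: cvgB; [exact: (continuous_mulmx cI)|exact: continuous_mulmx].
have cY : continuous (fun t => st_y (zoma_step Q prm x i (st t))).
  have cI : continuous (fun t => mat_Cy prm *m st_y (st t) + eta_y prm *: st_gy (st t)).
    by move=> t; apply: cvgD; [exact: continuous_mulmx|apply: cvgZl_tmp; exact: cgy].
  by move=> t; apply: cvgB; [exact: (continuous_mulmx cI)|exact: continuous_mulmx].
have cp k : continuous (fun t => agent_z (st_x (st t)) (st_y (st t)) k).
  by apply: continuous_pair; exact: continuous_agent.
have cp' k : continuous (fun t => agent_z (st_x (zoma_step Q prm x i (st t)))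
    (st_y (zoma_step Q prm x i (st t))) k).
  by apply: continuous_pair; exact: continuous_agent.
split; [exact: cX|exact: cY| | | | ].
- apply: (continuous_stack (F := fun k t => next_estimator (par_beta prm) (coin x i) (large x k i)
     (small x k i) (fun z s => cw_x (delta_x prm) (Q k s) z) _ _ (agent (st_gx (st t)) k))) => k.
  apply: continuous_next_estimator; last exact: continuous_agent.
    by move=> s; apply: continuous_cw_x; [exact: cQ|exact: cp'].
  by move=> s; apply: continuous_cw_x.
- apply: (continuous_stack (F := fun k t => next_estimator (par_beta prm) (coin x i) (large x k i)
     (small x k i) (fun z s => cw_y (delta_y prm) (Q k s) z) _ _ (agent (st_gy (st t)) k))) => k.
  apply: continuous_next_estimator; last exact: continuous_agent.
    by move=> s; apply: continuous_cw_y; [exact: cQ|exact: cp'].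
  by move=> s; apply: continuous_cw_y.
- by move=> t; apply: cvgD; [exact: cdx|exact: (continuous_mulmx cX)].
- by move=> t; apply: cvgD; [exact: cdy|exact: (continuous_mulmx cY)].
Qed.

Lemma continuous_centroid {T : topologicalType} (st : T -> state R K d1 d2) :
  continuous_state st -> continuous (fun t => centroid (st t)).
Proof.
move=> [cx cy _ _ _ _]; apply: continuous_pair.
  by apply: (continuous_mean (F := fun k t => agent (st_x (st t)) k)) => k; exact: continuous_agent.
by apply: (continuous_mean (F := fun k t => agent (st_y (st t)) k)) => k; exact: continuous_agent.
Qed.

Lemma continuous_Jglob : continuous (Jglob Q).
Proof. by move=> z; apply: differentiable_continuous; exact: differentiable_Jglob sQ z. Qed.

Lemma continuous_grad_x : continuous (grad_x (Jglob Q)).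
Proof.
have [h _ _] := sQ.
have -> : grad_x (Jglob Q) = fun z => mean (fun k => mean (fun s => grad_x (Q k s) z)).
  by apply/funext => z; rewrite (grad_x_Jglob sQ); apply: eq_mean => k; rewrite (grad_x_Jloc sQ).
apply: (continuous_mean (F := fun k z => mean (fun s => grad_x (Q k s) z))) => k.
by apply: (continuous_mean (F := fun s z => grad_x (Q k s) z)) => s; have [] := h k s.
Qed.

Lemma continuous_grad_y : continuous (grad_y (Jglob Q)).
Proof.
have [h _ _] := sQ.
have -> : grad_y (Jglob Q) = fun z => mean (fun k => mean (fun s => grad_y (Q k s) z)).
  by apply/funext => z; rewrite (grad_y_Jglob sQ); apply: eq_mean => k; rewrite (grad_y_Jloc sQ).
apply: (continuous_mean (F := fun k z => mean (fun s => grad_y (Q k s) z))) => k.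
by apply: (continuous_mean (F := fun s z => grad_y (Q k s) z)) => s; have [] := h k s.
Qed.

Lemma borel_lower_semicontinuous (g : Z -> R) :
  (forall a, open [set z | a < g z]) -> borel g.
Proof.
move=> og; apply: (measurability _ (RGenOInfty.measurableE R)) => _ [_ [a ->] <-].
apply: sub_sigma_algebra; rewrite setTI.
have -> : g @^-1` `]a, +oo[ = [set z | a < g z] by apply/seteqP; split => z /=; rewrite in_itv /= andbT.
exact: og.
Qed.

Lemma open_superlevel (g : Z -> R) a : continuous g -> open [set z | a < g z].
Proof.
move=> cg; rewrite -[X in open X]/(g @^-1` [set r | a < r]).
by apply: open_comp; [move=> z _; exact: cg|exact: open_gt].
Qed.

Lemma borel_continuous (g : Z -> R) : continuous g -> borel g.
Proof. by move=> cg; apply: borel_lower_semicontinuous => a; exact: open_superlevel. Qed.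

(* [Pmax] is a maximum of continuous functions, hence lower semicontinuous. *)
Lemma borel_Pmax : borel (fun z : Z => Pmax Q z.1).
Proof.
apply: borel_lower_semicontinuous => a.
have -> : [set z : Z | a < Pmax Q z.1] = \bigcup_y [set z : Z | a < Jglob Q (z.1, y)].
  apply/seteqP; split => z /=.
    by have [y -> _] := Pmax_attained PL z.1 => h; exists y.
  by case=> y _ /= h; apply: lt_le_trans h (Jglob_le_Pmax PL (z.1, y)).
apply: bigcup_open => y _.
apply: open_superlevel => z.
apply: (continuous_comp (f := fun z : Z => (z.1, y))); last exact: continuous_Jglob.
by apply: continuous_pair => z'; [exact: cvg_fst|exact: cvg_cst].
Qed.

Lemma borel_merit : borel (merit Q).
Proof.
apply: measurable_funD; apply: measurable_funB.
- exact: borel_Pmax.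
- exact: measurable_cst.
- exact: borel_Pmax.
- exact: borel_continuous continuous_Jglob.
Qed.

End BorelRun.

Section BorelMean.
Context {R : realType} {K N b d1 d2 : nat}.
Local Notation Z := ('cV[R]_d1 * 'cV[R]_d2)%type.

Lemma borel_sum (I : Type) (s : seq I) (F : I -> Z -> R) :
  (forall i, borel (F i)) -> borel (fun z => \sum_(i <- s) F i z).
Proof. by move=> bF; exact: measurable_sum. Qed.

Lemma borel_scale (a : R) (F : Z -> R) : borel F -> borel (fun z => a * F z).
Proof. by move=> bF; apply: measurable_funM => //; exact: measurable_cst. Qed.

Lemma borel_run_mean (p : R) i (F : {ffun 'I_K * 'I_b -> 'I_N} -> seq (round K N b) -> Z -> R) :
  (forall f h, borel (F f h)) ->
  borel (fun z => sample_mean (fun f => history_mean p i (fun h => F f h z))).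
Proof.
move=> bF; apply: borel_scale; apply: borel_sum => f; apply: borel_sum => h; exact: borel_scale.
Qed.

End BorelMean.

(** * The bound in expectation over the initial point *)

Section ExpectedBound.
Context {R : realType} {K N b d1 d2 : nat}.
Local Notation Z := ('cV[R]_d1 * 'cV[R]_d2)%type.
Variables (Q : loss R K N d1 d2) (L nu lam p etax etay dx dy : R)
  (W : 'M[R]_K) (Bx : 'M[R]_(K * d1)) (By : 'M[R]_(K * d2))
  (Ux : 'M[R]_(K * d1, K.-1 * d1)) (Uy : 'M[R]_(K * d2, K.-1 * d2))
  (ax : 'rV[R]_(K.-1 * d1)) (ay : 'rV[R]_(K.-1 * d2)).
Let Wx : 'M[R]_(K * d1) := W *t 1%:M.
Let Wy : 'M[R]_(K * d2) := W *t 1%:M.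
Let kappa := L / nu.
Hypotheses (K0 : (0 < K)%N) (N0 : (0 < N)%N) (b0 : (0 < b)%N).
Hypotheses (L0 : 0 < L) (PL : PL_condition Q nu) (sQ : expected_smoothness Q L)
  (nuL : nu <= L).
Hypotheses (WT : W^T = W) (Wr : forall k, \sum_l W k l = 1)
  (BxT : Bx^T = Bx) (BxB : Bx *m Bx = 1%:M - Wx)
  (ByT : By^T = By) (ByB : By *m By = 1%:M - Wy).
Hypotheses
  (UxU : Ux^T *m Ux = 1%:M)
  (cUx : ((const_mx 1 : 'cV[R]_K) *t (1%:M : 'M[R]_d1))^T *m Ux = 0)
  (WUx : Wx *m Ux = Ux *m diag_mx ax) (hax : forall j, 0 <= ax 0 j <= lam)
  (UyU : Uy^T *m Uy = 1%:M)
  (cUy : ((const_mx 1 : 'cV[R]_K) *t (1%:M : 'M[R]_d2))^T *m Uy = 0)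
  (WUy : Wy *m Uy = Uy *m diag_mx ay) (hay : forall j, 0 <= ay 0 j <= lam).
Hypotheses (lam01 : 0 <= lam < 1) (p01 : 0 < p <= 1) (pbK : 1 <= p * b%:R * K%:R)
  (dx0 : 0 < dx) (dy0 : 0 < dy) (etax0 : 0 < etax)
  (etaxy : 32 * (32 * (kappa ^+ 2 * etax)) <= etay)
  (etayL : 10 * (10 * (L * etay)) <= 1)
  (etay3 : (10 * (10 * (L * etay))) ^+ 2 <= (1 - lam) ^+ 3).
Variables (sigma : R) (Dx0 : 'cV[R]_(K * d1)) (Dy0 : 'cV[R]_(K * d2)).
Hypotheses (hsigma : bounded_variance Q sigma) (BDx : Bx *m Dx0 = 0) (BDy : By *m Dy0 = 0).
Context {disp} {Om : measurableType disp} (P : probability Om R).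
Variables (z0 : Om -> Z) (xi : Om -> noise K N b N b).
Hypothesis (law : noise_law P p z0 xi).

Let prm : params R K d1 d2 := {|
  par_p := p; par_beta := 0; eta_x := etax; eta_y := etay; delta_x := dx; delta_y := dy;
  mat_Ax := Wx; mat_Bx := Bx; mat_Cx := 1%:M;
  mat_Ay := Wy; mat_By := By; mat_Cy := 1%:M |}.
Let run (w : Om) (i : nat) := zoma Q prm (z0 w) Dx0 Dy0 (xi w) i.
Let after (z : Z) (f : {ffun 'I_K * 'I_b -> 'I_N}) h := state_after Q p etax etay dx dy W Bx By N0 Dx0 Dy0 z f h.
Let disagree (z : Z) (f : {ffun 'I_K * 'I_b -> 'I_N}) := initial_disagreement Q p etax etay dx dy W Bx By N0 Dx0 Dy0 z f.
Let bias : R := d1%:R * (L ^+ 2 * dx ^+ 2) + d2%:R * (L ^+ 2 * dy ^+ 2).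

Let p01' : 0 <= p <= 1. Proof. by case/andP: p01 => /ltW -> ->. Qed.
Let KR : (0 : R) < K%:R. Proof. by rewrite ltr0n. Qed.
Let iK : (0 : R) <= K%:R^-1. Proof. by rewrite invr_ge0. Qed.
Let mz := measurable_initial law.

Lemma continuous_after f h : continuous_state (fun z => after z f h).
Proof.
elim: h => [|r h IH]; first exact: (continuous_init sQ).
exact: (@continuous_step _ _ _ _ _ _ _ _ sQ prm _ _ (noise_of r.2 (fun=> r)) 0%N IH).
Qed.

Let runE w i : run w i = after (z0 w) (first_of (xi w)) (history_of (xi w) i).
Proof. exact: zoma_history. Qed.

Let expectation_after (G : state R K d1 d2 -> R) i : (forall st, 0 <= G st) ->
  (forall f h, borel (fun z => G (after z f h))) ->
  ('E_P[fun w => G (run w i)]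
  = \int[P]_w (sample_mean (fun f => history_mean p i (fun h => G (after (z0 w) f h))))%:E)%E.
Proof.
move=> G0 bG; rewrite unlock.
rewrite -(expectation_run N0 p01' law i (F := fun f h z => G (after z f h))) //.
by apply: eq_integral => w _; rewrite runE.
Qed.

Let mean_after_ge0 (G : state R K d1 d2 -> R) i z : (forall st, 0 <= G st) ->
  0 <= sample_mean (fun f => history_mean p i (fun h => G (after z f h))).
Proof.
move=> G0; rewrite -[leLHS](@sample_mean_cst R ('I_K * 'I_b)%type N N0 0); apply: le_sample_mean => f.
by rewrite -[leLHS](@history_mean_cst R K N b p N0 i 0); apply: le_history_mean.
Qed.

Let measurable_after (G : state R K d1 d2 -> R) i :
  (forall f h, borel (fun z => G (after z f h))) ->
  measurable_fun setT (fun w =>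
    (sample_mean (fun f => history_mean p i (fun h => G (after (z0 w) f h))))%:E).
Proof. by move=> bG; exact: (measurable_source mz (borel_run_mean p i bG)). Qed.

Let Delta0E : Delta0 P Q run = (\int[P]_w (merit Q (z0 w))%:E)%E.
Proof.
rewrite /Delta0 unlock; apply: eq_integral => w _; rewrite /merit.
have e : centroid (run w 0) = z0 w by rewrite runE; exact: centroid_init.
by rewrite e.
Qed.

Let bgx f h : borel (fun z => sqnorm (grad_x (Jglob Q) (centroid (after z f h)))).
Proof.
apply: borel_continuous; apply: continuous_sqnorm.
move=> z; apply: continuous_comp; last exact: (continuous_grad_x sQ).
exact: (continuous_centroid (continuous_after f h)).
Qed.

Let bgy f h : borel (fun z => sqnorm (grad_y (Jglob Q) (centroid (after z f h)))).
Proof.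
apply: borel_continuous; apply: continuous_sqnorm.
move=> z; apply: continuous_comp; last exact: (continuous_grad_y sQ).
exact: (continuous_centroid (continuous_after f h)).
Qed.

Let bdx f h : borel (fun z => sqnorm ((Wx - averaging R K d1) *m st_gx (after z f h))).
Proof.
apply: borel_continuous; apply: continuous_sqnorm.
exact: (continuous_mulmx (continuous_st_gx (continuous_after f h))).
Qed.

Let bdy f h : borel (fun z => sqnorm ((Wy - averaging R K d2) *m st_gy (after z f h))).
Proof.
apply: borel_continuous; apply: continuous_sqnorm.
exact: (continuous_mulmx (continuous_st_gy (continuous_after f h))).
Qed.

Let zeta0E : zeta0_sq P prm run = (\int[P]_w (sample_mean (disagree (z0 w)))%:E)%E.
Proof.
have G0x (st : state R K d1 d2) : 0 <= sqnorm ((Wx - averaging R K d1) *m st_gx st) by exact: sqnorm_ge0.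
have G0y (st : state R K d1 d2) : 0 <= sqnorm ((Wy - averaging R K d2) *m st_gy st) by exact: sqnorm_ge0.
have px w := mean_after_ge0 0 (z0 w) G0x; have py w := mean_after_ge0 0 (z0 w) G0y.
rewrite /zeta0_sq /= (expectation_after 0 G0x bdx) (expectation_after 0 G0y bdy).
have hx := measurable_after (G := fun st => sqnorm (_ *m st_gx st)) 0 bdx.
have hy := measurable_after (G := fun st => sqnorm (_ *m st_gy st)) 0 bdy.
rewrite -ge0_integralZl_EFin //; last by move=> w _; rewrite lee_fin.
rewrite -[X in (_ + X)%E]ge0_integralZl_EFin //; last by move=> w _; rewrite lee_fin.
rewrite -ge0_integralD //; first last.
- exact: measurable_funeM.
- by move=> w _; rewrite -EFinM lee_fin; exact: mulr_ge0.
- exact: measurable_funeM.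
- by move=> w _; rewrite -EFinM lee_fin; exact: mulr_ge0.
apply: eq_integral => w _; rewrite -!EFinM -EFinD; congr EFin.
rewrite -!sample_meanZ -sample_meanD; apply: eq_sample_mean => f.
by rewrite !history_mean0.
Qed.

(** [run_bound] holds for each fixed initial point and is integrated here. All terms are nonnegative
    and measurable, so the integral is additive even if [Delta0] or [zeta0_sq] is infinite. *)
Lemma expected_run_bound T : (0 < T)%N ->
  (avg_sqgrad P Q run T <= (4 / etax / T%:R)%:E * Delta0 P Q run
   + (4 / etax * (etay * (1 - lam)) / T%:R)%:E * zeta0_sq P prm run
   + (4 / etax * etay * (9 * bias + 8 * sigma ^+ 2 + lam ^+ 2 * (b%:R^-1 * sigma ^+ 2)) / T%:R
      + 80 / etax * (etay * bias))%:E)%E.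
Proof.
move=> T0.
have TR : (0 : R) < T%:R by rewrite ltr0n.
have /andP[l0 l1] := lam01.
have ey0 : 0 < etay by apply: lt_le_trans (etax_le PL nuL etax0 etaxy); rewrite !mulr_gt0.
pose G z i := sample_mean (fun f => history_mean p i (fun h => sqgrad Q (centroid (after z f h)))).
have G0 z i : 0 <= G z i.
  apply: (mean_after_ge0 (G := fun st => sqgrad Q (centroid st))) => st.
  by apply: addr_ge0; exact: sqnorm_ge0.
have bG i : borel (G^~ i).
  apply: borel_run_mean => f h; apply: measurable_funD; [exact: bgx|exact: bgy].
have mG i : measurable_fun setT (fun w => (G (z0 w) i)%:E).
  exact: (measurable_source mz (bG i)).
have sumE : (\sum_(i < T)
     ('E_P[fun w => sqnorm (grad_x (Jglob Q) (centroid (run w i)))]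
      + 'E_P[fun w => sqnorm (grad_y (Jglob Q) (centroid (run w i)))])
   = \int[P]_w (\sum_(i < T) G (z0 w) i)%:E)%E.
  transitivity (\sum_(i < T) \int[P]_w (G (z0 w) i)%:E)%E; last first.
    rewrite -ge0_integral_sum //; last by move=> i w _; rewrite lee_fin.
    by apply: eq_integral => w _; rewrite sumEFin.
  apply: eq_bigr => i _.
  have Gx0 (st : state R K d1 d2) : 0 <= sqnorm (grad_x (Jglob Q) (centroid st)) by exact: sqnorm_ge0.
  have Gy0 (st : state R K d1 d2) : 0 <= sqnorm (grad_y (Jglob Q) (centroid st)) by exact: sqnorm_ge0.
  rewrite (expectation_after i Gx0 bgx) (expectation_after i Gy0 bgy) -ge0_integralD //; first last.
  - exact: (measurable_after (G := fun st => sqnorm (grad_y _ (centroid st))) i bgy).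
  - by move=> w _; rewrite lee_fin; exact: (mean_after_ge0 i (z0 w) Gy0).
  - exact: (measurable_after (G := fun st => sqnorm (grad_x _ (centroid st))) i bgx).
  - by move=> w _; rewrite lee_fin; exact: (mean_after_ge0 i (z0 w) Gx0).
  apply: eq_integral => w _; rewrite -EFinD; congr EFin.
  rewrite -sample_meanD; apply: eq_sample_mean => f.
  by rewrite -history_meanD.
have Tinv : 0 <= T%:R^-1 :> R by rewrite invr_ge0 ltW.
have e0 : 0 <= 4 / etax by rewrite divr_ge0 // ltW.
have s0 : 0 <= sigma ^+ 2 by exact: sqr_ge0.
have bias0 : 0 <= bias.
  by apply: addr_ge0; apply: mulr_ge0 => //; apply: mulr_ge0; exact: sqr_ge0.
have A0 : 0 <= 9 * bias + 8 * sigma ^+ 2 + lam ^+ 2 * (b%:R^-1 * sigma ^+ 2).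
  apply: addr_ge0; first by apply: addr_ge0; apply: mulr_ge0.
  by apply: mulr_ge0; [exact: sqr_ge0|apply: mulr_ge0 => //; rewrite invr_ge0].
have cM : 0 <= 4 / etax / T%:R by apply: mulr_ge0.
have cS : 0 <= 4 / etax * (etay * (1 - lam)) / T%:R.
  by apply: mulr_ge0 => //; apply: mulr_ge0 => //; apply: mulr_ge0; [exact: ltW|rewrite subr_ge0 ltW].
have cC : 0 <= 4 / etax * etay * (9 * bias + 8 * sigma ^+ 2 + lam ^+ 2 * (b%:R^-1 * sigma ^+ 2)) / T%:R
      + 80 / etax * (etay * bias).
  apply: addr_ge0; last first.
    by apply: mulr_ge0; [rewrite divr_ge0 // ltW|apply: mulr_ge0 => //; exact: ltW].
  by apply: mulr_ge0 => //; apply: mulr_ge0 => //; apply: mulr_ge0 => //; exact: ltW.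
have mM : measurable_fun setT (fun w => (merit Q (z0 w))%:E).
  exact: (measurable_source mz (borel_merit sQ PL)).
have mS : measurable_fun setT (fun w => (sample_mean (disagree (z0 w)))%:E).
  apply: (measurable_source mz (g := fun z => sample_mean (disagree z))).
  apply: borel_scale; apply: borel_sum => f; apply: measurable_funD; apply: borel_scale.
    exact: (bdx f [::]).
  exact: (bdy f [::]).
have S0 z : 0 <= sample_mean (disagree z).
  rewrite -[leLHS](@sample_mean_cst R ('I_K * 'I_b)%type N N0 0); apply: le_sample_mean => f.
  exact: initial_disagreement_ge0.
have M0 := merit_ge0 PL.
rewrite /avg_sqgrad sumE Delta0E zeta0E -ge0_integralZl_EFin //; first last.
- by apply: (measurable_source mz (g := fun z => \sum_(i < T) G z i)); exact: borel_sum.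
- by move=> w _; rewrite lee_fin; apply: sumr_ge0.
rewrite -ge0_integralZl_EFin //; last by move=> w _; rewrite lee_fin.
rewrite -[X in (_ + X + _)%E]ge0_integralZl_EFin //; last by move=> w _; rewrite lee_fin.
rewrite -ge0_integralD //; first last.
- exact: measurable_funeM.
- by move=> w _; rewrite -EFinM lee_fin; exact: mulr_ge0.
- exact: measurable_funeM.
- by move=> w _; rewrite -EFinM lee_fin; exact: mulr_ge0.
set c := (X in (_ + X%:E)%E).
have -> : c%:E = (\int[P]_w (cst c%:E) w)%E.
  by rewrite integral_cst // [X in (_ * X)%E]probability_setT mule1.
rewrite -ge0_integralD //; first last.
- by apply: emeasurable_funD; exact: measurable_funeM.
- by move=> w _; rewrite -!EFinM -EFinD lee_fin; apply: addr_ge0; exact: mulr_ge0.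
apply: ge0_le_integral => //.
- by move=> w _; rewrite -EFinM lee_fin; apply: mulr_ge0 => //; apply: sumr_ge0.
- apply: measurable_funeM.
  by apply: (measurable_source mz (g := fun z => \sum_(i < T) G z i)); exact: borel_sum.
- by apply: emeasurable_funD => //; apply: emeasurable_funD; exact: measurable_funeM.
move=> w _; rewrite -!EFinM -!EFinD lee_fin.
have := run_bound K0 N0 b0 L0 PL sQ nuL WT Wr BxT BxB ByT ByB UxU cUx WUx hax UyU cUy WUy hay
  lam01 p01 pbK dx0 dy0 etax0 etaxy etayL etay3 hsigma BDx BDy (z0 w) T.
rewrite -/(G (z0 w) _) => /(ler_wpM2l Tinv) h; apply: le_trans h _.
rewrite -/bias /c le_eqVlt; apply/orP; left; apply/eqP.
rewrite -[sample_mean (disagree (z0 w))]/(sample_mean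
  (initial_disagreement Q p etax etay dx dy W Bx By N0 Dx0 Dy0 (z0 w))).
move: (sample_mean _) (merit Q _) (bias) (b%:R^-1 * _) => S M B t.
by field; rewrite !gt_eqF.
Qed.

End ExpectedBound.

(** * Step sizes and complexity *)

(** If [D] or [Z] is infinite, the positive factors [C], [A], [B] make the right side infinite too;
    otherwise this is real arithmetic. The [1] added to [D] leaves room for the [A] in the bound on
    [c]. *)
Lemma lee_affine {R : realType} (D Z : \bar R) (a a' c C A B e1 e2 : R) :
  (0 <= D)%E -> (0 <= Z)%E -> 0 < C -> 0 < A -> 0 < B -> 0 <= e1 -> 0 <= e2 ->
  a <= C * A -> a' <= C * B -> c <= C * (A + e1 + e2) ->
  (a%:E * D + a'%:E * Z + c%:E <= C%:E * (A%:E * (D + 1) + B%:E * Z + e1%:E + e2%:E))%E.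
Proof.
move=> D0 Z0 C0 A0 B0 e10 e20 ha ha' hc.
have AE : (0 < A%:E)%E by rewrite lte_fin.
have BE : (0 < B%:E)%E by rewrite lte_fin.
have CE : (0 < C%:E)%E by rewrite lte_fin.
case: D D0 => [d d0|_|] //; last first.
  rewrite -[(+oo + 1)%E]/(+oo%E : \bar R).
  rewrite (gt0_muley AE) [X in (_ <= C%:E * X)%E](_ : _ = +oo%E) ?(gt0_muley CE) ?leey //.
  by case: Z Z0 => [z z0|_|] //; rewrite ?(gt0_muley BE).
case: Z Z0 => [z z0|_|] //; last first.
  by rewrite (gt0_muley BE) [X in (_ <= C%:E * X)%E](_ : _ = +oo%E) ?(gt0_muley CE) ?leey //.
move: d0 z0; rewrite !lee_fin => d0 z0.
have h1 := ler_wpM2r d0 ha; have h2 := ler_wpM2r z0 ha'.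
have -> : C * (A * (d + 1) + B * z + e1 + e2) = C * A * d + C * B * z + C * (A + e1 + e2) by ring.
by rewrite !lerD.
Qed.

Section RateExponents.
Context {R : realType}.
Implicit Types (s r L kappa lam sigma : R) (K N b d T : nat).

Lemma powR32 s : 0 < s -> (s `^ (3 / 2)) ^+ 2 = s ^+ 3.
Proof.
move=> s0; rewrite -powR_mulrn ?powR_ge0 // -powRrM -powR_mulrn ?(ltW s0) //.
by congr (_ `^ _); field.
Qed.

Lemma powR34 s : 0 < s -> (s `^ (3 / 4)) ^+ 2 = s `^ (3 / 2).
Proof.
move=> s0; rewrite -powR_mulrn ?powR_ge0 // -powRrM.
by congr (_ `^ _); field.
Qed.

Lemma powR32_le1 s : 0 < s -> s <= 1 -> s `^ (3 / 2) <= 1.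
Proof.
move=> s0 s1; rewrite -(@expr_le1 _ 2) ?powR_ge0 // powR32 //.
by rewrite expr_le1 // ltW.
Qed.

Lemma batch_size K N b : (0 < K)%N -> (0 < N)%N ->
  Posz b = Num.ceil (Num.sqrt (N%:R / K%:R : R)) ->
  Num.sqrt (N%:R / K%:R : R) <= b%:R < Num.sqrt (N%:R / K%:R : R) + 1.
Proof.
move=> K0 N0 bE; have := ceil_itv (Num.sqrt (N%:R / K%:R : R)).
by rewrite -bE intrB /= -!pmulrn => /andP[h1 h2]; rewrite h2 -ltrBlDr.
Qed.

(** The radius cancels the dimension and makes the bias of order [1 / ((1 - lam)^(3/2) T)]. This is
    the origin of the [+ 1] beside [Delta0] in the rate. *)
Lemma perturbation_bias d L s T : (0 < d)%N -> (0 < T)%N -> 0 < s ->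
  d%:R * (L ^+ 2 * (1 / (Num.sqrt d%:R * s `^ (3 / 4) * Num.sqrt T%:R)) ^+ 2)
  = L ^+ 2 / (s `^ (3 / 2) * T%:R).
Proof.
move=> d0 T0 s0.
have dR : (0 : R) < d%:R by rewrite ltr0n.
have TR : (0 : R) < T%:R by rewrite ltr0n.
have r0 := powR_gt0 (3 / 2) s0.
rewrite expr_div_n !exprMn !sqr_sqrtr ?(ltW dR) ?(ltW TR) // powR34 //.
by field; rewrite !gt_eqF.
Qed.

End RateExponents.

Section RateConstant.
Context {R : realType}.
Variable L : R.
Hypothesis L0 : 0 < L.

(** With this rate [100 L etay] equals [(1 - lam)^(3/2)], so the step-size condition of the network
    holds with equality. *)
Definition ascent_rate : R := (10 * (10 * L))^-1.
Definition descent_rate : R := ascent_rate / (32 * 32).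
(** The first summand serves [Delta0]. In the second, [64 * 64 * kappa^2] is [4 etay / etax], the
    [8] belongs to [8 sigma^2], and [64 L^2] covers the bias, which contributes
    [2 (9 + 20) = 58]. *)
Definition rate_constant : R := 4 / descent_rate + 64 * 64 * (8 + 64 * L ^+ 2).

Lemma ascent_rate_gt0 : 0 < ascent_rate.
Proof. by rewrite invr_gt0 !mulr_gt0. Qed.

Lemma descent_rate_gt0 : 0 < descent_rate.
Proof. by rewrite divr_gt0 ?ascent_rate_gt0 ?mulr_gt0. Qed.

Lemma rate_constant_gt0 : 0 < rate_constant.
Proof.
apply: addr_gt0; first by rewrite divr_gt0 ?descent_rate_gt0.
apply: mulr_gt0; first exact: mulr_gt0.
by apply: addr_gt0 => //; apply: mulr_gt0 => //; exact: exprn_gt0.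
Qed.

Lemma rate_arith (kappa r T bias lam v rho sigma etax etay : R) :
  etax = descent_rate * (r / kappa ^+ 2) -> etay = ascent_rate * r ->
  0 < kappa -> 0 < r -> 1 <= T -> bias = L ^+ 2 / (r * T) + L ^+ 2 / (r * T) ->
  0 <= v <= rho ->
  4 / etax * etay * (9 * bias + 8 * sigma ^+ 2 + lam ^+ 2 * (v * sigma ^+ 2)) / T
    + 80 / etax * (etay * bias)
  <= rate_constant * (kappa ^+ 2 / (r * T) + kappa ^+ 2 * lam ^+ 2 * rho * sigma ^+ 2 / T
      + kappa ^+ 2 * sigma ^+ 2 / T).
Proof.
move=> exE eyE k0 r0 T1 biasE /andP[v0 vrho].
have T0 : 0 < T by apply: lt_le_trans T1.
have a0 := ascent_rate_gt0.
have me : 4 / etax * etay = 64 * 64 * kappa ^+ 2.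
  by rewrite exE eyE /descent_rate; field; rewrite !gt_eqF.
have me' : 80 / etax * (etay * bias) = 20 * (64 * 64 * kappa ^+ 2) * bias.
  by rewrite -me; field; rewrite exE gt_eqF // mulr_gt0 ?descent_rate_gt0 // divr_gt0 // exprn_gt0.
rewrite me me'.
have k2 : 0 < kappa ^+ 2 by rewrite exprn_gt0.
pose A := kappa ^+ 2 / (r * T).
have A0 : 0 < A by rewrite divr_gt0 ?mulr_gt0.
pose E1 := kappa ^+ 2 * lam ^+ 2 * rho * sigma ^+ 2 / T.
pose E2 := kappa ^+ 2 * sigma ^+ 2 / T.
have E20 : 0 <= E2 by rewrite divr_ge0 ?(ltW T0) // mulr_ge0 ?sqr_ge0 ?(ltW k2).
have LA : 0 <= L ^+ 2 * A by rewrite mulr_ge0 ?sqr_ge0 ?(ltW A0).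
have bT : bias / T <= bias.
  rewrite ler_pdivrMr // ler_peMr // biasE -mulr2n mulrn_wge0 // divr_ge0 ?sqr_ge0 //.
  by rewrite mulr_ge0 ?ltW.
have kb : kappa ^+ 2 * bias = 2 * (L ^+ 2 * A).
  by rewrite biasE /A; field; rewrite !gt_eqF.
have kbT : kappa ^+ 2 * (bias / T) <= 2 * (L ^+ 2 * A) by rewrite -kb ler_wpM2l // ltW.
have E1v : kappa ^+ 2 * lam ^+ 2 * v * sigma ^+ 2 / T <= E1.
  rewrite ler_wpM2r ?invr_ge0 ?(ltW T0) // ler_wpM2r ?sqr_ge0 // ler_wpM2l //.
  by rewrite mulr_ge0 ?sqr_ge0 ?(ltW k2).
have E1v0 : 0 <= kappa ^+ 2 * lam ^+ 2 * v * sigma ^+ 2 / T.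
  by rewrite divr_ge0 ?(ltW T0) // mulr_ge0 ?sqr_ge0 // mulr_ge0 // mulr_ge0 ?sqr_ge0.
have E10 : 0 <= E1 by apply: le_trans E1v.
rewrite -/A -/E1 -/E2 /rate_constant [leRHS]mulrDl -[leLHS]add0r; apply: lerD.
  apply: mulr_ge0; first by rewrite divr_ge0 ?(ltW descent_rate_gt0).
  by rewrite !addr_ge0 // ltW.
rewrite -[leRHS]mulrA.
have -> : 64 * 64 * kappa ^+ 2 * (9 * bias + 8 * sigma ^+ 2 + lam ^+ 2 * (v * sigma ^+ 2)) / T
    + 20 * (64 * 64 * kappa ^+ 2) * bias
  = 64 * 64 * (9 * (kappa ^+ 2 * (bias / T)) + 8 * E2
      + kappa ^+ 2 * lam ^+ 2 * v * sigma ^+ 2 / T + 20 * (kappa ^+ 2 * bias)).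
  by rewrite /E2; field; rewrite gt_eqF.
apply: ler_wpM2l; first by rewrite mulr_ge0.
have -> : (8 + 64 * L ^+ 2) * (A + E1 + E2)
  = 8 * A + 8 * E1 + 8 * E2 + 64 * (L ^+ 2 * A) + 64 * (L ^+ 2 * (E1 + E2)) by ring.
have LE : 0 <= L ^+ 2 * (E1 + E2) by rewrite mulr_ge0 ?sqr_ge0 // addr_ge0.
rewrite kb; move: (kappa ^+ 2 * (bias / T)) kbT E1v E10 E20 LA LE (ltW A0).
move: (kappa ^+ 2 * lam ^+ 2 * v * sigma ^+ 2 / T) (L ^+ 2 * A) (L ^+ 2 * (E1 + E2)).
move: A E1 E2 {A0 bT kb E1v0} => a e1 e2; move=> *; lra.
Qed.

End RateConstant.

(** * Communication and query complexity *)

Section Complexity.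
Context {R : realType}.

Lemma communication_complexity_le (avg : nat -> \bar R) (M e : R) : 1 <= M / e ^+ 2 -> 0 < e ->
  (forall T, (0 < T)%N -> (avg T <= (M / T%:R)%:E)%E) ->
  exists2 CC, communication_complexity avg e CC & CC%:R <= 2 * (M / e ^+ 2).
Proof.
move=> hX e0 bound; set X := M / e ^+ 2 in hX *.
have X0 : 0 <= X by apply: le_trans hX.
have e2 : 0 < e ^+ 2 by rewrite exprn_gt0.
(* The first integer above [X] meets the accuracy, and [1 <= X] turns the bound [X + 1] into
   [2 X]. *)
pose T1 := (Num.trunc X).+1.
have T1X : X < T1%:R by exact: truncnS_gt.
have T1R : (0 : R) < T1%:R by rewrite ltr0n.
have T1P : (0 < T1)%N && `[< (avg T1 <= (e ^+ 2)%:E)%E >].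
  apply/andP; split => //; apply/asboolP; apply: le_trans (bound _ _) _ => //.
  rewrite lee_fin ler_pdivrMr // mulrC -ler_pdivrMr //; exact: ltW.
have exT : exists T, (0 < T)%N && `[< (avg T <= (e ^+ 2)%:E)%E >] by exists T1.
exists (ex_minn exT).
  case: ex_minnP => T /andP[T0 /asboolP hT] min; split => // T' /andP[T'0 T'T] hT'.
  have := min T'; rewrite T'0 /= => /(_ (introT (asboolP _) hT')).
  by rewrite leqNgt T'T.
case: ex_minnP => T _ /(_ T1 T1P) TT1.
apply: (@le_trans _ _ (T1%:R)); first by rewrite ler_nat.
have /andP[h _] := truncn_itv X0.
rewrite /T1 -natr1; move: h hX; move: (_%:R) => t; lra.
Qed.

(** Since [p N = sqrt (N / K)], the full batches cost per round on average as much as small ones.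
    [K <= N] makes this number at least 1, so rounding up the batch size costs at most a factor
    2. *)
Lemma function_queries_le (CC b N K d1 d2 : nat) (Y : R) : (0 < K)%N -> (K <= N)%N ->
  b%:R <= Num.sqrt (N%:R / K%:R : R) + 1 -> CC%:R <= Y ->
  function_queries CC (Num.sqrt (N%:R * K%:R))^-1 b N b d1 d2
  <= 10 * ((d1 + d2)%:R * (Y * Num.sqrt (N%:R / K%:R))) + 4 * ((d1 + d2)%:R * Num.sqrt (N%:R / K%:R)).
Proof.
move=> K0 KN hb hY; rewrite /function_queries.
have KR : (0 : R) < K%:R by rewrite ltr0n.
have NR : (0 : R) < N%:R by rewrite ltr0n (leq_trans K0).
set rho := Num.sqrt (N%:R / K%:R) in hb *; set d : R := (d1 + d2)%:R.
have d0 : 0 <= d by [].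
have rho1 : 1 <= rho.
  by rewrite -sqrtr1 ler_sqrt ?divr_gt0 // ler_pdivlMr // mul1r ler_nat.
have pN : (Num.sqrt (N%:R * K%:R))^-1 * N%:R = rho.
  have e : N%:R = Num.sqrt N%:R * Num.sqrt N%:R :> R by rewrite -expr2 sqr_sqrtr ?ltW.
  rewrite /rho sqrtrM ?(ltW NR) // sqrtrM ?(ltW NR) // sqrtrV ?(ltW KR) // [X in _ * X]e.
  by field; rewrite !gt_eqF ?sqrtr_gt0.
have b2 : b%:R <= 2 * rho by apply: le_trans hb _; rewrite mulr2n mulrDl mul1r lerD2l.
set p := (Num.sqrt _)^-1 in pN *.
have p0 : 0 <= p by rewrite invr_ge0 sqrtr_ge0.
have C0 : (0 : R) <= CC%:R by [].
have Cr : CC%:R * rho <= Y * rho by rewrite ler_wpM2r // (le_trans ler01).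
have t1 : CC%:R * (1 - p) * b%:R <= 2 * (Y * rho).
  apply: (@le_trans _ _ (CC%:R * b%:R)).
    by rewrite ler_wpM2r // ler_piMr // lerBlDr lerDl.
  apply: (@le_trans _ _ (CC%:R * (2 * rho))); first by rewrite ler_wpM2l.
  by rewrite mulrCA ler_wpM2l.
rewrite -[CC%:R * p * N%:R]mulrA pN.
have h1 : (CC%:R * rho + b%:R) * (2 * d) <= (Y * rho + 2 * rho) * (2 * d).
  by rewrite ler_wpM2r ?mulr_ge0 // lerD.
have h2 : CC%:R * (1 - p) * b%:R * (4 * d) <= 2 * (Y * rho) * (4 * d).
  by rewrite ler_wpM2r ?mulr_ge0.
apply: le_trans (lerD h1 h2) _.
by rewrite le_eqVlt; apply/orP; left; apply/eqP; ring.
Qed.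

End Complexity.

Unset Implicit Arguments.
Set Strict Implicit.
Set Printing Implicit Defensive.

Theorem corollary3 (R : realType) (Lf q : R) (hLf : 0 < Lf) (hq : 0 < q) :
  exists (cx cy cdx cdy C : R) (Ceps : R -> R -> R -> R),
    [/\ 0 < cx, 0 < cy, 0 < cdx, 0 < cdy & 0 < C] /\
  forall (K N d1 d2 : nat) (Q : loss R K N d1 d2) (nu sigma : R)
    (W : 'M[R]_K) (lam : R)
    (Bx : 'M[R]_(K * d1)) (By : 'M[R]_(K * d2))
    (disp : measure_display) (Om : measurableType disp) (P : probability Om R)
    (b : nat) (z0 : Om -> 'cV[R]_d1 * 'cV[R]_d2) (xi : Om -> noise K N b N b)
    (Dx0 : 'cV[R]_(K * d1)) (Dy0 : 'cV[R]_(K * d2)),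
  (2 <= K)%N -> (0 < N)%N -> (0 < d1)%N -> (0 < d2)%N ->
  PL_condition Q nu -> expected_smoothness Q Lf -> nu <= Lf ->
  0 <= sigma -> bounded_variance Q sigma ->
  network_matrix W -> psd W -> second_eigenvalue W lam ->
  let Wx : 'M[R]_(K * d1) := W *t 1%:M in
  let Wy : 'M[R]_(K * d2) := W *t 1%:M in
  is_sqrtmx Bx (1%:M - Wx) -> is_sqrtmx By (1%:M - Wy) ->
  factorization_bound q Wx Bx 1%:M -> factorization_bound q Wy By 1%:M ->
  Posz b = Num.ceil (Num.sqrt (N%:R / K%:R : R)) ->
  let p : R := (Num.sqrt (N%:R * K%:R))^-1 in
  noise_law P p z0 xi ->
  Bx *m Dx0 = 0 -> By *m Dy0 = 0 ->
  let kappa := Lf / nu in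
  let prm (T : nat) : params R K d1 d2 := {|
    par_p := p;
    par_beta := 0;
    eta_x := cx * ((1 - lam) `^ (3 / 2) / kappa ^+ 2);
    eta_y := cy * (1 - lam) `^ (3 / 2);
    delta_x := cdx / (Num.sqrt d1%:R * (1 - lam) `^ (3 / 4) * Num.sqrt T%:R);
    delta_y := cdy / (Num.sqrt d2%:R * (1 - lam) `^ (3 / 4) * Num.sqrt T%:R);
    mat_Ax := Wx; mat_Bx := Bx; mat_Cx := 1%:M;
    mat_Ay := Wy; mat_By := By; mat_Cy := 1%:M |} in
  let run (T : nat) (w : Om) (i : nat) := zoma Q (prm T) (z0 w) Dx0 Dy0 (xi w) i in
  (forall T : nat, (0 < T)%N ->
    (avg_sqgrad P Q (run T) T <=
     C%:E * ((kappa ^+ 2 / ((1 - lam) `^ (3 / 2) * T%:R))%:E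
               * (Delta0 P Q (run T) + 1)
             + (kappa ^+ 2 * (1 - lam) / T%:R)%:E * zeta0_sq P (prm T) (run T)
             + (kappa ^+ 2 * lam ^+ 2 * Num.sqrt K%:R * sigma ^+ 2
                  / (Num.sqrt N%:R * T%:R))%:E
             + (kappa ^+ 2 * sigma ^+ 2 / T%:R)%:E))%E) /\
  ((K <= N)%N -> forall D Z : R,
    (forall T : nat, (0 < T)%N ->
       (Delta0 P Q (run T) <= D%:E)%E /\ (zeta0_sq P (prm T) (run T) <= Z%:E)%E) ->
    forall eps : R, 0 < eps <= 1 ->
    exists CC : nat,
      [/\ communication_complexity (fun T => avg_sqgrad P Q (run T) T) eps CC,
          CC%:R <= Ceps sigma D Z *
            (kappa ^+ 2 * eps ^- 2 / (1 - lam) `^ (3 / 2) + kappa ^+ 2 * eps ^- 2)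
        & function_queries CC p b N b d1 d2 <= Ceps sigma D Z *
            ((d1 + d2)%:R * kappa ^+ 2 * Num.sqrt N%:R * eps ^- 2
               / (Num.sqrt K%:R * (1 - lam) `^ (3 / 2))
             + (d1 + d2)%:R * Num.sqrt (N%:R / K%:R))]).
Proof.
have a0 := ascent_rate_gt0 hLf; have e0 := descent_rate_gt0 hLf.
have C0 := rate_constant_gt0 hLf; set C := rate_constant Lf in C0.
(* In the complexity constant the factor 2 comes from rounding up the number of rounds and 10 from
   counting queries; the absolute values allow bounds [D] and [Z] of any sign, and the inner [+ 1]
   keeps the predicted number of rounds at least 1. *)
exists (descent_rate Lf), (ascent_rate Lf), 1, 1, C,
  (fun sigma D Z => 10 * (2 * (C * (`|D| + 1 + `|Z| + 2 * sigma ^+ 2) + 1))).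
split=> // K N d1 d2 Q nu sigma W lam Bx By disp Om P b z0 xi Dx0 Dy0 K2 N0 d10 d20 PL sQ nuL
  sigma0 hsigma hW pW hlam Wx Wy sBx sBy facx facy bE p law BDx BDy kappa prm run.
have K0 : (0 < K)%N by apply: leq_trans K2.
have KR : (0 : R) < K%:R by rewrite ltr0n.
have NR : (0 : R) < N%:R by rewrite ltr0n.
have [lam01 _] := second_eigenvalue_bounds K2 hW pW hlam.
have /andP[l0 l1] := lam01.
have s0 : 0 < 1 - lam by rewrite subr_gt0.
have s1 : 1 - lam <= 1 by rewrite lerBlDr lerDl.
set r : R := (1 - lam) `^ (3 / 2).
have r0 : 0 < r by exact: powR_gt0.
have r1 : r <= 1 by exact: powR32_le1.
have nu0 : 0 < nu by case: PL.
have k1 : 1 <= kappa := kappa_ge1 PL nuL.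
have k0 : 0 < kappa by apply: lt_le_trans k1.
have [[BxT _] BxB] := sBx; have [[ByT _] ByB] := sBy.
have [Ux [ax [_ [_ [_ [_ [[UxU cUx WUx _ _] _ _ _]]]]]]] := facx.
have [Uy [ay [_ [_ [_ [_ [[UyU cUy WUy _ _] _ _ _]]]]]]] := facy.
have hax := complement_eigenvalues K2 hW pW hlam UxU cUx WUx.
have hay := complement_eigenvalues K2 hW pW hlam UyU cUy WUy.
have [WT _ Wr _ _] := hW.
have rho0 : 0 < Num.sqrt (N%:R / K%:R : R) by rewrite sqrtr_gt0 divr_gt0.
have /andP[b_ge b_lt] := batch_size K0 N0 bE.
have bR : (0 : R) < b%:R by apply: lt_le_trans b_ge.
have b0 : (0 < b)%N by rewrite -(ltr0n R).
have rhoE : Num.sqrt (N%:R / K%:R) = Num.sqrt N%:R / Num.sqrt K%:R :> R.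
  by rewrite sqrtrM ?ler0n // sqrtrV ?ler0n.
have sN : 0 < Num.sqrt N%:R :> R by rewrite sqrtr_gt0.
have sK : 0 < Num.sqrt K%:R :> R by rewrite sqrtr_gt0.
have pE : p = (Num.sqrt N%:R * Num.sqrt K%:R)^-1 by rewrite /p sqrtrM ?ler0n.
have p01 : 0 < p <= 1.
  rewrite invr_gt0 sqrtr_gt0 mulr_gt0 // invf_le1 ?sqrtr_gt0 ?mulr_gt0 //.
  have : Num.sqrt 1 <= Num.sqrt (N%:R * K%:R) :> R.
    by rewrite ler_sqrt ?mulr_gt0 // -natrM ler1n muln_gt0 N0.
  by rewrite sqrtr1.
(* Equality holds for the unrounded batch size [sqrt (N / K)], and the ceiling only helps. *)
have pbK : 1 <= p * b%:R * K%:R.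
  have KE : K%:R = Num.sqrt K%:R * Num.sqrt K%:R :> R by rewrite -expr2 sqr_sqrtr ?ler0n.
  apply: (@le_trans _ _ (p * Num.sqrt (N%:R / K%:R) * K%:R)).
    by rewrite pE rhoE [X in _ * X]KE le_eqVlt; apply/orP; left; apply/eqP; field; rewrite !gt_eqF.
  by rewrite ler_wpM2r // ler_wpM2l // ltW //; case/andP: p01.
have binv : 0 <= (b%:R^-1 : R) <= Num.sqrt K%:R / Num.sqrt N%:R.
  rewrite invr_ge0 ler0n /= -[leRHS]invrK lef_pV2 ?posrE ?invr_gt0 ?divr_gt0 //.
  by rewrite invf_div -rhoE.
pose etax := descent_rate Lf * (r / kappa ^+ 2).
pose etay := ascent_rate Lf * r.
have etax0 : 0 < etax by rewrite mulr_gt0 // divr_gt0 // exprn_gt0.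
have aL : 10 * (10 * (Lf * etay)) = r by rewrite /etay /ascent_rate; field; rewrite gt_eqF.
have etaxy : 32 * (32 * (kappa ^+ 2 * etax)) <= etay.
  by rewrite le_eqVlt; apply/orP; left; apply/eqP; rewrite /etax /etay /descent_rate; field; rewrite gt_eqF.
have etayL : 10 * (10 * (Lf * etay)) <= 1 by rewrite aL.
have etay3 : (10 * (10 * (Lf * etay))) ^+ 2 <= (1 - lam) ^+ 3 by rewrite aL powR32.
have main T : (0 < T)%N -> (avg_sqgrad P Q (run T) T <=
     C%:E * ((kappa ^+ 2 / (r * T%:R))%:E * (Delta0 P Q (run T) + 1)
             + (kappa ^+ 2 * (1 - lam) / T%:R)%:E * zeta0_sq P (prm T) (run T)
             + (kappa ^+ 2 * lam ^+ 2 * Num.sqrt K%:R * sigma ^+ 2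
                  / (Num.sqrt N%:R * T%:R))%:E
             + (kappa ^+ 2 * sigma ^+ 2 / T%:R)%:E))%E.
  move=> T0; have TR : (0 : R) < T%:R by rewrite ltr0n.
  have sT : 0 < Num.sqrt T%:R :> R by rewrite sqrtr_gt0.
  have d0 d : (0 < d)%N -> 0 < 1 / (Num.sqrt d%:R * (1 - lam) `^ (3 / 4) * Num.sqrt T%:R).
    by move=> d0; rewrite divr_gt0 // mulr_gt0 // mulr_gt0 ?sqrtr_gt0 ?ltr0n ?powR_gt0.
  have := expected_run_bound K0 N0 b0 hLf PL sQ nuL WT Wr BxT BxB ByT ByB UxU cUx WUx hax
    UyU cUy WUy hay lam01 p01 pbK (d0 d1 d10) (d0 d2 d20) etax0 etaxy etayL etay3 hsigma BDx BDy
    law T0.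
  rewrite -/(prm T) -/(run T) => h; apply: le_trans h _.
  rewrite !perturbation_bias //.
  have k2 : 0 < kappa ^+ 2 by rewrite exprn_gt0.
  have s20 : 0 <= sigma ^+ 2 by exact: sqr_ge0.
  have A0 : 0 < kappa ^+ 2 / (r * T%:R) by rewrite divr_gt0 // mulr_gt0.
  have B0 : 0 < kappa ^+ 2 * (1 - lam) / T%:R by rewrite divr_gt0 // mulr_gt0.
  apply: lee_affine => //.
  - by apply: expectation_ge0 => w; exact: (merit_ge0 PL).
  - apply: adde_ge0; apply: mule_ge0; rewrite ?lee_fin ?invr_ge0 ?ler0n //;
      by apply: expectation_ge0 => w; exact: sqnorm_ge0.
  - apply: divr_ge0; last by apply: mulr_ge0; rewrite ?sqrtr_ge0 ?ler0n.
    apply: mulr_ge0 => //; apply: mulr_ge0; last exact: sqrtr_ge0.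
    by apply: mulr_ge0; exact: sqr_ge0.
  - by apply: divr_ge0; [apply: mulr_ge0; exact: sqr_ge0|exact: ler0n].
  - have -> : 4 / etax / T%:R = 4 / descent_rate Lf * (kappa ^+ 2 / (r * T%:R)).
      by rewrite /etax; field; rewrite !gt_eqF.
    apply: (ler_wpM2r (ltW A0)).
    rewrite /C /rate_constant lerDl; apply: mulr_ge0 => //.
    by apply: addr_ge0 => //; apply: mulr_ge0 => //; exact: sqr_ge0.
  - have -> : 4 / etax * (etay * (1 - lam)) / T%:R = 64 * 64 * (kappa ^+ 2 * (1 - lam) / T%:R).
      by rewrite /etax /etay /descent_rate; field; rewrite !gt_eqF.
    apply: (ler_wpM2r (ltW B0)).
    rewrite /C /rate_constant -[leLHS]add0r; apply: lerD; first by rewrite divr_ge0 // ltW.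
    rewrite ler_peMr ?mulr_ge0 //.
    have : 0 <= 64 * Lf ^+ 2 by apply: mulr_ge0 => //; exact: sqr_ge0.
    by move: (64 * Lf ^+ 2) => t t0; lra.
  have T1 : (1 : R) <= T%:R by rewrite ler1n.
  have h := @rate_arith R Lf hLf kappa r T%:R _ lam _ _ sigma etax etay (erefl _) (erefl _) k0 r0 T1
    (erefl _) binv.
  apply: le_trans h _.
  rewrite -/C le_eqVlt; apply/orP; left; apply/eqP; congr (_ * (_ + _ + _)).
  by field; rewrite !gt_eqF.
split=> [T T0|KN D Z hDZ eps /andP[eps0 eps1]]; first exact: main.
pose M := C * (`|D| + 1 + `|Z| + 2 * sigma ^+ 2).
have DZ0 : 0 <= `|D| + 1 + `|Z| + 2 * sigma ^+ 2.
  by rewrite !addr_ge0 // mulr_ge0 // sqr_ge0.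
have M0 : 0 <= M by rewrite mulr_ge0 // ltW.
have k2 : 1 <= kappa ^+ 2 by rewrite expr_ge1 // ltW.
pose M' := (M + 1) * (kappa ^+ 2 / r).
(* Every term of the rate is at most a constant times [kappa^2 / (r T)]: [1 - lam], [lam] and [r]
   are at most 1, and [K <= N] bounds [sqrt K / sqrt N]. *)
have bound T : (0 < T)%N -> (avg_sqgrad P Q (run T) T <= (M' / T%:R)%:E)%E.
  move=> T0; have TR : (0 : R) < T%:R by rewrite ltr0n.
  have [hD hZ] := hDZ T T0.
  have s20 : 0 <= sigma ^+ 2 by exact: sqr_ge0.
  pose A : R := kappa ^+ 2 / (r * T%:R).
  have A0 : 0 < A by apply: divr_gt0; [exact: exprn_gt0|exact: mulr_gt0].
  have hA : kappa ^+ 2 / T%:R <= A.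
    rewrite /A invfM mulrA ler_wpM2r ?invr_ge0 ?ler0n // ler_peMr ?sqr_ge0 //.
    by rewrite invf_ge1.
  have kT0 : 0 <= kappa ^+ 2 / T%:R by rewrite divr_ge0 ?sqr_ge0.
  have KN1 : 0 <= (Num.sqrt K%:R / Num.sqrt N%:R : R) <= 1.
    by rewrite divr_ge0 ?sqrtr_ge0 //= ler_pdivrMr // mul1r ler_sqrt ?ler_nat.
  apply: le_trans (main T T0) _.
  apply: (@le_trans _ _ (C%:E * (A%:E * (`|D|%:E + 1) + A%:E * `|Z|%:E
     + (A * sigma ^+ 2)%:E + (A * sigma ^+ 2)%:E))%E); last first.
    rewrite -[leLHS]/((C * (A * (`|D| + 1) + A * `|Z| + A * sigma ^+ 2 + A * sigma ^+ 2))%:E) lee_fin.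
    have -> : M' / T%:R = (M + 1) * A by rewrite /M' /A; field; rewrite !gt_eqF.
    have -> : C * (A * (`|D| + 1) + A * `|Z| + A * sigma ^+ 2 + A * sigma ^+ 2) = M * A.
      by rewrite /M; ring.
    by rewrite ler_wpM2r ?lerDl ?(ltW A0).
  apply: lee_wpmul2l; first by rewrite lee_fin ltW.
  apply: leeD; first apply: leeD; first apply: leeD.
  - apply: lee_wpmul2l; first by rewrite lee_fin ltW.
    by apply: leeD2r; apply: le_trans hD _; rewrite lee_fin ler_norm.
  - apply: (@le_trans _ _ ((kappa ^+ 2 * (1 - lam) / T%:R)%:E * `|Z|%:E)%E).
      apply: lee_wpmul2l; first rewrite lee_fin.
        by apply: divr_ge0 => //; apply: mulr_ge0; [exact: sqr_ge0|exact: ltW].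
      by apply: le_trans hZ _; rewrite lee_fin ler_norm.
    rewrite -!EFinM lee_fin ler_wpM2r //; apply: le_trans hA.
    by rewrite mulrAC ler_piMr.
  - rewrite lee_fin.
    have -> : kappa ^+ 2 * lam ^+ 2 * Num.sqrt K%:R * sigma ^+ 2 / (Num.sqrt N%:R * T%:R)
      = (kappa ^+ 2 / T%:R) * (lam ^+ 2 * (Num.sqrt K%:R / Num.sqrt N%:R)) * sigma ^+ 2.
      by field; rewrite !gt_eqF.
    rewrite ler_wpM2r //; apply: le_trans hA; rewrite ler_piMr //.
    have /andP[u0 u1] := KN1.
    by rewrite mulr_ile1 ?sqr_ge0 // expr_le1 // ltW.
  by rewrite lee_fin mulrAC ler_wpM2r.
have e20 : 0 < eps ^+ 2 by rewrite exprn_gt0.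
pose X := kappa ^+ 2 * eps ^- 2 / r.
(* Here [eps <= 1] enters, together with [r <= 1 <= kappa]; the rounding of the number of rounds
   relies on this bound. *)
have X1 : 1 <= X.
  rewrite /X ler_pdivlMr // mul1r; apply: le_trans r1 _.
  by rewrite ler_pdivlMr // mul1r; apply: le_trans k2; rewrite expr_le1 // ltW.
have X0 : 0 <= X by apply: le_trans X1.
have MX : M' / eps ^+ 2 = (M + 1) * X by rewrite /M' /X; field; rewrite !gt_eqF.
have M1 : 1 <= M' / eps ^+ 2.
  by rewrite MX; apply: le_trans X1 _; rewrite ler_peMl // lerDr.
have [CC hCC CCle] := communication_complexity_le M1 eps0 bound.
move: CCle; rewrite MX mulrA => CCle.
have M20 : 0 <= 2 * (M + 1) by rewrite mulr_ge0 // addr_ge0.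
have CE : 2 * (M + 1) <= 10 * (2 * (M + 1)) by rewrite ler_peMl // ler1n.
exists CC; split=> //.
- apply: le_trans CCle _; rewrite -/r -/M -/X; apply: ler_pM => //.
  by rewrite lerDl mulr_ge0 ?sqr_ge0 // invr_ge0 ltW.
apply: le_trans (function_queries_le d1 d2 K0 KN (ltW b_lt) CCle) _.
rewrite -/r -/M.
have -> : (d1 + d2)%:R * kappa ^+ 2 * Num.sqrt N%:R * eps ^- 2 / (Num.sqrt K%:R * r)
  = (d1 + d2)%:R * (X * Num.sqrt (N%:R / K%:R)).
  by rewrite rhoE /X; field; rewrite !gt_eqF.
rewrite [leRHS]mulrDr; apply: lerD.
  by rewrite le_eqVlt; apply/orP; left; apply/eqP; ring.
rewrite ler_wpM2r ?mulr_ge0 ?sqrtr_ge0 //.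
by move: M0; clear; move: M => m; lra.
Qed.
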